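(* For every integer $n\ge 4$ and every $a\in(0,1)$ there is a complete, smooth, rotationally symmetric (about the origin $0$) Riemannian metric $g_a$ on $\mathbb{R}^n$ such that: (1) all sectional curvatures of $g_a$ are nonnegative, and $(\mathbb{R}^n,g_a)$ is nonflat; (2) the asymptotic volume ratio satisfies $$\lim_{R\to\infty}\frac{\operatorname{Vol}_{g_a}(B_R(0))}{\omega_n R^n}=a^{n-2}>0;$$ (3) the normalized minimal positive Green function $G$ of $(\mathbb{R}^n,g_a)$ with pole $0$ exists, and the function $b=G^{1/(2-n)}$ satisfies $$|\nabla b|^2=\left(\frac{1+ar^2}{1+r^2}\right)^2,$$ where $r$ is the $g_a$-distance to $0$; in particular $|\nabla b|^2$ extends smoothly across the pole $0$; (4) the scalar curvature at the pole is $$\operatorname{Scal}_{g_a}(0)=2n(n-4)(1-a).$$ Thus $\operatorname{Scal}_{g_a}(0)>0$ whenever $n\ge 5$, while for $n=4$ one has $\operatorname{Scal}_{g_a}(0)=0$ although the metric is still nonflat.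
   Context: $\omega_n$ is the volume of the unit ball in Euclidean $\mathbb{R}^n$, and $B_R(0)$ is the $g_a$-geodesic ball of radius $R$ about $0$. $\Delta=\operatorname{div}\nabla$. A manifold is nonparabolic if it admits a minimal positive Green function. The minimal positive Green function $G(p,\cdot)$ with pole $p$ is normalized by $-\Delta G(p,\cdot)=(n-2)|\mathbb{S}^{n-1}|\,\delta_p$ (distributionally) and $G(p,x)=r(x)^{2-n}(1+o(1))$ as $x\to p$, where $r(x)=d(p,x)$ and $|\mathbb{S}^{n-1}|$ is the volume of the unit sphere in $\mathbb{R}^n$; thus $G(p,x)=|x-p|^{2-n}$ on Euclidean space. *)

(* Defs.v *)
From HB Require Import structures.
From mathcomp Require Import all_boot all_order all_algebra.
From mathcomp Require Import all_classical all_reals all_analysis.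

Set Implicit Arguments.
Unset Strict Implicit.
Unset Printing Implicit Defensive.

Import Order.TTheory GRing.Theory Num.Theory.
Import numFieldNormedType.Exports.

Local Open Scope classical_set_scope.
Local Open Scope ring_scope.

(* The coordinate sigma-algebra on 'rV[R]_n, i.e. the Borel sets of R^n; this
   follows the library's sigma-algebra on n.-tuple. *)
Definition rV_display : measure_display -> measure_display.
Proof. exact. Qed.

Section measurable_rV.
Context {R : realType}.
Variable n : nat.

Let coors : 'I_n -> 'rV[R]_n -> measurableTypeR R := fun i x => x 0 i.

Let rV_set0 : g_sigma_preimage coors set0.
Proof. exact: sigma_algebra0. Qed.

Let rV_setC A : g_sigma_preimage coors A -> g_sigma_preimage coors (~` A).
Proof. exact: sigma_algebraC. Qed.

Let rV_bigcup (F : _^nat) : (forall i, g_sigma_preimage coors (F i)) ->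
  g_sigma_preimage coors (\bigcup_i (F i)).
Proof. exact: sigma_algebra_bigcup. Qed.

HB.instance Definition _ := @isMeasurable.Build
  (rV_display (R.-ocitv.-measurable).-sigma) 'rV[R]_n
  (g_sigma_preimage coors) rV_set0 rV_setC rV_bigcup.

End measurable_rV.

Section lebesgue_measure_rV.
Context {R : realType}.

Lemma measurable_coord n (i : 'I_n) :
  measurable_fun [set: 'rV[R]_n] (fun x => x 0 i : measurableTypeR R).
Proof.
move=> _ Y mY; rewrite setTI; apply: sub_sigma_algebra => /=.
rewrite -bigcup_seq/=; exists i => /=; first by rewrite mem_index_enum.
by exists Y => //; rewrite setTI.
Qed.

Lemma measurable_fun_rV d (T : measurableType d) n (f : T -> 'rV[R]_n) :
  (forall i, measurable_fun [set: T] (fun t => f t 0 i : measurableTypeR R)) ->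
  measurable_fun [set: T] f.
Proof.
move=> mf.
suff S : g_sigma_preimage (fun i t => f t 0 i : measurableTypeR R) `<=` measurable.
  move=> _ A mA; apply: S.
  have := g_sigma_preimage_comp (fun (i : 'I_n) (x : 'rV[R]_n) => x 0 i : measurableTypeR R) f.
  rewrite /comp => ->; by exists A.
apply: smallest_sub; first exact: sigma_algebra_measurable.
rewrite -bigcup_seq; apply: bigcup_sub => i _ A [B mB <-].
exact: mf.
Qed.

Definition rV_cons n (p : measurableTypeR R * 'rV[R]_n) : 'rV[R]_n.+1 :=
  row_mx (p.1)%:M p.2.

Lemma measurable_rV_cons n : measurable_fun setT (@rV_cons n).
Proof.
apply: measurable_fun_rV => i.
case: (splitP (i : 'I_(1 + n))) => j ij.
  rewrite (_ : (fun _ => _) = fst); first exact: measurable_fst.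
  apply/funext => -[t x]; rewrite /rV_cons /=.
  have -> : i = lshift n j by apply: val_inj.
  by rewrite (row_mxEl t%:M x) ord1 mxE eqxx mulr1n.
rewrite (_ : (fun _ => _) = (fun x : 'rV[R]_n => x 0 j : measurableTypeR R) \o snd); last first.
  apply/funext => -[t x]; rewrite /rV_cons /=.
  have -> : i = rshift 1 j by apply: val_inj.
  by rewrite (row_mxEr t%:M x).
by apply: measurableT_comp; [exact: measurable_coord|exact: measurable_snd].
Qed.

Definition rV_uncons n (x : 'rV[R]_n.+1) : measurableTypeR R * 'rV[R]_n :=
  (x 0 0, \row_(i < n) x 0 (lift 0 i)).

Lemma rV_consK n : cancel (@rV_cons n) (@rV_uncons n).
Proof.
move=> [t x]; rewrite /rV_uncons /rV_cons; congr pair.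
  rewrite (_ : 0 = lshift n (0 : 'I_1)); last exact: val_inj.
  by rewrite (row_mxEl t%:M x) mxE eqxx mulr1n.
apply/rowP => i; rewrite mxE.
rewrite (_ : lift 0 i = rshift 1 i); last exact: val_inj.
by rewrite (row_mxEr t%:M x).
Qed.

Lemma measurable_rV_uncons n : measurable_fun setT (@rV_uncons n).
Proof.
apply: measurable_fun_pair; first exact: measurable_coord.
apply: measurable_fun_rV => i.
rewrite (_ : (fun _ => _) =
    (fun x : 'rV[R]_n.+1 => x 0 (lift 0 i) : measurableTypeR R)).
  exact: measurable_coord.
by apply/funext => x; rewrite mxE.
Qed.

Section step.
Variables (n : nat) (m : {sigma_finite_measure set 'rV[R]_n -> \bar R}).

Definition lebesgue_rV_step : set 'rV[R]_n.+1 -> \bar R :=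
  pushforward (lebesgue_measure \x m)%E (@rV_cons n).

Let step0 : lebesgue_rV_step set0 = 0%E.
Proof. by rewrite /lebesgue_rV_step /pushforward preimage_set0 measure0. Qed.

Let step_ge0 A : (0 <= lebesgue_rV_step A)%E.
Proof. by rewrite /lebesgue_rV_step /pushforward measure_ge0. Qed.

Let step_sigma_additive : semi_sigma_additive lebesgue_rV_step.
Proof.
move=> F mF tF mUF; rewrite /lebesgue_rV_step /pushforward preimage_bigcup.
apply: measure_semi_sigma_additive.
- by move=> k; rewrite -[X in measurable X]setTI; exact: measurable_rV_cons.
- apply/trivIsetP => /= i j _ _ ij; rewrite -preimage_setI.
  by move/trivIsetP : tF => /(_ _ _ _ _ ij) ->//; rewrite preimage_set0.
- rewrite -preimage_bigcup -[X in measurable X]setTI.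
  exact: measurable_rV_cons.
Qed.

HB.instance Definition _ := isMeasure.Build _ _ _
  lebesgue_rV_step step0 step_ge0 step_sigma_additive.

Let step_sigma_finite : sigma_finite setT lebesgue_rV_step.
Proof.
have /sigma_finiteP[F [TF ndF Foo]] :=
  sigma_finiteT (@lebesgue_measure R : {sigma_finite_measure set _ -> \bar R}).
have /sigma_finiteP[G [TG ndG Goo]] := sigma_finiteT m.
have pre k : @rV_cons n @^-1` (@rV_uncons n @^-1` (F k `*` G k)) = F k `*` G k.
  rewrite -comp_preimage (_ : _ \o _ = id) ?preimage_id//.
  by apply/funext => p; exact: rV_consK.
exists (fun k => @rV_uncons n @^-1` (F k `*` G k)).
  rewrite -preimage_bigcup -[LHS](preimage_setT (@rV_uncons n)); congr (_ @^-1` _).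
  apply/esym/seteqP; split => // -[t x] _.
  have [i _ Fit] : (\bigcup_k F k) t by rewrite -TF.
  have [j _ Gjx] : (\bigcup_k G k) x by rewrite -TG.
  exists (maxn i j) => //; split => /=.
    by move: t Fit; exact/subsetPset/ndF/leq_maxl.
  by move: x Gjx; exact/subsetPset/ndG/leq_maxr.
move=> k; have [mF Fk] := Foo k; have [mG Gk] := Goo k; split.
  rewrite -[X in measurable X]setTI; apply: measurable_rV_uncons => //.
  exact: measurableX.
rewrite /lebesgue_rV_step /pushforward pre product_measure1E//.
by rewrite lte_mul_pinfty// ge0_fin_numE.
Qed.

HB.instance Definition _ := Measure_isSigmaFinite.Build _ _ _
  lebesgue_rV_step step_sigma_finite.

End step.

Fixpoint lebesgue_rV_def n : {sigma_finite_measure set 'rV[R]_n -> \bar R} :=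
  match n with
  | 0 => \d_(0 : 'rV[R]_0)
  | n'.+1 => lebesgue_rV_step (lebesgue_rV_def n')
  end.

Definition lebesgue_rV n : set 'rV[R]_n -> \bar R := lebesgue_rV_def n.
HB.instance Definition _ n := SigmaFiniteMeasure.on (@lebesgue_rV n).

Lemma lebesgue_rV_box n (A : 'I_n -> set (measurableTypeR R)) :
  (forall i, measurable (A i)) ->
  lebesgue_rV [set x | forall i, A i (x 0 i)] =
  (\prod_(i < n) lebesgue_measure (A i))%E.
Proof.
elim: n A => [|n IHn] A mA.
  rewrite big_ord0 /lebesgue_rV /= /dirac indicE mem_set//.
  by case.
rewrite big_ord_recl -IHn; last by move=> i; exact: mA.
have mbox : measurable [set x : 'rV[R]_n | forall i, A (lift ord0 i) (x 0 i)].
  rewrite (_ : mkset _ =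
      \bigcap_(i in [set: 'I_n]) [set x : 'rV[R]_n | A (lift ord0 i) (x 0 i)]).
    apply: fin_bigcap_measurable => // i _.
    rewrite -[X in measurable X]setTI; apply: measurable_coord => //.
  by apply/seteqP; split => [x Ax i _|x Ax i]; exact: Ax.
rewrite -product_measure1E//.
rewrite /lebesgue_rV /= /lebesgue_rV_step /pushforward; congr product_measure1.
apply/seteqP; split => -[t x] /=.
  move=> Atx; split => [|i].
    have := Atx 0; have := congr1 fst (rV_consK (t, x)) => /= -> //.
  have := Atx (lift 0 i).
  by have /(congr1 snd)/= /rowP/(_ i) := rV_consK (t, x); rewrite mxE => ->.
move=> [At Ax] i; case: (unliftP 0 i) => [j ->|->].
  by have /(congr1 snd)/= /rowP/(_ j) := rV_consK (t, x); rewrite mxE => ->.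
by have := congr1 fst (rV_consK (t, x)) => /= ->.
Qed.

End lebesgue_measure_rV.

Section smooth_functions.
Context {R : realType} {n : nat}.
Implicit Types (f : 'rV[R]_n -> R) (U : set 'rV[R]_n).

Definition partial (i : 'I_n) f : 'rV[R]_n -> R :=
  fun x => 'D_(delta_mx 0 i) f x.

(* Only meant for open U. *)
Fixpoint Ck_on (k : nat) U f : Prop :=
  (forall x, U x -> {for x, continuous f}) /\
  if k is k'.+1 then
    forall i : 'I_n, (forall x, U x -> derivable f x (delta_mx 0 i)) /\
                     Ck_on k' U (partial i f)
  else True.

Definition smooth_on U f := forall k, Ck_on k U f.

Definition test_function f :=
  smooth_on setT f /\ compact (closure [set x | f x != 0]).

End smooth_functions.

Section euclidean_constants.
Context {R : realType}.

Definition unit_ball_volume n : R :=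
  fine (lebesgue_rV [set x : 'rV[R]_n | \sum_i x 0 i ^+ 2 < 1]).

(* Surface measure of a subset S of the unit sphere, in polar coordinates:
   n times the volume of the cone {t u | 0 < t <= 1, u in S}. *)
Definition sphere_measure n (S : set 'rV[R]_n) : \bar R :=
  (n%:R%:E *
   lebesgue_rV [set t *: u | t in [set t : R | (0 < t <= 1)%R] & u in S])%E.

Definition unit_sphere_area n : R :=
  fine (sphere_measure [set u : 'rV[R]_n | \sum_i u 0 i ^+ 2 = 1]).

End euclidean_constants.

(* Riemannian geometry of R^n in its global chart: tangent vectors are row
   vectors, a metric is its matrix g x = (g_ij(x)), and <u, v> = u g v^T. *)
Section riemannian_geometry.
Context {R : realType} {n : nat}.
Implicit Types (g : 'rV[R]_n -> 'M[R]_n) (x p q u v w : 'rV[R]_n).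
Implicit Types (f : 'rV[R]_n -> R) (X : 'rV[R]_n -> 'rV[R]_n).

Definition inner g x u v : R := (u *m g x *m v^T) 0 0.

Definition riemannian_metric g :=
  [/\ forall i j, smooth_on setT (fun x => g x i j),
      forall x, (g x)^T = g x &
      forall x v, v != 0 -> 0 < inner g x v v].

(* The differential of the linear map x |-> x A is v |-> v A. *)
Definition rotationally_symmetric g :=
  forall A : 'M[R]_n, A *m A^T = 1%:M ->
  forall x u v, inner g (x *m A) (u *m A) (v *m A) = inner g x u v.

(* Gamma^k_ij *)
Definition christoffel g (k i j : 'I_n) x : R :=
  2^-1 * \sum_l invmx (g x) k l *
    (partial i (fun y => g y j l) x + partial j (fun y => g y i l) x
     - partial l (fun y => g y i j) x).

(* R(e_i, e_j) e_k = \sum_l riemann g l i j k x e_l, with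
   R(X, Y) = [nabla_X, nabla_Y] - nabla_[X, Y]. *)
Definition riemann g (l i j k : 'I_n) x : R :=
  partial i (christoffel g l j k) x - partial j (christoffel g l i k) x
  + \sum_m (christoffel g m j k x * christoffel g l i m x
            - christoffel g m i k x * christoffel g l j m x).

Definition curvature g x u v w : 'rV[R]_n :=
  \row_l \sum_i \sum_j \sum_k
    riemann g l i j k x * u 0 i * v 0 j * w 0 k.

Definition sectional g x u v : R :=
  inner g x (curvature g x u v v) u /
  (inner g x u u * inner g x v v - inner g x u v ^+ 2).

Definition nonneg_sectional g :=
  forall x u v, row_free (col_mx u v) -> 0 <= sectional g x u v.

Definition flat g := forall x u v w, curvature g x u v w = 0.

Definition ricci g (j k : 'I_n) x : R := \sum_i riemann g i i j k x.

Definition scalar_curvature g x : R :=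
  \sum_j \sum_k invmx (g x) j k * ricci g j k x.

(* C^1 arcs are parametrised by [0, 1]; as C^1 maps on [0, 1] extend to R,
   they are taken C^1 on R to have two-sided derivatives at 0 and 1. *)
Definition C1_arc (c : R -> 'rV[R]_n) :=
  (forall t, derivable c t 1) /\ continuous (derive1 c).

Definition arc_length g (c : R -> 'rV[R]_n) : R :=
  \int[lebesgue_measure]_(t in `[0, 1])
    Num.sqrt (inner g (c t) (derive1 c t) (derive1 c t)).

(* Piecewise C^1 curves from p to q, as lists of consecutive arcs. *)
Fixpoint path_between p q (s : seq (R -> 'rV[R]_n)) : Prop :=
  match s with
  | [::] => p = q
  | c :: s' => [/\ C1_arc c, c 0 = p & path_between (c 1) q s']
  end.

Definition dist g p q : R :=
  inf [set \sum_(c <- s) arc_length g c | s in path_between p q].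

Definition geodesic_ball g p (r : R) := [set x | dist g p x < r].

Definition complete_metric g :=
  forall s : nat -> 'rV[R]_n,
    (forall e, 0 < e -> exists N, forall i j, (N <= i)%N -> (N <= j)%N ->
      dist g (s i) (s j) < e) ->
    exists l, (fun i => dist g (s i) l) @ \oo --> 0.

Definition volume_density g x : R := Num.sqrt (\det (g x)).

Definition volume g (A : set 'rV[R]_n) : \bar R :=
  (\int[@lebesgue_rV R n]_(x in A) (volume_density g x)%:E)%E.

Definition grad g f x : 'rV[R]_n := (\row_i partial i f x) *m invmx (g x).

Definition grad_sqnorm g f x : R := inner g x (grad g f x) (grad g f x).

Definition divergence g X x : R :=
  (volume_density g x)^-1 *
  \sum_i partial i (fun y => volume_density g y * X y 0 i) x.

Definition laplacian g f : 'rV[R]_n -> R := divergence g (grad g f).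

Definition locally_integrable_wrt g f :=
  measurable_fun setT f /\
  forall K, compact K ->
    (\int[@lebesgue_rV R n]_(x in K) (`|f x| * volume_density g x)%:E < +oo)%E.

(* Values at the pole itself are irrelevant. *)
Definition green_function g p (G : 'rV[R]_n -> R) :=
  [/\ smooth_on (~` [set p]) G,
      locally_integrable_wrt g G,
      forall phi, test_function phi ->
        \int[@lebesgue_rV R n]_x
          (G x * - laplacian g phi x * volume_density g x) =
        (n%:R - 2) * unit_sphere_area n * phi p &
      (fun x => G x / dist g p x `^ (2 - n%:R)) @ p^' --> (1 : R)].

Definition positive_off p f := forall x, x != p -> 0 < f x.

Definition minimal_positive_green g p (G : 'rV[R]_n -> R) :=
  [/\ green_function g p G, positive_off p G &
      forall H, green_function g p H -> positive_off p H ->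
        forall x, x != p -> G x <= H x].

End riemannian_geometry.

(* Main.v *)
Require Import Defs.
From HB Require Import structures.
From mathcomp Require Import all_boot all_order all_algebra.
From mathcomp Require Import all_classical all_reals all_analysis.
From mathcomp Require Import measurable_realfun.
From mathcomp Require Import ring lra.

Set Implicit Arguments.
Unset Strict Implicit.
Unset Printing Implicit Defensive.

Import Order.TTheory GRing.Theory Num.Theory.
Import numFieldNormedType.Exports.

Local Open Scope classical_set_scope.
Local Open Scope ring_scope.

(** In polar coordinates about the origin a rotationally symmetric metric is
    dr^2 + f(r)^2 dtheta^2, and its radial Green function satisfies
    G' = -(n-2) f^(1-n), that is b' = (b / f)^(n-1) for b = G^(1/(2-n)). Hence
    the required value (1 + a r^2) / (1 + r^2) of |grad b| determines b by
    integration, and then f = b (b')^(-1/(n-1)). With t = r^2 this reads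
    b = r p(t), b' = beta(t) and f = r phi(t), where beta = [slope],
    p = a + (1 - a) arctan(sqrt t) / sqrt t is [height], and
    phi = p beta^(-m) with m = 1/(n-1) is [warp]. These are smooth functions of t
    near [0, +oo[, since arctan(sqrt t) / sqrt t is an integral depending
    smoothly on t. So in the chart of geodesic normal coordinates the metric
    [gmx] is A(t) I + B(t) x^T x with A = phi^2 and A + t B = 1, which is smooth
    across the origin.

    Curvature. The planes containing the radial direction have curvature -f''/f,
    those tangent to the spheres (1 - f'^2) / f^2. After clearing denominators
    f'' <= 0 is a polynomial inequality in t and p <= 1, valid because
    m <= 1/3, i.e. n >= 4; moreover f'(0) = 1 and f' >= 0. At the origin both
    curvatures equal -6 phi'(0) = 2 (1 - a) (1 - 3m), which gives the scalar
    curvature 2n(n-4)(1-a) and vanishes for n = 4; but -f''/f is positive away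
    from the origin, so the metric is never flat ([nonneg_sectional_gmx],
    [not_flat_gmx], [scalar_curvature_gmx]).

    Distance and volume. The metric lies between a^2 and 1 times the Euclidean
    one and dominates dr^2, so that it is complete and the distance to 0 is |x|
    ([complete_gmx], [dist0]). The volume density phi^(n-1) = p^(n-1) / beta is at
    most 1 and tends to a^(n-2) at infinity, and its averages over balls have the
    same limit ([volume_ratio]).

    Green function. By construction the volume density times grad G is the
    Euclidean field -(n-2) x / |x|^n. Regularising G as a function of |x|^2 + e
    and integrating by parts, the distributional equation becomes the
    convergence, as e tends to 0, to the integral of x . grad phi / |x|^n, which
    is -n omega_n phi(0) ([green_identity]). This last value is obtained without
    surface measures: |x|^(-n) is the integral of n s^(-n-1) over s > |x|, and
    after Tonelli's theorem and the substitution x = s y the integrand is a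
    derivative along each ray ([polar_integral], [integral_euler]).

    Minimality. Another positive Green function H solves the equation weakly,
    hence classically, off the pole ([div_flux_eq0]). It is asymptotic to G at the
    pole, and G tends to 0 at infinity; so for k < 1 the function
    H - k (G - G(r)) is positive near the pole and on the sphere of radius r, and
    by the maximum principle between them ([green_le]). The strict inequality
    that the maximum principle needs comes from adding a small multiple of
    r^2 - |x|^2. *)

(** * Directional derivatives, pointwise form *)

Section directional_derivatives.
Context {R : realType} {V : normedModType R}.
Implicit Types (f g : V -> R) (x v : V) (d df dg dh : R).

Lemma isd_eq f x v d d' : is_derive x v f d -> d = d' -> is_derive x v f d'.
Proof. by move=> + <-. Qed.

Lemma isd_cst (c : R) x v : is_derive x v (fun=> c) 0.
Proof. exact: is_derive_cst. Qed.

Lemma isd_add f g x v df dg : is_derive x v f df -> is_derive x v g dg ->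
  is_derive x v (fun y => f y + g y) (df + dg).
Proof. exact: is_deriveD. Qed.

Lemma isd_opp f x v df : is_derive x v f df -> is_derive x v (fun y => - f y) (- df).
Proof. exact: is_deriveN. Qed.

Lemma isd_sub f g x v df dg : is_derive x v f df -> is_derive x v g dg ->
  is_derive x v (fun y => f y - g y) (df - dg).
Proof. exact: is_deriveB. Qed.

Lemma isd_mul f g x v df dg : is_derive x v f df -> is_derive x v g dg ->
  is_derive x v (fun y => f y * g y) (df * g x + f x * dg).
Proof.
move=> hf hg; apply: (isd_eq (is_deriveM hf hg)).
by rewrite /GRing.scale /= addrC [g x * df]mulrC.
Qed.

Lemma isd_cmul (c : R) f x v df : is_derive x v f df ->
  is_derive x v (fun y => c * f y) (c * df).
Proof.
move=> hf; apply: (isd_eq (isd_mul (isd_cst c x v) hf)).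
by rewrite mul0r add0r.
Qed.

Lemma isd_sum n (f : 'I_n -> V -> R) x v (df : 'I_n -> R) :
  (forall i, is_derive x v (f i) (df i)) ->
  is_derive x v (fun y => \sum_i f i y) (\sum_i df i).
Proof.
move=> h; have := is_derive_sum h.
by rewrite (_ : \sum_i f i = fun y => \sum_i f i y)//; apply/funext => y; rewrite fct_sumE.
Qed.

Lemma isd_comp f (h : R -> R) x v df dh :
  is_derive x v f df -> is_derive (f x) 1 h dh ->
  is_derive x v (fun y => h (f y)) (dh * df).
Proof.
move=> [ef vf] hh.
have line (k : V -> R) d : is_derive x v k d <->
    is_derive (0 : R) 1 (fun t : R => k (t *: v + x)) d.
  have E : (fun t : R => t^-1 *: ((k \o shift x) (t *: v) - k x)) =
      (fun t : R => t^-1 *: (((fun s : R => k (s *: v + x)) \o shift 0) (t *: 1)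
        - (fun s : R => k (s *: v + x)) 0)).
    by apply/funext => t /=; rewrite addr0 scale0r add0r [_%:A]mulr1.
  by split=> -[h1 h2]; split; rewrite /derivable /derive; move: h1 h2;
    rewrite /derivable /derive E.
apply/line; have /line : is_derive x v f df by split.
move=> h2; have h3 : is_derive ((fun t : R => f (t *: v + x)) 0) 1 h dh.
  by rewrite /= scale0r add0r.
exact: (@is_derive1_comp R h _ 0 dh df h3 h2).
Qed.

Lemma is_derive_line f x v (t : R) d : is_derive (x + t *: v) v f d ->
  is_derive t 1 (fun s : R => f (x + s *: v)) d.
Proof.
move=> [h1 h2]; have E : (fun h : R => h^-1 *: ((f \o shift (x + t *: v)) (h *: v) - f (x + t *: v)))
  = (fun h : R => h^-1 *: (((fun s : R => f (x + s *: v)) \o shift t) (h *: 1)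
        - (fun s : R => f (x + s *: v)) t)).
  apply/funext => h /=; congr (_ *: (f _ - _)).
  by rewrite addrCA -scalerDl [h%:A]mulr1.
by split; move: h1 h2; rewrite /derivable /derive E.
Qed.

Lemma continuous_near_eq (f g : V -> R) x : (\near x, f x = g x) ->
  {for x, continuous f} -> {for x, continuous g}.
Proof.
move=> fg cf; have : g @ x --> f x by apply: cvg_trans cf; exact: near_eq_cvg.
by rewrite (nbhs_singleton fg).
Qed.

End directional_derivatives.

(** * Functions of class C^k along a family of directions *)

Section Ck.
Context {R : realType} {V : normedModType R} {I : Type}.
Variable dirs : I -> V.
Implicit Types (U : set V) (f g : V -> R).

(** The same recursion as [Ck_on], for an arbitrary family of directions: with
    [V = R] and the single direction [1] it describes functions of one
    variable, so that closure properties are proved once. *)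
Fixpoint Ck (k : nat) U f : Prop :=
  (forall x, U x -> {for x, continuous f}) /\
  if k is k'.+1 then
    forall i, (forall x, U x -> derivable f x (dirs i)) /\
              Ck k' U (fun x => 'D_(dirs i) f x)
  else True.

Definition smooth U f := forall k, Ck k U f.

Lemma Ck_continuous k U f : Ck k U f -> forall x, U x -> {for x, continuous f}.
Proof. by case: k => [|k] []. Qed.

Lemma CkS k U f : Ck k.+1 U f -> Ck k U f.
Proof.
elim: k f => [|k IH] f; first by case.
by case=> cf h; split => // i; have [h1 h2] := h i; split => //; exact: IH.
Qed.

Lemma Ck_sub k U U' f : U' `<=` U -> Ck k U f -> Ck k U' f.
Proof.
move=> sU; elim: k f => [|k IH] f [cf h]; split => //; try by move=> x /sU/cf.
by move=> i; have [h1 h2] := h i; split; [move=> x /sU/h1|exact: IH].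
Qed.

Lemma Ck_ext k U f g : open U -> (forall x, U x -> f x = g x) ->
  Ck k U f -> Ck k U g.
Proof.
move=> oU; elim: k f g => [|k IH] f g fg [cf h].
all: have nfg x : U x -> \near x, f x = g x by
  move=> Ux; apply: filterS (open_nbhs_nbhs (conj oU Ux)).
all: have cg x : U x -> {for x, continuous g} by
  move=> Ux; apply: continuous_near_eq (cf x Ux); exact: nfg.
  by split.
split => // i; have [h1 h2] := h i; split.
  by move=> x Ux; apply: near_eq_derivable (h1 x Ux); exact: nfg.
by apply: IH h2 => x Ux; apply: near_eq_derive; exact: nfg.
Qed.

Lemma CkSI k U f (df : I -> V -> R) : open U ->
  (forall x, U x -> {for x, continuous f}) ->
  (forall i x, U x -> is_derive x (dirs i) f (df i x)) ->
  (forall i, Ck k U (df i)) -> Ck k.+1 U f.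
Proof.
move=> oU cf h hk; split => // i; split => [x Ux|].
  by have [] := h i x Ux.
apply: Ck_ext (hk i) => // x Ux; by have [_ ->] := h i x Ux.
Qed.

Lemma Ck_derive k U f i x : Ck k.+1 U f -> U x ->
  is_derive x (dirs i) f ('D_(dirs i) f x).
Proof. by move=> [_ /(_ i)[h _]] Ux; apply/derivableP/h. Qed.

Lemma Ck_partial k U f i : Ck k.+1 U f -> Ck k U (fun x => 'D_(dirs i) f x).
Proof. by move=> [_ /(_ i)[_ h]]. Qed.

Lemma Ck_cst k U (c : R) : open U -> Ck k U (fun=> c).
Proof.
move=> oU; elim: k c => [|k IH] c; first by split => // x _; exact: cst_continuous.
apply: (@CkSI _ _ _ (fun _ _ => 0)) => //.
by move=> x _; exact: cst_continuous.
Qed.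

Lemma Ck_add k U f g : open U -> Ck k U f -> Ck k U g ->
  Ck k U (fun x => f x + g x).
Proof.
move=> oU; elim: k f g => [|k IH] f g hf hg.
  by split=> // x Ux; apply: continuousD; [exact: (Ck_continuous hf)|exact: (Ck_continuous hg)].
apply: CkSI => //.
- by move=> x Ux; apply: continuousD; [exact: (Ck_continuous hf)|exact: (Ck_continuous hg)].
- by move=> i x Ux; exact: (isd_add (Ck_derive i hf Ux) (Ck_derive i hg Ux)).
- by move=> i; apply: IH; exact: Ck_partial.
Qed.

Lemma Ck_mul k U f g : open U -> Ck k U f -> Ck k U g ->
  Ck k U (fun x => f x * g x).
Proof.
move=> oU; elim: k f g => [|k IH] f g hf hg.
  by split=> // x Ux; apply: continuousM; [exact: (Ck_continuous hf)|exact: (Ck_continuous hg)].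
apply: CkSI => //.
- by move=> x Ux; apply: continuousM; [exact: (Ck_continuous hf)|exact: (Ck_continuous hg)].
- by move=> i x Ux; exact: (isd_mul (Ck_derive i hf Ux) (Ck_derive i hg Ux)).
- move=> i; apply: Ck_add => //; apply: IH; try exact: CkS; exact: Ck_partial.
Qed.

Lemma Ck_sum k U (J : Type) (r : seq J) (P : pred J) (f : J -> V -> R) :
  open U -> (forall j, Ck k U (f j)) -> Ck k U (fun x => \sum_(j <- r | P j) f j x).
Proof.
move=> oU h; elim: r => [|j r IH].
  by apply: Ck_ext (Ck_cst k 0 oU) => // x _; rewrite big_nil.
have H x : \sum_(l <- j :: r | P l) f l x =
    (if P j then f j x else 0) + \sum_(l <- r | P l) f l x.
  by rewrite big_cons; case: ifP => // _; rewrite add0r.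
apply: (Ck_ext oU (f := fun x => (if P j then f j x else 0) + \sum_(l <- r | P l) f l x)) => [x _|].
  by rewrite H.
by apply: Ck_add => //; case: (P j) => //; exact: Ck_cst.
Qed.

Lemma smooth_cst U (c : R) : open U -> smooth U (fun=> c).
Proof. by move=> oU k; exact: Ck_cst. Qed.

Lemma smooth_add U f g : open U -> smooth U f -> smooth U g ->
  smooth U (fun x => f x + g x).
Proof. by move=> oU hf hg k; exact: Ck_add. Qed.

Lemma smooth_mul U f g : open U -> smooth U f -> smooth U g ->
  smooth U (fun x => f x * g x).
Proof. by move=> oU hf hg k; exact: Ck_mul. Qed.

Lemma smooth_opp U f : open U -> smooth U f -> smooth U (fun x => - f x).
Proof.
move=> oU hf k; apply: (Ck_ext oU (f := fun x => -1 * f x)) => [x _|].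
  by rewrite mulN1r.
by apply: Ck_mul => //; exact: Ck_cst.
Qed.

Lemma smooth_sub U f g : open U -> smooth U f -> smooth U g ->
  smooth U (fun x => f x - g x).
Proof. by move=> oU hf hg; apply: smooth_add => //; exact: smooth_opp. Qed.

Lemma smooth_sum U (J : Type) (r : seq J) (P : pred J) (f : J -> V -> R) :
  open U -> (forall j, smooth U (f j)) -> smooth U (fun x => \sum_(j <- r | P j) f j x).
Proof. by move=> oU h k; apply: Ck_sum => // j; exact: h. Qed.

Lemma smooth_ext U f g : open U -> (forall x, U x -> f x = g x) ->
  smooth U f -> smooth U g.
Proof. by move=> oU fg h k; apply: Ck_ext (h k). Qed.

Lemma smooth_sub_set U U' f : U' `<=` U -> smooth U f -> smooth U' f.
Proof. by move=> sU h k; apply: Ck_sub (h k). Qed.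

Lemma smooth_continuous U f x : smooth U f -> U x -> {for x, continuous f}.
Proof. by move=> h; exact: Ck_continuous (h 0%N) x. Qed.

Lemma smooth_is_derive U f i x : smooth U f -> U x ->
  is_derive x (dirs i) f ('D_(dirs i) f x).
Proof. by move=> h; exact: Ck_derive (h 1%N). Qed.

Lemma smooth_partial U f i : smooth U f -> smooth U (fun x => 'D_(dirs i) f x).
Proof. by move=> h k; exact: Ck_partial (h k.+1). Qed.

End Ck.

Definition smooth1 {R : realType} (D : set R) (h : R -> R) :=
  @smooth R R unit (fun=> 1) D h.

Section smooth_compositions.
Context {R : realType} {V : normedModType R} {I : Type}.
Variable dirs : I -> V.
Implicit Types (U : set V) (D : set R) (f g : V -> R) (h : R -> R).

Lemma smooth_comp U D f h : open U -> open D -> smooth1 D h -> smooth dirs U f ->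
  (forall x, U x -> D (f x)) -> smooth dirs U (fun x => h (f x)).
Proof.
move=> oU oD hh hf UD k; elim: k h hh => [|k IH] h hh.
all: have ch x : U x -> {for x, continuous (fun y => h (f y))} by
  move=> Ux; apply: continuous_comp;
    [exact: smooth_continuous hf Ux|exact: smooth_continuous hh (UD _ Ux)].
  by split.
apply: CkSI => //.
- by move=> i x Ux; exact: (isd_comp (smooth_is_derive i hf Ux) (smooth_is_derive tt hh (UD _ Ux))).
- move=> i; apply: Ck_mul => //; last exact: (smooth_partial i hf).
  exact: (IH _ (smooth_partial tt hh)).
Qed.

End smooth_compositions.

Section smooth_one_variable.
Context {R : realType}.
Implicit Types (D U : set R) (f h k w u : R -> R).

Lemma smooth_id U : open U -> smooth1 U (fun x : R => x).
Proof.
move=> oU [|k]; first by split => // x _; exact: cvg_id.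
apply: (@CkSI _ _ _ _ _ _ _ (fun _ _ => 1)) => //.
- by move=> x _; exact: cvg_id.
- by move=> _; exact: Ck_cst.
Qed.

Lemma smooth_family D (hs : nat -> R -> R) : open D ->
  (forall j t, D t -> is_derive t 1 (hs j) (hs j.+1 t)) ->
  forall j, smooth1 D (hs j).
Proof.
move=> oD hd j k.
have ch l t : D t -> {for t, continuous (hs l)}.
  by move=> /(hd l)[/derivable1_diffP/differentiable_continuous + _].
elim: k j => [|k IH] j; first by split => // t /ch.
apply: (@CkSI _ _ _ _ _ _ _ (fun _ => hs j.+1)) => // t; exact: ch.
Qed.

Lemma open_pos : open [set t : R | 0 < t].
Proof. exact: open_gt. Qed.

Lemma smooth_powR (p : R) : smooth1 [set t : R | 0 < t] (fun t => t `^ p).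
Proof.
pose hs j (t : R) := (\prod_(i < j) (p - i%:R)) * t `^ (p - j%:R).
have h j t : [set t : R | 0 < t] t -> is_derive t 1 (hs j) (hs j.+1 t).
  move=> t0; apply: (isd_eq (isd_cmul _ (is_derive1_powR _ t0))).
  by rewrite /hs big_ord_recr /= mulrA -addrA -opprD -natr1.
move=> k; apply: Ck_ext (smooth_family open_pos h 0%N k) => [|t _].
  exact: open_pos.
by rewrite /hs big_ord0 mul1r subr0.
Qed.

End smooth_one_variable.
(** * Integrals depending on a parameter *)

Section parametric_integrals.
Context {R : realType}.
Implicit Types (k w u : R -> R) (t s : R).
Local Notation leb := (@lebesgue_measure R).

Definition param_integral w u k t : R :=
  \int[leb]_(s in `[0, 1]) (w s * k (t * u s)).

Let D : set R := [set t | -1 < t].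

Lemma integrable_cont01 (f : R -> R) :
  (forall s, 0 <= s <= 1 -> {for s, continuous f}) ->
  leb.-integrable `[0, 1] (EFin \o f).
Proof.
move=> cf; apply: continuous_compact_integrable; first exact: segment_compact.
apply: continuous_in_subspaceT => s; rewrite inE/= in_itv/=; exact: cf.
Qed.

Lemma open_gtm1 : open D. Proof. exact: open_gt. Qed.

Section derivative.
Variables (w u k k' : R -> R).
Hypotheses (cw : continuous w) (cu : continuous u)
  (u01 : forall s, 0 <= s <= 1 -> 0 <= u s <= 1)
  (dk : forall t, D t -> is_derive t 1 k (k' t))
  (ck' : forall t, D t -> {for t, continuous k'}).

Lemma param_integral_dom t s : D t -> 0 <= s <= 1 -> D (t * u s).
Proof.
rewrite /D /= => t1 /u01/andP[u0 u1].
have [t0|t0] := leP 0 t; first by rewrite (lt_le_trans (ltrN10 _))// mulr_ge0.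
apply: lt_le_trans t1 _; rewrite -[leLHS]mulr1 ler_nM2l //.
Qed.

Lemma param_integral_derive t : D t ->
  is_derive t 1 (param_integral w u k) (param_integral (fun s => w s * u s) u k' t).
Proof.
move=> Dt; rewrite /D/= in Dt.
pose lo := (t - 1) / 2; pose hi := t + 1.
have lo1 : -1 < lo by rewrite /lo; lra.
have lot : lo < t by rewrite /lo; lra.
have thi : t < hi by rewrite /hi; lra.
have ck x : D x -> {for x, continuous k}.
  by move=> /dk[/derivable1_diffP/differentiable_continuous + _].
pose f x s := w s * k (x * u s).
have df x s : D x -> 0 <= s <= 1 -> is_derive x 1 (f ^~ s) (w s * (u s * k' (x * u s))).
  move=> Dx s01; apply: isd_cmul.
  have h1 : is_derive x 1 (fun x : R => x * u s) (u s).
    by apply: (isd_eq (isd_mul (is_derive_id x 1) (isd_cst (u s) x 1))); rewrite mulr0 addr0 mul1r.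
  apply: (isd_eq (isd_comp h1 (dk (param_integral_dom Dx s01)))).
  by rewrite mulrC.
have cf x : D x -> forall s, 0 <= s <= 1 -> {for s, continuous (f x)}.
  move=> Dx s s01; apply: continuousM; first exact: cw.
  apply: (@continuous_comp _ _ _ (fun s => x * u s) k).
    by apply: continuousM; [exact: cst_continuous|exact: cu].
  by apply: ck; exact: param_integral_dom.
have sub x : x \in `]lo, hi[ -> D x by rewrite in_itv/= /D/= => /andP[+ _]; lra.
(* The derivative of the integrand is bounded by compactness, uniformly in the
   parameter near t. *)
pose lo0 := Num.min lo 0.
have hi0 : 0 <= hi by rewrite /hi; lra.
have loD y : lo0 <= y -> D y.
  by rewrite /D /= /lo0; case: (leP lo 0) => ? ?; lra.
have [C C0 HC] : exists2 C : R, 0 <= C & forall x s, x \in `]lo, hi[ -> 0 <= s <= 1 ->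
    `|w s * (u s * k' (x * u s))| <= C.
  have lohi : lo0 <= hi by rewrite /lo0; case: (leP lo 0) => ?; lra.
  have ck'i : {within `[lo0, hi], continuous (fun y => `|k' y|)}.
    apply: continuous_in_subspaceT => y; rewrite inE/= in_itv/= => /andP[y0 y1].
    by apply: (@continuous_comp _ _ _ k' (@Num.norm R R)); [exact: ck' (loD _ y0)|exact: norm_continuous].
  have cwi : {within `[0, 1], continuous (fun y => `|w y|)}.
    apply: continuous_in_subspaceT => y _.
    by apply: (@continuous_comp _ _ _ w (@Num.norm R R)); [exact: cw|exact: norm_continuous].
  have [c1 c1i H1] := EVT_max lohi ck'i.
  have [c2 c2i H2] := EVT_max ler01 cwi.
  exists (`|w c2| * `|k' c1|); first by rewrite mulr_ge0.
  move=> x s; rewrite in_itv/= => /andP[lx xh] s01; have /andP[s0 s1] := s01.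
  have /andP[us0 us1] := u01 s01.
  rewrite normrM ler_pM//; first by apply: H2; rewrite in_itv/= s0.
  rewrite normrM ger0_norm// -[leRHS]mul1r ler_pM//.
  apply: H1; rewrite in_itv/=; apply/andP; split.
    rewrite /lo0; case: (leP lo 0) => l0.
      have [x0|x0] := leP 0 x; first by rewrite (le_trans l0)// mulr_ge0.
      by rewrite (le_trans (ltW lx))// -[leLHS]mulr1 ler_nM2l.
    by rewrite mulr_ge0//; lra.
  have [x0|x0] := leP 0 x; last by rewrite (le_trans _ hi0)// mulr_le0_ge0// ltW.
  by rewrite (le_trans _ (ltW xh))// -[leRHS]mulr1 ler_wpM2l.
have tI : [set` `]lo, hi[] t by rewrite /= in_itv/= lot thi.
have key := @cvg_differentiation_under_integral R _ _ leb f `[0, 1]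
  (measurable_itv _) t lo hi tI.
have d1 x s : x \in `]lo, hi[ -> 0 <= s <= 1 ->
  partial1of2 f x s = w s * (u s * k' (x * u s)).
  by move=> xi s01; rewrite partial1of2E; have [_ ->] := df x s (sub _ xi) s01.
have E : \int[leb]_(s in `[0, 1]) partial1of2 f t s =
    param_integral (fun s => w s * u s) u k' t.
  apply: eq_Rintegral => s; rewrite inE/= in_itv/= => s01.
  by rewrite d1 ?mulrA// in_itv/= lot thi.
have {}key : (h^-1 *: (((param_integral w u k) \o shift t) (h *: 1) - param_integral w u k t)) @[h --> 0^'] --> param_integral (fun s => w s * u s) u k' t.
  under eq_cvg do rewrite /= [_%:A]mulr1.
  rewrite -E; apply: (key _ _ (cst C)) => //.
  - by move=> x xI; apply: integrable_cont01; apply: cf; exact: sub.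
  - by move=> x s xI; rewrite /= in_itv/= => s01; have [] := df x s (sub _ xI) s01.
  - apply: integrable_cont01 => s _; exact: cst_continuous.
  - by move=> x s xI; rewrite /= in_itv/= => s01; rewrite d1//; exact: HC.
by split; [apply/cvg_ex; exists (param_integral (fun s => w s * u s) u k' t)|exact/cvg_lim].
Qed.

End derivative.

Lemma smooth_param_integral w u k : continuous w -> continuous u ->
  (forall s, 0 <= s <= 1 -> 0 <= u s <= 1) -> smooth1 D k ->
  smooth1 D (param_integral w u k).
Proof.
move=> cw cu u01 hk j; elim: j w k cw hk => [|j IH] w k cw hk.
all: have dk t : D t -> is_derive t 1 k ('D_1 k t) by
  move=> Dt; exact: (smooth_is_derive tt hk Dt).
all: have hk' : smooth1 D (fun t => 'D_1 k t) by exact: (smooth_partial tt hk).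
all: have dP := fun t Dt => @param_integral_derive w u k _ cw cu u01 dk
   (fun t Dt => smooth_continuous hk' Dt) t Dt.
all: have cP t : D t -> {for t, continuous (param_integral w u k)} by
   move=> /dP[/derivable1_diffP/differentiable_continuous + _].
  by split.
apply: (@CkSI _ _ _ _ _ _ _ (fun _ => param_integral (fun s => w s * u s) u (fun t => 'D_1 k t))) => [||_]; first exact: open_gtm1.
- exact: cP.
- apply: IH => //.
  by move=> s; apply: continuousM; [exact: cw|exact: cu].
Qed.

End parametric_integrals.
Section calculus_on_intervals.
Context {R : realType}.
Implicit Types (f F : R -> R) (x d s t y : R).
Local Notation leb := (@lebesgue_measure R).

Lemma is_derive_continuous f x d : is_derive x 1 f d -> {for x, continuous f}.
Proof. by move=> [/derivable1_diffP/differentiable_continuous + _]. Qed.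

Lemma is_derive_unique f x d (d' : R) : is_derive x 1 f d -> is_derive x 1 f d' -> d = d'.
Proof. by move=> [_ <-] [_ <-]. Qed.

Lemma FTC01 F f : (forall s, 0 <= s <= 1 -> is_derive s 1 F (f s)) ->
  (forall s, 0 <= s <= 1 -> {for s, continuous f}) ->
  \int[leb]_(s in `[0, 1]) f s = F 1 - F 0.
Proof.
move=> dF cf; rewrite /Rintegral (@continuous_FTC2 R f F 0 1) ?ltr01//.
- apply: continuous_in_subspaceT => s; rewrite inE/= in_itv/=; exact: cf.
- have cF s : 0 <= s <= 1 -> {for s, continuous F} by move=> /dF; exact: is_derive_continuous.
  split.
  + by move=> s; rewrite in_itv/= => /andP[/ltW s0 /ltW s1]; have [] := dF s (introT andP (conj s0 s1)).
  + by apply: cvg_at_right_filter; apply: cF; rewrite lexx ler01.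
  + by apply: cvg_at_left_filter; apply: cF; rewrite lexx ler01.
- move=> s; rewrite in_itv/= => /andP[/ltW s0 /ltW s1].
  by rewrite derive1E; have [_ ->] := dF s (introT andP (conj s0 s1)).
Qed.

Lemma derive_le0_nincr f f' (a : R) :
  (forall t, a <= t -> is_derive t 1 f (f' t)) -> (forall t, a <= t -> f' t <= 0) ->
  forall x y, a <= x -> x <= y -> f y <= f x.
Proof.
move=> df f'0 x y ax xy; apply: (@ler0_derive1_nincry _ f a) => //.
- by move=> t; rewrite in_itv/= andbT => /ltW/df[].
- move=> t; rewrite in_itv/= andbT => /ltW ta; rewrite derive1E.
  by have [_ ->] := df t ta; exact: f'0.
- apply: continuous_in_subspaceT => t; rewrite inE/= in_itv/= andbT => /df.
  exact: is_derive_continuous.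
Qed.

Lemma isd_id x : is_derive x 1 (fun y : R => y) 1.
Proof. exact: is_derive_id. Qed.

Lemma isd_inv f x d : is_derive x 1 f d -> f x != 0 ->
  is_derive x 1 (fun y => (f y)^-1) (- d / f x ^+ 2).
Proof.
move=> df f0; have [h1 h2] := is_deriveV f0 df; split => //; rewrite h2.
by rewrite /GRing.scale /= mulNr mulrC mulNr.
Qed.

Lemma isd_sqr f x d : is_derive x 1 f d ->
  is_derive x 1 (fun y => f y ^+ 2) (2 * f x * d).
Proof.
move=> df; have := isd_mul df df.
rewrite (_ : (fun y => f y * f y) = (fun y => f y ^+ 2)).
  by move=> h; apply: (isd_eq h); ring.
by apply/funext => y; rewrite expr2.
Qed.

Lemma continuous_fun_cst (c : R) : continuous (fun _ : R => c).
Proof. by move=> x; exact: cst_continuous. Qed.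

Lemma continuous_sqr_comp f x : {for x, continuous f} ->
  {for x, continuous (fun y => f y ^+ 2)}.
Proof.
move=> cf; rewrite (_ : (fun y => f y ^+ 2) = (fun y => f y * f y)).
  exact: continuousM.
by apply/funext => y; rewrite expr2.
Qed.

End calculus_on_intervals.

(** * The radial profile *)

Section profile_definitions.
Context {R : realType}.

(** This is the function arctan (sqrt t) / sqrt t, in a form that is manifestly
    smooth across t = 0. *)
Definition arctan_ratio (t : R) : R :=
  param_integral (fun=> 1) (fun s => s ^+ 2) (fun y => (1 + y)^-1) t.

(** With t = r^2: the derivative of b along a ray, then b / r, then f / r, where
    the metric is dr^2 + f(r)^2 dtheta^2; here m = 1 / (n - 1). *)
Definition slope (a t : R) : R := (1 + a * t) / (1 + t).
Definition height (a t : R) : R := a + (1 - a) * arctan_ratio t.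
Definition warp (a m t : R) : R := height a t * slope a t `^ (- m).

Definition tangential (a m t : R) : R := warp a m t ^+ 2.
(** Equal to (1 - tangential) / t, by Hadamard's lemma. *)
Definition radial (a m t : R) : R :=
  - param_integral (fun=> 1) id (fun t => 'D_1 (tangential a m) t) t.
End profile_definitions.

Section profile.
Context {R : realType}.
Variables a m : R.
Hypotheses (a0 : 0 < a) (a1 : a < 1) (m0 : 0 < m) (m3 : m <= 3^-1).
Local Notation D := [set t : R | -1 < t].
Local Notation q := (@arctan_ratio R).
Local Notation beta := (slope a).
Local Notation p := (height a).
Local Notation phi := (warp a m).
Local Notation A := (tangential a m).
Local Notation B := (radial a m).
Local Notation leb := (@lebesgue_measure R).

Let oD : open D. Proof. exact: open_gtm1. Qed.

Lemma smooth_id_cst (c : R) : smooth1 D (fun t => c + t).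
Proof. by apply: smooth_add => //; [exact: smooth_cst|exact: smooth_id]. Qed.

Lemma smooth_inv1 : smooth1 D (fun t => (1 + t)^-1).
Proof.
have h : smooth1 D (fun t => (1 + t) `^ (-1)).
  apply: (smooth_comp oD open_pos (smooth_powR (-1)) (smooth_id_cst 1)).
  by move=> t /=; lra.
by apply: smooth_ext h => // t /= t1; rewrite powR_inv1//; lra.
Qed.

Let sq01 (s : R) : 0 <= s <= 1 -> 0 <= s ^+ 2 <= 1.
Proof. by move=> /andP[s0 s1]; rewrite sqr_ge0 expr_le1. Qed.

Lemma continuous_sqr : continuous (fun s : R => s ^+ 2).
Proof. by move=> s; exact: exprn_continuous. Qed.

Lemma smooth_arctan_ratio : smooth1 D q.
Proof.
apply: smooth_param_integral => //; [exact: cst_continuous|exact: continuous_sqr|].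
exact: smooth_inv1.
Qed.

Lemma den_gt0 (t s : R) : -1 < t -> 0 <= s <= 1 -> 0 < 1 + t * s ^+ 2.
Proof.
move=> t1 s01; have := @param_integral_dom R (fun s => s ^+ 2) sq01 t s t1 s01.
by rewrite /=; lra.
Qed.

Lemma arctan_ratioE t : D t -> q t + 2 * t * 'D_1 q t = (1 + t)^-1.
Proof.
move=> t1; rewrite /= in t1.
have dk y : D y -> is_derive y 1 (fun y : R => (1 + y)^-1) (- (1 + y) ^- 2).
  move=> /= y1; have h : is_derive y 1 (fun y : R => 1 + y) 1.
    by apply: (isd_eq (isd_add (isd_cst (1 : R) y 1) (isd_id y))); rewrite add0r.
  have n0 : 1 + y != 0 by lra.
  by apply: (isd_eq (isd_inv h n0)); rewrite mulNr mul1r.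
have ck y : D y -> {for y, continuous (fun y : R => - (1 + y) ^- 2)}.
  move=> /= y1; apply: continuousN; apply: continuousV; first by rewrite /= expf_neq0//; lra.
  apply: (@continuous_sqr_comp _ (fun y => 1 + y)).
  by apply: continuousD; [exact: cst_continuous|exact: cvg_id].
have [_ ->] := param_integral_derive (@continuous_fun_cst R 1) continuous_sqr sq01 dk ck t1.
pose f s : R := (1 + t * s ^+ 2)^-1; pose f' s : R := 1 * s ^+ 2 * - (1 + t * s ^+ 2) ^- 2.
have dden (s : R) : is_derive s 1 (fun s : R => 1 + t * s ^+ 2) (t * (2 * s)).
  apply: (isd_eq (isd_add (isd_cst (1 : R) s 1) (isd_cmul t (isd_sqr (isd_id s))))).
  by rewrite add0r mulr1.
have nz (s : R) : 0 <= s <= 1 -> 1 + t * s ^+ 2 != 0 by move=> /(den_gt0 t1); lra.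
have cden (s : R) : {for s, continuous (fun s : R => 1 + t * s ^+ 2)}.
  exact: is_derive_continuous (dden s).
have cf (s : R) : 0 <= s <= 1 -> {for s, continuous f}.
  by move=> s01; apply: continuousV => //; exact: nz.
have cf' (s : R) : 0 <= s <= 1 -> {for s, continuous f'}.
  move=> s01; apply: continuousM.
    by apply: continuousM; [exact: cst_continuous|exact: continuous_sqr].
  apply: continuousN; apply: continuousV; first by rewrite /= expf_neq0// nz.
  exact: continuous_sqr_comp.
have -> : q t = \int[leb]_(s in `[0, 1]) f s.
  by apply: eq_Rintegral => s _; rewrite mul1r.
rewrite /param_integral -RintegralZl//; last exact: integrable_cont01.
rewrite -RintegralD//; [|exact: integrable_cont01| ]; last first.
  apply: integrable_cont01 => s s01; apply: continuousM; [exact: cst_continuous|exact: cf'].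
have dF (s : R) : 0 <= s <= 1 ->
    is_derive s 1 (fun s : R => s * f s) (f s + 2 * t * f' s).
  move=> s01; apply: (isd_eq (isd_mul (isd_id s) (isd_inv (dden s) (nz s s01)))).
  by rewrite /f /f'; have ? := nz s s01; field.
have cF (s : R) : 0 <= s <= 1 -> {for s, continuous (fun s : R => f s + 2 * t * f' s)}.
  move=> s01; apply: continuousD; first exact: cf.
  by apply: continuousM; [exact: cst_continuous|exact: cf'].
by apply: (etrans (FTC01 dF cF)); rewrite /f mul0r subr0 mul1r expr1n mulr1.
Qed.

Lemma is_derive_arctan_ratio (t : R) : D t -> is_derive t 1 q ('D_1 q t).
Proof. exact: (smooth_is_derive tt smooth_arctan_ratio). Qed.

Lemma arctan_ratio_ge0 (t : R) : D t -> 0 <= q t.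
Proof.
move=> t1; apply: Rintegral_ge0 => s; rewrite /= in_itv/= => s01.
by rewrite mul1r invr_ge0 ltW// den_gt0.
Qed.

(** Along r the derivative of r q(r^2) is 1 / (1 + r^2). *)
Lemma is_derive_ray (h : R -> R) (r d : R) : is_derive (r ^+ 2) 1 h d ->
  is_derive r 1 (fun r : R => r * h (r ^+ 2)) (h (r ^+ 2) + 2 * r ^+ 2 * d).
Proof.
move=> dh; apply: (isd_eq (isd_mul (isd_id r)
  (isd_comp (isd_sqr (isd_id r)) dh))).
by rewrite /=; ring.
Qed.

Let sqr_dom (r : R) : D (r ^+ 2).
Proof. by rewrite /= (lt_le_trans (ltrN10 _))// sqr_ge0. Qed.

Let nneg_dom (t : R) : 0 <= t -> D t.
Proof. by rewrite /= => t0; rewrite (lt_le_trans (ltrN10 _)). Qed.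

Let is_derive_rayq (r : R) : is_derive r 1 (fun r : R => r * q (r ^+ 2)) ((1 + r ^+ 2)^-1).
Proof.
apply: (isd_eq (is_derive_ray (is_derive_arctan_ratio (sqr_dom r)))).
exact: arctan_ratioE (sqr_dom r).
Qed.

Lemma arctan_ratio_le1 (t : R) : 0 <= t -> q t <= 1.
Proof.
move=> t0; have [->|tn0] := eqVneq t 0.
  by have := arctan_ratioE (nneg_dom (lexx 0)); rewrite mulr0 mul0r !addr0 invr1 => ->.
have tp : 0 < t by rewrite lt_neqAle eq_sym tn0.
pose r := Num.sqrt t; have r0 : 0 < r by rewrite sqrtr_gt0.
have rt : r ^+ 2 = t by rewrite sqr_sqrtr.
have d (s : R) : 0 <= s -> is_derive s 1 (fun s : R => s * q (s ^+ 2) - s) ((1 + s ^+ 2)^-1 - 1).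
  by move=> _; exact: isd_sub (is_derive_rayq s) (isd_id s).
have dn (s : R) : 0 <= s -> (1 + s ^+ 2)^-1 - 1 <= 0.
  by move=> _; rewrite subr_le0 invf_le1 ?lerDl ?sqr_ge0// ltr_pwDl// sqr_ge0.
have := derive_le0_nincr d dn (lexx 0) (ltW r0); rewrite mul0r subr0 rt subr_le0.
by rewrite -[X in _ <= X -> _]mulr1 ler_pM2l.
Qed.

(** Comparison of the derivatives 1 / (1 + r^2) <= 2 / (1 + r)^2. *)
Lemma arctan_ratio_decay (r : R) : 0 < r -> q (r ^+ 2) <= 2 / (1 + r).
Proof.
move=> r0.
have d (s : R) : 0 <= s -> is_derive s 1 (fun s : R => s * q (s ^+ 2) - 2 * (s / (1 + s)))
    ((1 + s ^+ 2)^-1 - 2 / (1 + s) ^+ 2).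
  move=> s0; have n0 : 1 + s != 0 by lra.
  have h : is_derive s 1 (fun y : R => 1 + y) 1.
    by apply: (isd_eq (isd_add (isd_cst (1 : R) s 1) (isd_id s))); rewrite add0r.
  apply: (isd_eq (isd_sub (is_derive_rayq s) (isd_cmul 2 (isd_mul (isd_id s) (isd_inv h n0))))).
  congr (_ - _); field.
  by rewrite n0.
have dn (s : R) : 0 <= s -> (1 + s ^+ 2)^-1 - 2 / (1 + s) ^+ 2 <= 0.
  move=> s0; rewrite subr_le0 ler_pdivlMr; last by rewrite exprn_gt0//; lra.
  rewrite mulrC ler_pdivrMr; last by rewrite ltr_pwDl// sqr_ge0.
  have := sqr_ge0 (1 - s); nra.
have := derive_le0_nincr d dn (lexx 0) (ltW r0).
rewrite !mul0r mulr0 subr0 subr_le0 mulrCA ler_pM2l//.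
Qed.

Let c : R := 1 - a.
Let c0 : 0 < c. Proof. by rewrite subr_gt0. Qed.

Lemma slope_num_gt0 (t : R) : D t -> 0 < 1 + a * t.
Proof.
have [? ?] := (a0, a1); rewrite /= => t1.
have h : 0 < a * (1 + t) by rewrite mulr_gt0//; lra.
lra.
Qed.

Lemma slope_gt0 (t : R) : D t -> 0 < beta t.
Proof.
by move=> t1; rewrite /slope divr_gt0 ?slope_num_gt0//; move: t1 => /=; lra.
Qed.

Lemma slope_bounds (t : R) : 0 <= t -> a <= beta t <= 1.
Proof.
have [? ?] := (a0, a1); move=> t0; rewrite /slope ler_pdivlMr ?ler_pdivrMr; try lra.
by apply/andP; split; nra.
Qed.

Lemma smooth_slope : smooth1 D beta.
Proof.
apply: smooth_mul => //; last exact: smooth_inv1.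
apply: smooth_add => //; first exact: smooth_cst.
by apply: smooth_mul => //; [exact: smooth_cst|exact: smooth_id].
Qed.

Lemma smooth_height : smooth1 D p.
Proof.
apply: smooth_add => //; first exact: smooth_cst.
by apply: smooth_mul => //; [exact: smooth_cst|exact: smooth_arctan_ratio].
Qed.

Lemma smooth_warp : smooth1 D phi.
Proof.
apply: smooth_mul => //; first exact: smooth_height.
apply: (smooth_comp oD open_pos (smooth_powR (- m)) smooth_slope).
exact: slope_gt0.
Qed.

Lemma smooth_tangential : smooth1 D A.
Proof.
apply: (smooth_ext oD (f := fun t => phi t * phi t)) => [t _|].
  by rewrite /tangential expr2.
by apply: smooth_mul => //; exact: smooth_warp.
Qed.

Lemma smooth_radial : smooth1 D B.
Proof.
apply: smooth_opp => //; apply: smooth_param_integral => //.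
- exact: continuous_fun_cst.
- by move=> t; exact: cvg_id.
- exact: (smooth_partial tt smooth_tangential).
Qed.

Let dD (f : R -> R) (t : R) : smooth1 D f -> D t -> is_derive t 1 f ('D_1 f t).
Proof. by move=> hf; exact: (smooth_is_derive tt hf). Qed.

(** The ray function r p(r^2) has derivative beta(r^2). *)
Lemma heightE (t : R) : D t -> p t + 2 * t * 'D_1 p t = beta t.
Proof.
move=> Dt; have := isd_add (isd_cst a t 1) (isd_cmul (1 - a) (is_derive_arctan_ratio Dt)).
move=> /(is_derive_unique (dD smooth_height Dt)) ->.
have := arctan_ratioE Dt; rewrite /height /slope; move: (q t) ('D_1 q t) => x y e.
have -> : a + (1 - a) * x + 2 * t * (0 + (1 - a) * y) = a + (1 - a) * (x + 2 * t * y) by ring.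
by rewrite e; move: Dt => /= ?; field; lra.
Qed.

Lemma height_bounds (t : R) : 0 <= t -> a <= p t <= 1.
Proof.
have [? ?] := (a0, a1); move=> t0; rewrite /height; have q0 := arctan_ratio_ge0 (nneg_dom t0).
by have q1 := arctan_ratio_le1 t0; apply/andP; split; nra.
Qed.

Lemma height_gt0 (t : R) : D t -> 0 < p t.
Proof. have [? ?] := (a0, a1); move=> /arctan_ratio_ge0 q0; rewrite /height; nra. Qed.

Lemma height0 : p 0 = 1.
Proof.
have := heightE (nneg_dom (lexx 0)); rewrite mulr0 mul0r addr0 => ->.
by rewrite /slope mulr0 addr0 divr1.
Qed.

Lemma warp_gt0 (t : R) : D t -> 0 < phi t.
Proof. by move=> Dt; rewrite mulr_gt0 ?height_gt0// powR_gt0// slope_gt0. Qed.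

Lemma slope0 : beta 0 = 1.
Proof. by rewrite /slope mulr0 addr0 divr1. Qed.

Lemma warp0 : phi 0 = 1.
Proof. by rewrite /warp height0 slope0 powR1 mulr1. Qed.

Lemma tangential0 : A 0 = 1.
Proof. by rewrite /tangential warp0 expr1n. Qed.

Lemma tangential_gt0 (t : R) : D t -> 0 < A t.
Proof. by move=> Dt; rewrite exprn_gt0// warp_gt0. Qed.

Lemma tangential_radial (t : R) : D t -> A t + t * B t = 1.
Proof.
move=> Dt; have hA' := smooth_partial tt smooth_tangential.
have i01 (s : R) : 0 <= s <= 1 -> D (t * s).
  by move=> s01; apply: (@param_integral_dom R id) => //.
have cA' (s : R) : 0 <= s <= 1 -> {for s, continuous (fun s : R => 'D_1 A (t * s))}.
  move=> s01; apply: (@continuous_comp _ _ _ (fun s => t * s) (fun t => 'D_1 A t)).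
    by apply: continuousM; [exact: cst_continuous|exact: cvg_id].
  by apply: smooth_continuous hA' (i01 _ s01).
rewrite /radial mulrN /param_integral -RintegralZl//; last first.
  by apply: integrable_cont01 => s s01; apply: continuousM; [exact: cst_continuous|exact: cA'].
have dF (s : R) : 0 <= s <= 1 -> is_derive s 1 (fun s : R => A (t * s)) (t * (1 * 'D_1 A (t * s))).
  move=> s01; have h : is_derive s 1 (fun s : R => t * s) t.
    by apply: (isd_eq (isd_cmul t (isd_id s))); rewrite mulr1.
  apply: (isd_eq (isd_comp h (dD smooth_tangential (i01 _ s01)))).
  by rewrite mul1r mulrC.
have cF (s : R) : 0 <= s <= 1 -> {for s, continuous (fun s : R => t * (1 * 'D_1 A (t * s)))}.
  move=> s01; apply: continuousM; first exact: cst_continuous.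
  by apply: continuousM; [exact: cst_continuous|exact: cA'].
by have := FTC01 dF cF; rewrite /= => ->; rewrite mulr1 mulr0 tangential0; ring.
Qed.

End profile.
Section profile_concavity.
Context {R : realType}.
Variables a m : R.
Hypotheses (a0 : 0 < a) (a1 : a < 1) (m0 : 0 < m) (m3 : m <= 3^-1).
Local Notation D := [set t : R | -1 < t].
Local Notation beta := (slope a).
Local Notation p := (height a).
Local Notation phi := (warp a m).
Local Notation p1 := (fun t => 'D_1 p t).
Local Notation p2 := (fun t => 'D_1 p1 t).
Local Notation phi1 := (fun t => 'D_1 phi t).
Local Notation phi2 := (fun t => 'D_1 phi1 t).

Let oD : open D. Proof. exact: open_gtm1. Qed.
Let nneg_dom (t : R) : 0 <= t -> D t.
Proof. by rewrite /= => t0; rewrite (lt_le_trans (ltrN10 _)). Qed.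
Let dD (f : R -> R) (t : R) : smooth1 D f -> D t -> is_derive t 1 f ('D_1 f t).
Proof. by move=> hf; exact: (smooth_is_derive tt hf). Qed.
Let sp := smooth_height a.
Let sphi := smooth_warp m a0 a1.
Let sD (f : R -> R) : smooth1 D f -> smooth1 D (fun t => 'D_1 f t).
Proof. by move=> hf; exact: (smooth_partial tt hf). Qed.

Let near_D (t : R) (P : R -> Prop) : D t -> (forall y, D y -> P y) -> \near t, P t.
Proof. by move=> Dt DP; apply: filterS (open_nbhs_nbhs (conj oD Dt)) => y /DP. Qed.

(** The logarithmic derivative of [slope]. *)
Definition slope_log (t : R) : R := - (1 - a) / ((1 + t) * (1 + a * t)).
Let slope_log' (t : R) : R :=
  (1 - a) * ((1 + a * t) + a * (1 + t)) / ((1 + t) * (1 + a * t)) ^+ 2.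
Local Notation l := slope_log.
Let w (t : R) := beta t `^ (- m).

Let nz (t : R) : D t -> (1 + t != 0) * (1 + a * t != 0).
Proof.
move=> Dt; have h := slope_num_gt0 a0 a1 Dt; split; last by rewrite gt_eqF.
by move: Dt => /= ?; lra.
Qed.

Let d1 (b t : R) : is_derive t 1 (fun t : R => 1 + b * t) b.
Proof.
by apply: (isd_eq (isd_add (isd_cst (1 : R) t 1) (isd_cmul b (isd_id t)))); rewrite add0r mulr1.
Qed.

Let d11 (t : R) : is_derive t 1 (fun t : R => 1 + t) 1.
Proof. by apply: (isd_eq (isd_add (isd_cst (1 : R) t 1) (isd_id t))); rewrite add0r. Qed.

Lemma is_derive_slope (t : R) : D t -> is_derive t 1 beta (l t * beta t).
Proof.
move=> Dt; have [? ?] := nz Dt.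
apply: (isd_eq (isd_mul (d1 a t) (isd_inv (d11 t) (fst (nz Dt))))).
by rewrite /slope_log /slope; field; apply/andP.
Qed.

Let dl (t : R) : D t -> is_derive t 1 l (slope_log' t).
Proof.
move=> Dt; have [? ?] := nz Dt.
have h : (1 + t) * (1 + a * t) != 0 by rewrite mulf_neq0.
apply: (isd_eq (isd_cmul (- (1 - a)) (isd_inv (isd_mul (d11 t) (d1 a t)) h))).
by rewrite /slope_log'; field; apply/andP.
Qed.

Let dw (t : R) : D t -> is_derive t 1 w (- m * l t * w t).
Proof.
move=> Dt; have b0 := slope_gt0 a0 a1 Dt.
apply: (isd_eq (isd_comp (is_derive_slope Dt) (is_derive1_powR (- m) b0))).
have bn0 : beta t != 0 by rewrite gt_eqF.
rewrite /w powRB ?bn0 ?implybT// powRr1 ?(ltW b0)//; field.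
exact: bn0.
Qed.

Lemma height2E (t : R) : D t -> 3 * p1 t + 2 * t * p2 t = l t * beta t.
Proof.
move=> Dt; have h1 : is_derive t 1 (fun t => p t + 2 * t * p1 t) (l t * beta t).
  apply: near_eq_is_derive (is_derive_slope Dt).
  by apply: near_D => // y Dy; rewrite heightE.
have h2 := isd_add (dD sp Dt) (isd_mul (isd_cmul 2 (isd_id t)) (dD (sD sp) Dt)).
by rewrite -(is_derive_unique h2 h1) /=; ring.
Qed.

Lemma warp1E (t : R) : D t -> phi1 t = w t * (p1 t - m * l t * p t).
Proof.
move=> Dt; have h := isd_mul (dD sp Dt) (dw Dt).
by rewrite (is_derive_unique (dD sphi Dt) h) /w /=; ring.
Qed.

Let warp2E (t : R) : D t -> phi2 t =
  w t * (- m * l t * (p1 t - m * l t * p t) + p2 t - m * (slope_log' t * p t + l t * p1 t)).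
Proof.
move=> Dt; have h := isd_mul (dw Dt) (isd_sub (dD (sD sp) Dt)
   (isd_mul (isd_cmul m (dl Dt)) (dD sp Dt))).
have h2 : is_derive t 1 phi1 (phi2 t) by exact: dD (sD sphi) Dt.
have h3 : is_derive t 1 (fun t => w t * (p1 t - m * l t * p t)) (phi2 t).
  by apply: near_eq_is_derive h2; apply: near_D => // y /warp1E.
by rewrite (is_derive_unique h3 h) /=; ring.
Qed.

(** [dwarp] is f'(r), as f = r phi(r^2). *)
Definition dwarp (t : R) : R := phi t + 2 * t * phi1 t.
Definition d2warp (t : R) : R := 3 * phi1 t + 2 * t * phi2 t.

Lemma is_derive_dwarp (t : R) : D t -> is_derive t 1 dwarp (d2warp t).
Proof.
move=> Dt; apply: (isd_eq (isd_add (dD sphi Dt)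
   (isd_mul (isd_cmul 2 (isd_id t)) (dD (sD sphi) Dt)))).
by rewrite /d2warp; ring.
Qed.

Let dwarpE (t : R) : D t -> dwarp t = w t * (beta t - 2 * t * m * l t * p t).
Proof. by move=> Dt; rewrite /dwarp warp1E// -(heightE a Dt) /warp -/(w t); ring. Qed.

Let slope_log_le0 (t : R) : 0 <= t -> l t <= 0.
Proof.
have [? ?] := (a0, a1); move=> t0; rewrite /slope_log mulNr oppr_le0.
have := slope_num_gt0 a0 a1 (nneg_dom t0) => ?.
by rewrite divr_ge0// ?mulr_ge0//; lra.
Qed.

Lemma dwarp_ge0 (t : R) : 0 <= t -> 0 <= dwarp t.
Proof.
move=> t0; rewrite dwarpE ?mulr_ge0 ?powR_ge0//; last exact: nneg_dom.
have := slope_log_le0 t0 => l0; have /andP[pa p_1] := height_bounds a0 a1 t0.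
have b0 := slope_gt0 a0 a1 (nneg_dom t0).
have : 0 <= t * m * - l t * p t.
  by rewrite !mulr_ge0 ?oppr_ge0 ?(ltW m0)// (le_trans (ltW a0)).
by lra.
Qed.

Let d2warpE (t : R) : D t -> d2warp t =
  w t * (1 - a) / ((1 + t) * (1 + a * t)) ^+ 2 *
  (- (1 - 2 * m) * (1 + a * t) ^+ 2 +
   m * p t * ((1 + a * t) * (1 + t) + 2 * t * (m * (1 - a) - (1 + a * t) - a * (1 + t)))).
Proof.
move=> Dt; have [? ?] := nz Dt; rewrite /d2warp warp1E// warp2E//.
have h1 := heightE a Dt; have h2 := height2E Dt.
transitivity (w t * (l t * beta t - 3 * m * l t * p t - 2 * m * l t * (beta t - p t)
  + 2 * t * m * p t * (m * l t ^+ 2 - slope_log' t))).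
  by rewrite -h2 -h1 /=; ring.
rewrite /slope_log /slope_log' /slope; field; exact/andP.
Qed.

Let bracket (t : R) : 0 <= t ->
  - (1 - 2 * m) * (1 + a * t) ^+ 2 +
   m * p t * ((1 + a * t) * (1 + t) + 2 * t * (m * (1 - a) - (1 + a * t) - a * (1 + t)))
  <= - (2 * a * m * t).
Proof.
have [? [? [? ?]]] := (a0, (a1, (m0, m3))).
move=> t0; have /andP[pa p_1] := height_bounds a0 a1 t0.
set X := _ + 2 * t * _.
have mp : 0 < m * p t by rewrite mulr_gt0//; lra.
have at0 : 0 <= a * t by rewrite mulr_ge0// ltW.
have hX : m * p t * X <= Num.max 0 (m * X).
  have [X0|X0] := leP X 0.
    by rewrite le_max; apply/orP; left; rewrite mulr_ge0_le0// ltW.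
  by rewrite le_max; apply/orP; right; rewrite ler_pM2r// -[leRHS]mulr1 ler_pM2l.
apply: le_trans (lerD (lexx _) hX) _.
have e1 : 3 * m <= 1 by lra.
have e2 : m <= 1 - 2 * m by lra.
have s1 : m * (1 + a * t) ^+ 2 <= (1 - 2 * m) * (1 + a * t) ^+ 2 by rewrite ler_wpM2r// sqr_ge0.
have mat : 0 <= m * (a * t) by rewrite mulr_ge0// ltW.
have maat : 0 <= m * ((a * t) * (a * t)) by rewrite !mulr_ge0// ltW.
case: (leP 0 (m * X)) => _; last by nra.
have XE : X = 1 - t * (1 + a - 2 * m * (1 - a)) - 3 * a * t ^+ 2 by rewrite /X; ring.
have f1 : 0 <= m * (t * (1 + a - 2 * m * (1 - a))).
  rewrite !mulr_ge0 ?(ltW m0)//; nra.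
have f2 : 0 <= m * (a * t * t) by rewrite !mulr_ge0// ltW.
by rewrite XE; nra.
Qed.

Lemma d2warp_le0 (t : R) : 0 <= t -> d2warp t <= 0.
Proof.
move=> t0; rewrite d2warpE; last exact: nneg_dom.
rewrite mulr_ge0_le0//.
  by rewrite divr_ge0 ?sqr_ge0// mulr_ge0 ?powR_ge0// subr_ge0 ltW.
apply: le_trans (bracket t0) _; rewrite oppr_le0 !mulr_ge0//; exact: ltW.
Qed.

Lemma d2warp_lt0 (t : R) : 0 < t -> d2warp t < 0.
Proof.
move=> t0; have Dt := nneg_dom (ltW t0); rewrite d2warpE//.
have [h1 h2] := nz Dt.
rewrite pmulr_rlt0.
  apply: le_lt_trans (bracket (ltW t0)) _; rewrite oppr_lt0 !mulr_gt0//.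
rewrite divr_gt0 ?exprn_even_gt0 ?mulf_neq0//= mulr_gt0 ?subr_gt0// powR_gt0//.
exact: slope_gt0.
Qed.

Lemma dwarp0 : dwarp 0 = 1.
Proof. by rewrite /dwarp warp0 mulr0 mul0r addr0. Qed.

Lemma dwarp_le1 (t : R) : 0 <= t -> dwarp t <= 1.
Proof.
move=> t0; rewrite -dwarp0.
have d (s : R) : 0 <= s -> is_derive s 1 dwarp (d2warp s).
  by move=> /nneg_dom; exact: is_derive_dwarp.
by have := derive_le0_nincr d d2warp_le0 (lexx 0) t0.
Qed.

Let sqr_dom (r : R) : D (r ^+ 2).
Proof. by apply: nneg_dom; exact: sqr_ge0. Qed.

Lemma warp_le1 (t : R) : 0 <= t -> phi t <= 1.
Proof.
move=> t0; have [->|tn0] := eqVneq t 0; first by rewrite warp0.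
have tp : 0 < t by rewrite lt_neqAle eq_sym tn0.
pose r := Num.sqrt t; have r0 : 0 < r by rewrite sqrtr_gt0.
have rt : r ^+ 2 = t by rewrite sqr_sqrtr.
have d (s : R) : 0 <= s -> is_derive s 1 (fun s : R => s * phi (s ^+ 2) - s) (dwarp (s ^+ 2) - 1).
  by move=> _; exact: isd_sub (is_derive_ray (dD sphi (sqr_dom s))) (isd_id s).
have dn (s : R) : 0 <= s -> dwarp (s ^+ 2) - 1 <= 0.
  by move=> _; rewrite subr_le0 dwarp_le1// sqr_ge0.
have := derive_le0_nincr d dn (lexx 0) (ltW r0); rewrite mul0r subr0 rt subr_le0.
by rewrite -[X in _ <= X -> _]mulr1 ler_pM2l.
Qed.

Lemma warp_ge (t : R) : 0 <= t -> a <= phi t.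
Proof.
move=> t0; have /andP[pa _] := height_bounds a0 a1 t0.
apply: le_trans pa _; rewrite /warp -[leLHS]mulr1 ler_wpM2l//.
  exact: ltW (height_gt0 a0 a1 (nneg_dom t0)).
have /andP[b0 b1] := slope_bounds a0 a1 t0.
have bp := slope_gt0 a0 a1 (nneg_dom t0).
have -> : 1 = 1 `^ (- m) :> R by rewrite powR1.
rewrite !powRN lef_pV2 ?posrE ?powR_gt0//.
by rewrite ge0_ler_powR ?nnegrE// ltW.
Qed.

Lemma warp1_0 : phi1 0 = (1 - a) * (m - 3^-1).
Proof.
have D0 : D 0 by apply: nneg_dom.
rewrite warp1E// /w slope0 powR1 mul1r height0.
have := height2E D0; rewrite mulr0 mul0r addr0 slope0 mulr1 /slope_log.
rewrite mulr0 !addr0 mulr1 divr1 /= => h.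
have -> : 'D_1 p 0 = - (1 - a) / 3 by rewrite -h; field.
by field.
Qed.

End profile_concavity.
(** * Curvature coefficients *)

(** With t = |x|^2, the Christoffel symbols and the curvature tensor of
    A(t) I + B(t) x^T x, where A + t B = 1, are combinations of Kronecker deltas
    and coordinates with these coefficients. *)
Section coefficients.
Context {R : realType}.
Variables a m : R.
Local Notation A := (tangential a m).
Local Notation B := (radial a m).
Local Notation A1 := (fun t => 'D_1 A t).
Local Notation A2 := (fun t => 'D_1 A1 t).
Local Notation B1 := (fun t => 'D_1 B t).

Definition cfP (t : R) : R := A1 t / A t.
Definition cfQ (t : R) : R := B t - A1 t.
Definition cfS (t : R) : R := B1 t - 2 * B t * A1 t / A t.
Definition cfP' (t : R) : R := A2 t / A t - A1 t ^+ 2 / A t ^+ 2.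
Definition cfQ' (t : R) : R := B1 t - A2 t.

(** [curv0] is the curvature of planes tangent to the spheres (in Euclidean
    units), [curv0 + t curv1] that of planes containing the radial direction. *)
Definition curv0 (t : R) : R := cfQ t - cfP t + cfP t * cfQ t * t.
Definition curv1 (t : R) : R := cfS t - 2 * cfP' t + cfP t ^+ 2 + cfP t * cfS t * t.
Definition curv2 (t : R) : R := 2 * cfQ' t - cfS t + cfQ t ^+ 2 + cfS t * cfQ t * t.

Section facts.
Hypotheses (a0 : 0 < a) (a1 : a < 1) (m0 : 0 < m) (m3 : m <= 3^-1).
Local Notation D := [set t : R | -1 < t].
Local Notation phi := (warp a m).
Local Notation phi1 := (fun t => 'D_1 phi t).
Local Notation phi2 := (fun t => 'D_1 phi1 t).
Local Notation B2 := (fun t => 'D_1 B1 t).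

Let oD : open D. Proof. exact: open_gtm1. Qed.
Let nneg_dom (t : R) : 0 <= t -> D t.
Proof. by rewrite /= => t0; rewrite (lt_le_trans (ltrN10 _)). Qed.
Let dD (f : R -> R) (t : R) : smooth1 D f -> D t -> is_derive t 1 f ('D_1 f t).
Proof. by move=> hf; exact: (smooth_is_derive tt hf). Qed.
Let sphi := smooth_warp m a0 a1.
Let sA := smooth_tangential m a0 a1.
Let sB := smooth_radial m a0 a1.
Let sD (f : R -> R) : smooth1 D f -> smooth1 D (fun t => 'D_1 f t).
Proof. by move=> hf; exact: (smooth_partial tt hf). Qed.
Let near_D (t : R) (P : R -> Prop) : D t -> (forall y, D y -> P y) -> \near t, P t.
Proof. by move=> Dt DP; apply: filterS (open_nbhs_nbhs (conj oD Dt)) => y /DP. Qed.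

Let A1E (t : R) : D t -> A1 t = 2 * phi t * phi1 t.
Proof.
by move=> Dt; exact: (is_derive_unique (dD sA Dt) (isd_sqr (dD sphi Dt))).
Qed.

Let A2E (t : R) : D t -> A2 t = 2 * phi1 t ^+ 2 + 2 * phi t * phi2 t.
Proof.
move=> Dt; have h : is_derive t 1 (fun t => 2 * phi t * phi1 t) (A2 t).
  by apply: near_eq_is_derive (dD (sD sA) Dt); apply: near_D => // y /A1E.
have h' := isd_mul (isd_cmul 2 (dD sphi Dt)) (dD (sD sphi) Dt).
by apply: (etrans (is_derive_unique h h')) => /=; ring.
Qed.

Let AB1 (t : R) : D t -> A1 t + (B t + t * B1 t) = 0.
Proof.
move=> Dt; have h := isd_add (dD sA Dt) (isd_mul (isd_id t) (dD sB Dt)).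
have h' : is_derive t 1 (fun t => A t + t * B t) 0.
  apply: near_eq_is_derive (isd_cst 1 t 1).
  by apply: near_D => // y Dy; rewrite tangential_radial.
by have := is_derive_unique h h'; rewrite mul1r.
Qed.

Let AB2 (t : R) : D t -> A2 t + 2 * B1 t + t * B2 t = 0.
Proof.
move=> Dt; have h := isd_add (dD (sD sA) Dt)
  (isd_add (dD sB Dt) (isd_mul (isd_id t) (dD (sD sB) Dt))).
have h' : is_derive t 1 (fun t => A1 t + (B t + t * B1 t)) 0.
  apply: near_eq_is_derive (isd_cst 0 t 1).
  by apply: near_D => // y Dy; rewrite AB1.
have := is_derive_unique h h'; rewrite mul1r => <-.
by rewrite mulr_natl mulr2n !addrA.
Qed.

(** The mixed coefficients agree because the curvature tensor is symmetric
    under exchanging its two pairs of arguments. *)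
Lemma curv_sym (t : R) : D t -> A t * curv1 t = curv2 t + B t * curv0 t.
Proof.
move=> Dt; have hA := tangential_gt0 m a0 a1 Dt.
have h0 := tangential_radial m a0 a1 Dt; have h1 := AB1 Dt; have h2 := AB2 Dt.
have An0 : A t != 0 by rewrite gt_eqF.
rewrite /curv0 /curv1 /curv2 /cfP /cfQ /cfS /cfP' /cfQ'.
move: An0 h0 h1 h2; move: (A t) (A1 t) (A2 t) (B t) (B1 t) (B2 t) => /= x x1 x2 y y1 y2.
move=> xn0 h0 h1 h2.
have -> : x2 = - 2 * y1 - t * y2 by apply/eqP; rewrite -subr_eq0 -h2; apply/eqP; ring.
have e1 : x1 = - (y + t * y1) by apply/eqP; rewrite -subr_eq0 -h1; apply/eqP; ring.
have e : x = 1 - t * y by rewrite -h0; ring.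
rewrite e1; move: xn0; rewrite e => xn0; field.
exact: xn0.
Qed.

Let radial_curvE (t : R) : D t ->
  phi t * (curv0 t + t * curv1 t) = - 2 * d2warp a m t.
Proof.
move=> Dt; have hp := warp_gt0 m a0 a1 Dt.
have h0 := tangential_radial m a0 a1 Dt; have h1 := AB1 Dt; have h2 := AB2 Dt.
have hA1 := A1E Dt; have hA2 := A2E Dt.
have pn0 : phi t != 0 by rewrite gt_eqF.
apply: (mulfI pn0); rewrite /d2warp /curv0 /curv1 /cfP /cfQ /cfS /cfP' /cfQ'.
have hA : A t = phi t ^+ 2 by [].
transitivity (- (3 * A1 t + 2 * t * A2 t - t * A1 t ^+ 2 / phi t ^+ 2)); last first.
  by rewrite hA1 hA2 /=; field.
have xn0 : A t != 0 by rewrite hA expf_neq0.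
rewrite mulrA -expr2 -hA; clear hA1 hA2 hA; move: h0 h1 h2 xn0.
move: (A t) (A1 t) (A2 t) (B t) (B1 t) (B2 t) => /= x x1 x2 y y1 y2 h0 h1 h2 xn0.
have -> : x2 = - 2 * y1 - t * y2 by apply/eqP; rewrite -subr_eq0 -h2; apply/eqP; ring.
have e1 : x1 = - (y + t * y1) by apply/eqP; rewrite -subr_eq0 -h1; apply/eqP; ring.
have e : x = 1 - t * y by rewrite -h0; ring.
rewrite e1; move: xn0; rewrite e => xn0; field.
exact: xn0.
Qed.

Let sphere_curvE (t : R) : D t -> t * curv0 t = 1 - dwarp a m t ^+ 2.
Proof.
move=> Dt; have hp := warp_gt0 m a0 a1 Dt.
have h0 := tangential_radial m a0 a1 Dt.
have hA1 := A1E Dt.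
have pn0 : phi t != 0 by rewrite gt_eqF.
rewrite /dwarp /curv0 /cfP /cfQ.
have -> : t * (B t - A1 t - A1 t / A t + A1 t / A t * (B t - A1 t) * t) =
  t * B t - t * A1 t - t * A1 t / A t + t * (A1 t / A t) * (t * B t - t * A1 t) by ring.
have -> : t * B t = 1 - A t by rewrite -h0; ring.
by rewrite hA1 /tangential /=; field.
Qed.

Lemma curv0_at0 : curv0 0 = 2 * (1 - a) * (1 - 3 * m).
Proof.
have D0 : D 0 by exact: nneg_dom.
rewrite /curv0 /cfP /cfQ mulr0 addr0 (tangential0 a m) divr1 /=.
have := AB1 D0; rewrite mul0r addr0 /= => h.
have -> : B 0 = - 'D_1 A 0 by apply/eqP; rewrite -addr_eq0 addrC h.
have -> : 'D_1 A 0 = 2 * phi 0 * 'D_1 phi 0 := A1E D0.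
have -> : 'D_1 phi 0 = (1 - a) * (m - 3^-1) := warp1_0 m a0 a1.
by rewrite (warp0 a m); field.
Qed.

Lemma curv0_ge0 (t : R) : 0 <= t -> 0 <= curv0 t.
Proof.
move=> t0; have [->|tn0] := eqVneq t 0.
  have [? ?] := (a1, m3); rewrite curv0_at0 !mulr_ge0//; lra.
have tp : 0 < t by rewrite lt_neqAle eq_sym tn0.
rewrite -(pmulr_rge0 _ tp) sphere_curvE; last exact: nneg_dom.
by rewrite subr_ge0 expr_le1// ?dwarp_ge0// dwarp_le1.
Qed.

Lemma radial_curv_ge0 (t : R) : 0 <= t -> 0 <= curv0 t + t * curv1 t.
Proof.
move=> t0; have Dt := nneg_dom t0; rewrite -(pmulr_rge0 _ (warp_gt0 m a0 a1 Dt)).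
by rewrite radial_curvE// mulNr oppr_ge0 mulr_ge0_le0// d2warp_le0.
Qed.

Lemma radial_curv_gt0 (t : R) : 0 < t -> 0 < curv0 t + t * curv1 t.
Proof.
move=> t0; have Dt := nneg_dom (ltW t0); rewrite -(pmulr_rgt0 _ (warp_gt0 m a0 a1 Dt)).
by rewrite radial_curvE// mulNr oppr_gt0 pmulr_rlt0// d2warp_lt0.
Qed.

Lemma is_derive_cfP (t : R) : D t -> is_derive t 1 cfP (cfP' t).
Proof.
move=> Dt; have xn0 : A t != 0 by rewrite gt_eqF// tangential_gt0.
apply: (isd_eq (isd_mul (dD (sD sA) Dt) (isd_inv (dD sA Dt) xn0))).
by rewrite /cfP'; field.
Qed.

Lemma is_derive_cfQ (t : R) : D t -> is_derive t 1 cfQ (cfQ' t).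
Proof. by move=> Dt; exact: (isd_sub (dD sB Dt) (dD (sD sA) Dt)). Qed.

Lemma is_derive_cfS (t : R) : D t -> is_derive t 1 cfS ('D_1 cfS t).
Proof.
move=> Dt; have xn0 : A t != 0 by rewrite gt_eqF// tangential_gt0.
have h := isd_sub (dD (sD sB) Dt) (isd_mul (isd_mul (isd_cmul 2 (dD sB Dt)) (dD (sD sA) Dt))
  (isd_inv (dD sA Dt) xn0)).
by apply: derivableP; have [] := h.
Qed.

End facts.
End coefficients.

(** * Volume density and Green function as functions of t = r^2 *)

Section density.
Context {R : realType}.
Variables (a : R) (n : nat).
Hypotheses (a0 : 0 < a) (a1 : a < 1) (n4 : (4 <= n)%N).
Local Notation D := [set t : R | -1 < t].

(** The exponent for which b' = (b / f)^(n - 1). *)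
Definition warp_exp : R := (n.-1)%:R^-1.
Local Notation m := warp_exp.
Local Notation p := (height a).
Local Notation phi := (warp a m).

Lemma warp_exp_gt0 : 0 < m.
Proof. by rewrite invr_gt0 ltr0n -ltnS prednK; exact: leq_trans n4. Qed.

Lemma warp_exp_le : m <= 3^-1.
Proof.
rewrite lef_pV2 ?posrE ?ltr0n// ?(ler_nat _ 3 n.-1).
  by rewrite -ltnS prednK//; exact: leq_trans n4.
by rewrite -ltnS prednK; exact: leq_trans n4.
Qed.

Definition density (t : R) : R := phi t ^+ n.-1.

Lemma densityE (t : R) : D t -> density t = p t ^+ n.-1 / slope a t.
Proof.
move=> Dt; have b0 := slope_gt0 a0 a1 Dt; rewrite /density /warp exprMn; congr (_ * _).
rewrite -powR_mulrn ?powR_ge0// -powRrM mulNr mulVf ?powR_inv1 ?(ltW b0)//.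
by have := warp_exp_gt0; rewrite invr_gt0 => /lt0r_neq0.
Qed.

Lemma density_gt0 (t : R) : D t -> 0 < density t.
Proof. by move=> Dt; rewrite exprn_gt0// warp_gt0. Qed.

Lemma density_le1 (t : R) : 0 <= t -> density t <= 1.
Proof.
have [m0 m3] := (warp_exp_gt0, warp_exp_le) => t0.
have p0 : 0 <= phi t by rewrite ltW// warp_gt0//= (lt_le_trans (ltrN10 _)).
by rewrite exprn_ile1// warp_le1.
Qed.

(** The Green function with pole 0, as a function of t. *)
Definition green_profile (t : R) : R := (t * p t ^+ 2) `^ ((2 - n%:R) / 2).

Let pos := [set t : R | 0 < t].

Let pos_dom (t : R) : pos t -> D t.
Proof. by move=> /= t0; rewrite (lt_trans _ t0)// ltrN10. Qed.

Let inner_gt0 (t : R) : pos t -> 0 < t * p t ^+ 2.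
Proof. by move=> t0; rewrite mulr_gt0// exprn_gt0// height_gt0//; exact: pos_dom. Qed.

Lemma smooth_green_profile : smooth1 pos green_profile.
Proof.
have sp : smooth1 pos p by apply: smooth_sub_set (smooth_height a); exact: pos_dom.
have h : smooth1 pos (fun t => t * (p t * p t)).
  by apply: smooth_mul; [exact: open_pos|apply: smooth_id; exact: open_pos|
     apply: smooth_mul => //; exact: open_pos].
have h2 := smooth_comp open_pos open_pos (smooth_powR ((2 - n%:R) / 2)) h.
apply: (smooth_ext open_pos _ (h2 _)) => t t0 /=; first by rewrite /green_profile expr2.
by rewrite -expr2; exact: inner_gt0.
Qed.

(** The flux f^(n-1) G' is that of the Euclidean Green function. *)
Lemma is_derive_green_profile (t : R) : 0 < t ->
  is_derive t 1 green_profile ((2 - n%:R) / 2 * t `^ (- (n%:R / 2)) / density t).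
Proof.
move=> t0; have Dt := pos_dom t0.
have dp : is_derive t 1 p ('D_1 p t) by exact: (smooth_is_derive tt (smooth_height a) Dt).
have i0 := inner_gt0 t0.
have h := isd_comp (isd_mul (isd_id t) (isd_sqr dp)) (is_derive1_powR ((2 - n%:R) / 2) i0).
apply: (isd_eq h).
have hp := height_gt0 a0 a1 Dt; have hb := slope_gt0 a0 a1 Dt.
have n1 : n = n.-1.+1 by rewrite prednK//; exact: leq_trans n4.
have -> : (2 - n%:R) / 2 - 1 = - (n%:R / 2) :> R by field.
rewrite powRM ?sqr_ge0 ?(ltW t0)//.
have -> : (p t ^+ 2) `^ (- (n%:R / 2)) = (p t ^+ n)^-1.
  rewrite -powR_mulrn ?(ltW hp)// -powRrM.
  have -> : 2 * - (n%:R / 2) = - n%:R :> R by field.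
  by rewrite powR_invn// ltW.
rewrite densityE// -(heightE a Dt); have := heightE a Dt => hE.
have hb' : p t + 2 * t * 'D_1 p t != 0 by rewrite hE gt_eqF.
have hpn : p t != 0 by rewrite gt_eqF.
have -> : p t ^+ n = p t ^+ n.-1 * p t by rewrite -exprSr -n1.
move: (p t ^+ n.-1) (expf_neq0 n.-1 hpn) => z zn0.
field.
by rewrite hpn zn0 hb'.
Qed.

Lemma green_profile_gt0 (t : R) : 0 < t -> 0 < green_profile t.
Proof. by move=> t0; rewrite powR_gt0// inner_gt0. Qed.

End density.
Section profile_limits.
Context {R : realType}.
Variables (a : R) (n : nat).
Hypotheses (a0 : 0 < a) (a1 : a < 1) (n4 : (4 <= n)%N).
Local Notation p := (height a).

Lemma green_profile_sqr (r : R) : 0 < r ->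
  green_profile a n (r ^+ 2) = (r * p (r ^+ 2)) ^- (n - 2).
Proof.
move=> r0; have p0 : 0 < p (r ^+ 2).
  by rewrite height_gt0//= (lt_le_trans (ltrN10 _))// sqr_ge0.
have rp : 0 <= r * p (r ^+ 2) by rewrite ltW// mulr_gt0.
rewrite /green_profile -exprMn -(@powR_mulrn _ (r * p (r ^+ 2)) 2)// -powRrM.
rewrite mulrCA divff// mulr1.
by rewrite -opprB -natrB ?powR_invn//; exact: leq_trans n4.
Qed.

Lemma cvg_inv_infty (f : R -> R) : (\forall r \near +oo, 0 <= f r <= 2 / (1 + r)) ->
  f r @[r --> +oo] --> 0.
Proof.
move=> fb; apply/cvgr0Pnorm_le => e e0.
near=> r; have r0 : 0 <= r by near: r; apply: nbhs_pinfty_ge; exact: num_real.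
have /andP[f0 f1] : 0 <= f r <= 2 / (1 + r) by near: r.
rewrite ger0_norm//; apply: le_trans f1 _; rewrite ler_pdivrMr; last by lra.
have h : 2 / e <= r by near: r; apply: nbhs_pinfty_ge; exact: num_real.
move: h; rewrite ler_pdivrMr// => h; nra.
Unshelve. all: by end_near. Qed.

Lemma cvg_height_infty : p (r ^+ 2) @[r --> +oo] --> a.
Proof.
rewrite -[X in _ --> X]addr0; apply: cvgD; first exact: cvg_cst.
rewrite -[X in _ --> X](mulr0 (1 - a)); apply: cvgM; first exact: cvg_cst.
apply: cvg_inv_infty; near=> r; have r0 : 0 < r by near: r; exact: nbhs_pinfty_gt.
by rewrite arctan_ratio_decay// arctan_ratio_ge0//= (lt_le_trans (ltrN10 _))// sqr_ge0.
Unshelve. all: by end_near. Qed.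

Lemma cvg_slope_infty : slope a (r ^+ 2) @[r --> +oo] --> a.
Proof.
have -> : (fun r : R => slope a (r ^+ 2)) = (fun r => a + (1 - a) * (1 + r ^+ 2)^-1).
  apply/funext => r; rewrite /slope; field.
  by rewrite gt_eqF// ltr_pwDl// sqr_ge0.
rewrite -[X in _ --> X]addr0; apply: cvgD; first exact: cvg_cst.
rewrite -[X in _ --> X](mulr0 (1 - a)); apply: cvgM; first exact: cvg_cst.
apply: cvg_inv_infty; near=> r; have r0 : 0 < r by near: r; exact: nbhs_pinfty_gt.
rewrite invr_ge0 addr_ge0 ?sqr_ge0//= ler_pdivlMr; last by lra.
rewrite mulrC ler_pdivrMr; last by rewrite ltr_pwDl// sqr_ge0.
have := sqr_ge0 (r - 1); nra.
Unshelve. all: by end_near. Qed.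

Lemma cvg_density_infty : density a n (r ^+ 2) @[r --> +oo] --> a ^+ (n - 2).
Proof.
have -> : (fun r : R => density a n (r ^+ 2)) =
    (fun r => p (r ^+ 2) ^+ n.-1 * (slope a (r ^+ 2))^-1).
  by apply/funext => r; rewrite densityE//= (lt_le_trans (ltrN10 _))// sqr_ge0.
have -> : a ^+ (n - 2) = a ^+ n.-1 * a^-1.
  case: n n4 => [//|[//|k]] _; rewrite subn2 /= exprS; field; exact: lt0r_neq0.
apply: cvgM; last by apply: cvgV; [exact: lt0r_neq0|exact: cvg_slope_infty].
exact: cvg_comp cvg_height_infty (@exprn_continuous R n.-1 a).
Qed.

Lemma green_profile_infty (e : R) : 0 < e ->
  \forall r \near +oo, green_profile a n (r ^+ 2) <= e.
Proof.
move=> e0; near=> r; have r0 : 0 < r by near: r; exact: nbhs_pinfty_gt.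
rewrite green_profile_sqr//; have /andP[pa _] := height_bounds a0 a1 (sqr_ge0 r).
have h1 : a^-1 <= r by near: r; apply: nbhs_pinfty_ge; exact: num_real.
have h2 : (a * e)^-1 <= r by near: r; apply: nbhs_pinfty_ge; exact: num_real.
have rp1 : 1 <= r * p (r ^+ 2).
  apply: le_trans (_ : r * a <= _); last by rewrite ler_pM2l.
  by rewrite -ler_pdivrMr// mul1r.
have rp0 : 0 < r * p (r ^+ 2) by apply: lt_le_trans rp1.
rewrite -[leRHS]invrK lef_pV2 ?posrE ?invr_gt0 ?exprn_gt0//.
apply: le_trans (_ : r * p (r ^+ 2) <= _).
  apply: le_trans (_ : r * a <= _); last by rewrite ler_pM2l.
  by rewrite -ler_pdivrMr// -invfM mulrC.
rewrite -[leLHS]expr1; apply: ler_weXn2l => //.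
by rewrite subn_gt0; exact: leq_trans n4.
Unshelve. all: by end_near. Qed.

End profile_limits.
(** * Functions on R^n and radial functions *)

Section euclidean.
Context {R : realType} {n : nat}.
Implicit Types (x y u v w : 'rV[R]_n) (i j k l : 'I_n) (U : set 'rV[R]_n).

Definition dot u v : R := \sum_i u 0 i * v 0 i.
Definition sqn x : R := \sum_i x 0 i ^+ 2.

Lemma sqnE x : sqn x = dot x x.
Proof. by apply: eq_bigr => i _; rewrite expr2. Qed.

Lemma dotC u v : dot u v = dot v u.
Proof. by apply: eq_bigr => i _; rewrite mulrC. Qed.

Lemma dotDl u v w : dot (u + v) w = dot u w + dot v w.
Proof. by rewrite -big_split; apply: eq_bigr => i _; rewrite mxE mulrDl. Qed.

Lemma dotDr u v w : dot u (v + w) = dot u v + dot u w.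
Proof. by rewrite dotC dotDl !(dotC u). Qed.

Lemma dotZl (c : R) u v : dot (c *: u) v = c * dot u v.
Proof. by rewrite mulr_sumr; apply: eq_bigr => i _; rewrite mxE mulrA. Qed.

Lemma dotZr (c : R) u v : dot u (c *: v) = c * dot u v.
Proof. by rewrite dotC dotZl dotC. Qed.

Lemma dotNr u v : dot u (- v) = - dot u v.
Proof. by rewrite -scaleN1r dotZr mulN1r. Qed.

Lemma dotBr u v w : dot u (v - w) = dot u v - dot u w.
Proof. by rewrite dotDr dotNr. Qed.

Lemma dot0r u : dot u 0 = 0.
Proof. by rewrite -(scale0r 0) dotZr mul0r. Qed.

Lemma dotE u v : dot u v = (u *m v^T) 0 0.
Proof. by rewrite !mxE; apply: eq_bigr => i _; rewrite mxE. Qed.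

Lemma dot_delta x i : dot x (delta_mx 0 i) = x 0 i.
Proof.
rewrite /dot (bigD1 i)//= mxE !eqxx mulr1 big1 ?addr0// => j /negbTE ji.
by rewrite mxE ji andbF mulr0.
Qed.

Lemma sqn_ge0 x : 0 <= sqn x.
Proof. by apply: sumr_ge0 => i _; exact: sqr_ge0. Qed.

Lemma sqn_eq0 x : (sqn x == 0) = (x == 0).
Proof.
rewrite psumr_eq0; last by move=> i _; exact: sqr_ge0.
apply/idP/eqP => [/allP h|-> ]; last by apply/allP => i _; rewrite mxE expr0n/=.
apply/rowP => i; rewrite mxE; apply/eqP; rewrite -sqrf_eq0.
by have := h i (mem_index_enum _).
Qed.

Lemma sqn_gt0 x : (0 < sqn x) = (x != 0).
Proof. by rewrite lt_neqAle eq_sym sqn_eq0 sqn_ge0 andbT. Qed.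

Lemma sqn0 : sqn 0 = 0.
Proof. by apply/eqP; rewrite sqn_eq0. Qed.

Lemma sqnZ (c : R) x : sqn (c *: x) = c ^+ 2 * sqn x.
Proof. by rewrite !sqnE dotZl dotZr mulrA expr2. Qed.

Lemma sqnD x y : sqn (x + y) = sqn x + 2 * dot x y + sqn y.
Proof. by rewrite !sqnE dotDl !dotDr (dotC y x); ring. Qed.

Lemma cauchy_schwarz u v : dot u v ^+ 2 <= sqn u * sqn v.
Proof.
have [->|v0] := eqVneq v 0; first by rewrite dot0r expr0n/= sqn0 mulr0.
have hv : 0 < sqn v by rewrite sqn_gt0.
have := sqn_ge0 (u + (- (dot u v / sqn v)) *: v).
rewrite sqnD sqnZ dotZr => h.
rewrite -subr_ge0 -(pmulr_rge0 _ hv).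
have -> : sqn v * (sqn u * sqn v - dot u v ^+ 2) = sqn v ^+ 2 *
  (sqn u + 2 * (- (dot u v / sqn v) * dot u v) + (- (dot u v / sqn v)) ^+ 2 * sqn v).
  by field; rewrite gt_eqF.
by rewrite mulr_ge0// sqr_ge0.
Qed.

Lemma sum_delta (F : 'I_n -> R) i : \sum_l (i == l)%:R * F l = F i.
Proof.
rewrite (bigD1 i)//= eqxx mul1r big1 ?addr0// => j /negbTE ji.
by rewrite eq_sym ji mul0r.
Qed.

Lemma sum_delta_r (F : 'I_n -> R) i : \sum_l (l == i)%:R * F l = F i.
Proof. by rewrite -[RHS]sum_delta; apply: eq_bigr => l _; rewrite eq_sym. Qed.

Lemma isd_coord x v j : is_derive x v (fun y : 'rV[R]_n => y 0 j) (v 0 j).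
Proof.
have h : derivable (@id 'rV[R]_n) x v by exact: derivable_id.
have /derivable_mxP h1 := h.
split; first exact: (h1 0 j).
by have := derive_mx h; rewrite derive_id => /rowP/(_ j); rewrite mxE.
Qed.

Lemma isd_sqn x v : is_derive x v sqn (2 * dot x v).
Proof.
have h := fun i => isd_mul (isd_coord x v i) (isd_coord x v i).
apply: (isd_eq (f := sqn) (d := \sum_i (v 0 i * x 0 i + x 0 i * v 0 i))).
  rewrite (_ : sqn = fun y => \sum_i y 0 i * y 0 i); first exact: isd_sum.
  by apply/funext => y; rewrite sqnE.
by rewrite mulr_sumr; apply: eq_bigr => i _; ring.
Qed.

Lemma isd_radial (h : R -> R) x v (d : R) : is_derive (sqn x) 1 h d ->
  is_derive x v (fun y => h (sqn y)) (2 * d * dot x v).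
Proof. by move=> dh; apply: (isd_eq (isd_comp (isd_sqn x v) dh)); ring. Qed.

Definition cdirs : 'I_n -> 'rV[R]_n := fun i => delta_mx 0 i.

Lemma Ck_onE (k : nat) U (f : 'rV[R]_n -> R) : Ck_on k U f <-> Ck cdirs k U f.
Proof.
elim: k f => [|k IH] f; first by [].
by split => -[cf h]; split => // i; have [h1 h2] := h i; split => //; apply/IH.
Qed.

Lemma smooth_onE U (f : 'rV[R]_n -> R) : smooth_on U f <-> smooth cdirs U f.
Proof. by split => h k; apply/Ck_onE; exact: h. Qed.

Lemma isd_partial (f : 'rV[R]_n -> R) i x d :
  is_derive x (delta_mx 0 i) f d -> partial i f x = d.
Proof. by case. Qed.

Lemma continuous_coord i : continuous (fun y : 'rV[R]_n => y 0 i).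
Proof. by move=> x; exact: (@coord_continuous R 1 n 0 i). Qed.

Lemma smooth_coord U i : open U -> smooth cdirs U (fun y => y 0 i).
Proof.
move=> oU [|k]; first by split => // x _; exact: continuous_coord.
apply: (@CkSI _ _ _ _ _ _ _ (fun j _ => (j == i)%:R)) => //.
- by move=> x _; exact: continuous_coord.
- by move=> j x _; apply: (isd_eq (isd_coord x _ i)); rewrite mxE eqxx eq_sym.
- by move=> j; exact: Ck_cst.
Qed.

Lemma smooth_sqn U : open U -> smooth cdirs U sqn.
Proof.
move=> oU; apply: (smooth_ext oU (f := fun y => \sum_i y 0 i * y 0 i)).
  by move=> y _; rewrite sqnE.
by apply: smooth_sum => // i; apply: smooth_mul => //; exact: smooth_coord.
Qed.

Lemma smooth_radial_fun U (D : set R) (h : R -> R) : open U -> open D ->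
  smooth1 D h -> (forall x, U x -> D (sqn x)) -> smooth cdirs U (fun x => h (sqn x)).
Proof. by move=> oU oD sh; apply: smooth_comp => //; exact: smooth_sqn. Qed.

Lemma continuous_sqn : continuous sqn.
Proof. by move=> x; exact: (smooth_continuous (smooth_sqn openT)). Qed.

End euclidean.
(** * The metric in geodesic normal coordinates *)

Section metric.
Context {R : realType} {n : nat}.
Variables a m : R.
Implicit Types (x y u v w : 'rV[R]_n) (i j k l : 'I_n).
Local Notation A := (tangential a m).
Local Notation B := (radial a m).
Local Notation D := [set t : R | -1 < t].
Local Notation A1 := (fun t => 'D_1 A t).
Local Notation B1 := (fun t => 'D_1 B t).
Local Notation kd i j := ((i == j)%:R : R).

(** In the exponential chart at 0, the metric dr^2 + f(r)^2 dtheta^2. *)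
Definition gmx x : 'M[R]_n :=
  \matrix_(i, j) (A (sqn x) * kd i j + B (sqn x) * (x 0 i * x 0 j)).

Lemma inner_gmx x u v :
  inner gmx x u v = A (sqn x) * dot u v + B (sqn x) * (dot x u * dot x v).
Proof.
rewrite /inner mxE.
under eq_bigr => j _ do rewrite !mxE.
have E j : (\sum_l u 0 l * gmx x l j) * v 0 j =
    A (sqn x) * (u 0 j * v 0 j) + B (sqn x) * dot x u * (x 0 j * v 0 j).
  have -> : \sum_l u 0 l * gmx x l j = A (sqn x) * u 0 j + B (sqn x) * dot x u * x 0 j.
    rewrite -(sum_delta_r (fun l => u 0 l) j) mulr_sumr /dot mulr_sumr mulr_suml -big_split.
    by apply: eq_bigr => l _; rewrite mxE /=; ring.
  by ring.
rewrite (eq_bigr _ (fun j _ => E j)) big_split -!mulr_sumr /=; congr (_ + _).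
by rewrite -mulrA.
Qed.

Lemma gmx_sym x : (gmx x)^T = gmx x.
Proof. by apply/matrixP => i j; rewrite !mxE eq_sym [x 0 j * _]mulrC. Qed.

Lemma gmx_rotationally_symmetric : rotationally_symmetric gmx.
Proof.
move=> O OO x u v; rewrite !inner_gmx.
have dO y z : dot (y *m O) (z *m O) = dot y z.
  by rewrite !dotE trmx_mul mulmxA -(mulmxA y) OO mulmx1.
by rewrite sqnE !dO -sqnE.
Qed.

Section facts.
Hypotheses (a0 : 0 < a) (a1 : a < 1) (m0 : 0 < m) (m3 : m <= 3^-1).

Let oD : open D. Proof. exact: open_gtm1. Qed.
Let sqnD x : D (sqn x).
Proof. by rewrite /= (lt_le_trans (ltrN10 _))// sqn_ge0. Qed.
Let sA := smooth_tangential m a0 a1.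
Let sB := smooth_radial m a0 a1.
Let A_gt0 x : 0 < A (sqn x).
Proof. exact: tangential_gt0. Qed.
Let AB x : A (sqn x) + sqn x * B (sqn x) = 1.
Proof. exact: tangential_radial. Qed.
Let A_le1 x : A (sqn x) <= 1.
Proof. by rewrite expr_le1// ?warp_le1 ?sqn_ge0// ltW// warp_gt0. Qed.

Lemma smooth_gmx i j : smooth_on setT (fun x => gmx x i j).
Proof.
apply/smooth_onE; have oT := @openT 'rV[R]_n.
apply: (smooth_ext oT (f := fun x => A (sqn x) * kd i j + B (sqn x) * (x 0 i * x 0 j))).
  by move=> x _; rewrite mxE.
apply: (smooth_add oT); apply: (smooth_mul oT).
- exact: (smooth_radial_fun oT oD sA).
- exact: smooth_cst.
- exact: (smooth_radial_fun oT oD sB).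
- by apply: (smooth_mul oT); exact: smooth_coord.
Qed.

(** Since A + t B = 1 and A <= 1, the metric lies between A and 1 times the
    Euclidean one. *)
Lemma inner_gmx_lower x v : A (sqn x) * sqn v <= inner gmx x v v.
Proof.
rewrite inner_gmx -sqnE lerDl; have [x0|x0] := eqVneq x 0.
  by rewrite x0 dotC dot0r !mul0r mulr0.
rewrite mulr_ge0// -?expr2 ?sqr_ge0//.
rewrite -(@pmulr_rge0 _ (sqn x)) ?sqn_gt0//.
by have := AB x; have := A_le1 x; lra.
Qed.

Lemma inner_gmx_upper x v : inner gmx x v v <= sqn v.
Proof.
rewrite inner_gmx -sqnE -expr2; have [x0|x0] := eqVneq x 0.
  have := A_le1 x; rewrite x0 dotC dot0r expr0n mulr0 addr0 => h.
  by rewrite -[leRHS]mul1r ler_wpM2r// sqn_ge0.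
have hx : 0 < sqn x by rewrite sqn_gt0.
have B0 : 0 <= B (sqn x).
  rewrite -(@pmulr_rge0 _ (sqn x))//.
  by have := AB x; have := A_le1 x; lra.
have : B (sqn x) * dot x v ^+ 2 <= B (sqn x) * (sqn x * sqn v).
  by rewrite ler_wpM2l// cauchy_schwarz.
have -> : B (sqn x) * (sqn x * sqn v) = (1 - A (sqn x)) * sqn v by rewrite -(AB x); ring.
by lra.
Qed.

Lemma inner_gmx_radial x v : dot x v ^+ 2 <= sqn x * inner gmx x v v.
Proof.
rewrite inner_gmx -sqnE -expr2.
have -> : sqn x * (A (sqn x) * sqn v + B (sqn x) * dot x v ^+ 2) =
  A (sqn x) * (sqn x * sqn v - dot x v ^+ 2) + (A (sqn x) + sqn x * B (sqn x)) * dot x v ^+ 2.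
  by ring.
rewrite AB mul1r lerDr mulr_ge0 ?(ltW (A_gt0 x))// subr_ge0.
exact: cauchy_schwarz.
Qed.

Lemma gmx_metric : riemannian_metric gmx.
Proof.
split; [exact: smooth_gmx|exact: gmx_sym|move=> x v v0].
by apply: lt_le_trans (inner_gmx_lower x v); rewrite mulr_gt0 ?sqn_gt0.
Qed.

Lemma invmx_gmxE x : gmx x \in unitmx /\ invmx (gmx x) =
  \matrix_(i, j) ((A (sqn x))^-1 * kd i j - B (sqn x) / A (sqn x) * (x 0 i * x 0 j)).
Proof.
set h := \matrix_(i, j) _.
have An0 : A (sqn x) != 0 by rewrite gt_eqF.
have gh : gmx x *m h = 1%:M.
  apply/matrixP => i j; rewrite !mxE.
  pose al := A (sqn x); pose be := B (sqn x).
  transitivity (\sum_l (kd i l * (al * (al^-1 * kd l j - be / al * (x 0 l * x 0 j))) +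
      (be / al * x 0 i) * (kd l j * x 0 l) - be * be / al * x 0 i * x 0 j * x 0 l ^+ 2)).
    by apply: eq_bigr => l _; rewrite !mxE -/al -/be; ring.
  rewrite sumrB big_split /= sum_delta -!mulr_sumr -/(sqn x).
  rewrite (_ : \sum_l kd l j * x 0 l = x 0 j); last first.
    by rewrite -[RHS](sum_delta_r (fun l => x 0 l) j).
  have e := AB x; rewrite -/al -/be in e An0.
  rewrite eq_sym (_ : _ - _ = kd j i + be / al * x 0 i * x 0 j * (1 - (al + sqn x * be))).
    by rewrite e subrr mulr0 addr0 eq_sym.
  by field.
by have [gu] := mulmx1_unit gh; split => //; rewrite -[LHS]mulmx1 -gh mulKmx.
Qed.
End facts.
End metric.
Section gram.
Context {R : realType} {n : nat}.
Implicit Types x u v : 'rV[R]_n.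

Lemma dot0l u : dot 0 u = 0.
Proof. by rewrite dotC dot0r. Qed.

Lemma sqn_comb2 (b c : R) u v :
  sqn (b *: u + c *: v) = b ^+ 2 * sqn u + 2 * b * c * dot u v + c ^+ 2 * sqn v.
Proof. by rewrite sqnD !sqnZ dotZl dotZr; ring. Qed.

Lemma sqn_comb3 (a b c : R) x u v : sqn (a *: x + (b *: u + c *: v)) =
  a ^+ 2 * sqn x + b ^+ 2 * sqn u + c ^+ 2 * sqn v
  + 2 * (a * b * dot x u + a * c * dot x v + b * c * dot u v).
Proof. by rewrite sqnD !sqnZ sqn_comb2 dotZl dotDr !dotZr; ring. Qed.

(** Nonnegativity of the Gram determinant of x, u, v. *)
Lemma gram3 x u v :
  dot x v ^+ 2 * sqn u - 2 * dot x u * dot x v * dot u v + dot x u ^+ 2 * sqn v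
  <= sqn x * (sqn u * sqn v - dot u v ^+ 2).
Proof.
pose W1 := sqn u * sqn v - dot u v ^+ 2.
pose W2 := dot x v ^+ 2 * sqn u - 2 * dot x u * dot x v * dot u v + dot x u ^+ 2 * sqn v.
rewrite -/W1 -/W2; have W10 : 0 <= W1 by rewrite subr_ge0 cauchy_schwarz.
have [W1e|W1n] := eqVneq W1 0.
  have [u0|u0] := eqVneq u 0.
    have -> : W2 = 0 by rewrite /W2 u0 dot0r sqn0 (dotC 0) dot0r; ring.
    by rewrite mulr_ge0 ?sqn_ge0.
  have uu : 0 < sqn u by rewrite sqn_gt0.
  have : sqn ((- dot u v) *: u + sqn u *: v) = sqn u * W1 by rewrite sqn_comb2 /W1; ring.
  rewrite W1e mulr0 => /eqP; rewrite sqn_eq0 => /eqP/(congr1 (dot x)).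
  rewrite dotDr !dotZr dot0r => h.
  suff -> : W2 = 0 by rewrite mulr0.
  apply: (mulfI (lt0r_neq0 uu)); rewrite mulr0.
  have -> : sqn u * W2 = (- dot u v * dot x u + sqn u * dot x v) ^+ 2 + dot x u ^+ 2 * W1.
    by rewrite /W2 /W1; ring.
  by rewrite h W1e mulr0 expr0n addr0.
have W1p : 0 < W1 by rewrite lt_neqAle eq_sym W1n.
rewrite -subr_ge0 -(pmulr_rge0 _ W1p).
pose b1 := dot x u * sqn v - dot x v * dot u v.
pose b2 := dot x v * sqn u - dot x u * dot u v.
have := sqn_ge0 (W1 *: x + ((- b1) *: u + (- b2) *: v)).
rewrite sqn_comb3; congr (_ <= _).
by rewrite /b1 /b2 /W2 /W1; ring.
Qed.

End gram.

Section curvature.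
Context {R : realType} {n : nat}.
Variables a m : R.
Implicit Types (x y u v w : 'rV[R]_n) (i j k l : 'I_n).
Hypotheses (a0 : 0 < a) (a1 : a < 1) (m0 : 0 < m) (m3 : m <= 3^-1).
Local Notation A := (tangential a m).
Local Notation B := (radial a m).
Local Notation D := [set t : R | -1 < t].
Local Notation kd i j := ((i == j)%:R : R).
Local Notation g := (@gmx R n a m).
Local Notation P := (cfP a m).
Local Notation Q := (cfQ a m).
Local Notation S := (cfS a m).
Local Notation K0 := (curv0 a m).
Local Notation K1 := (curv1 a m).
Local Notation K2 := (curv2 a m).

Let sqnD x : D (sqn x).
Proof. by rewrite /= (lt_le_trans (ltrN10 _))// sqn_ge0. Qed.
Let dA x : is_derive (sqn x) 1 A ('D_1 A (sqn x)).
Proof. by have := smooth_is_derive tt (smooth_tangential m a0 a1) (sqnD x). Qed.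
Let dB x : is_derive (sqn x) 1 B ('D_1 B (sqn x)).
Proof. by have := smooth_is_derive tt (smooth_radial m a0 a1) (sqnD x). Qed.
Let AB x : A (sqn x) + sqn x * B (sqn x) = 1.
Proof. exact: tangential_radial. Qed.
Let An0 x : A (sqn x) != 0.
Proof. by rewrite gt_eqF// tangential_gt0. Qed.

Let partial_gmx i j k x : partial i (fun y => g y j k) x =
  2 * 'D_1 A (sqn x) * x 0 i * kd j k +
  (2 * 'D_1 B (sqn x) * x 0 i * (x 0 j * x 0 k) +
   B (sqn x) * (kd i j * x 0 k + x 0 j * kd i k)).
Proof.
apply: isd_partial.
have -> : (fun y => g y j k) = (fun y => A (sqn y) * kd j k + B (sqn y) * (y 0 j * y 0 k)).
  by apply/funext => y; rewrite mxE.
have hA := isd_radial (delta_mx 0 i) (dA x); have hB := isd_radial (delta_mx 0 i) (dB x).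
apply: (isd_eq (isd_add (isd_mul hA (isd_cst (kd j k) x _))
  (isd_mul hB (isd_mul (isd_coord x _ j) (isd_coord x _ k))))).
rewrite dot_delta mulr0 addr0 !mxE !eqxx /=.
by rewrite [j == i]eq_sym [k == i]eq_sym.
Qed.

Let gam k i j x : R := P (sqn x) * (x 0 i * kd j k + x 0 j * kd i k)
  + (Q (sqn x) * kd i j * x 0 k + S (sqn x) * (x 0 i * x 0 j * x 0 k)).

Let christoffel_gmx k i j : christoffel g k i j = gam k i j.
Proof.
apply/funext => x; rewrite /christoffel (proj2 (invmx_gmxE m a0 a1 x)) /gam /cfP /cfQ /cfS.
pose al := A (sqn x); pose be := B (sqn x).
pose al1 : R := 'D_1 A (sqn x); pose be1 : R := 'D_1 B (sqn x).
pose Y l := al1 * (x 0 i * kd j l + x 0 j * kd i l) + (be - al1) * kd i j * x 0 l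
  + be1 * x 0 i * x 0 j * x 0 l.
transitivity (\sum_l (al^-1 * (kd k l * Y l) - be / al * x 0 k * (x 0 l * Y l))).
  rewrite mulr_sumr; apply: eq_bigr => l _.
  rewrite mxE !partial_gmx /Y -/al -/be -/al1 -/be1 (eq_sym j i) (eq_sym l i) (eq_sym l j).
  by field; exact: An0.
rewrite sumrB -!mulr_sumr sum_delta.
have -> : \sum_l x 0 l * Y l =
    2 * al1 * x 0 i * x 0 j + (be - al1) * kd i j * sqn x + be1 * x 0 i * x 0 j * sqn x.
  transitivity (\sum_l (al1 * x 0 i * (kd j l * x 0 l) + al1 * x 0 j * (kd i l * x 0 l) +
     ((be - al1) * kd i j + be1 * x 0 i * x 0 j) * x 0 l ^+ 2)).
    by apply: eq_bigr => l _; rewrite /Y; ring.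
  by rewrite !big_split /= -!mulr_sumr !sum_delta -/(sqn x); ring.
rewrite -/al -/be -/al1 -/be1 /Y; clear Y.
have e : al = 1 - sqn x * be by rewrite -(AB x) -/al -/be; ring.
have := An0 x; rewrite -/al => n0; move: n0.
move: e; move: al be al1 be1 => al be al1 be1 -> n0.
by field.
Qed.

Let partial_gam l i j k x : partial i (gam l j k) x =
  2 * cfP' a m (sqn x) * x 0 i * (x 0 j * kd k l + x 0 k * kd j l) +
  P (sqn x) * (kd i j * kd k l + kd i k * kd j l) +
  (2 * cfQ' a m (sqn x) * x 0 i * kd j k * x 0 l + Q (sqn x) * kd j k * kd i l) +
  (2 * 'D_1 S (sqn x) * x 0 i * (x 0 j * x 0 k * x 0 l) +
   S (sqn x) * (kd i j * x 0 k * x 0 l + x 0 j * kd i k * x 0 l + x 0 j * x 0 k * kd i l)).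
Proof.
apply: isd_partial; set e := delta_mx 0 i.
have hP := isd_radial e (is_derive_cfP m a0 a1 (sqnD x)).
have hQ := isd_radial e (is_derive_cfQ m a0 a1 (sqnD x)).
have hS := isd_radial e (is_derive_cfS m a0 a1 (sqnD x)).
have c b := isd_coord x e b.
have kc b := isd_cst (b : R) x e.
apply: (isd_eq (isd_add (isd_mul hP (isd_add (isd_mul (c j) (kc (kd k l))) (isd_mul (c k) (kc (kd j l)))))
  (isd_add (isd_mul (isd_mul hQ (kc (kd j k))) (c l))
     (isd_mul hS (isd_mul (isd_mul (c j) (c k)) (c l)))))).
rewrite dot_delta !mxE !eqxx /= (eq_sym j i) (eq_sym k i) (eq_sym l i).
by ring.
Qed.

Let sum_gam j k x : \sum_b gam b j k x * x 0 b =
  2 * P (sqn x) * x 0 j * x 0 k + Q (sqn x) * kd j k * sqn x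
  + S (sqn x) * x 0 j * x 0 k * sqn x.
Proof.
transitivity (\sum_b (P (sqn x) * x 0 j * (kd k b * x 0 b) + P (sqn x) * x 0 k * (kd j b * x 0 b)
    + (Q (sqn x) * kd j k + S (sqn x) * x 0 j * x 0 k) * x 0 b ^+ 2)).
  by apply: eq_bigr => b _; rewrite /gam; ring.
by rewrite !big_split /= -!mulr_sumr !sum_delta -/(sqn x); ring.
Qed.

Let sum_gam_gam l i j k x : \sum_b gam b j k x * gam l i b x =
  P (sqn x) * x 0 i * gam l j k x + Q (sqn x) * x 0 l * gam i j k x +
  (P (sqn x) * kd i l + S (sqn x) * x 0 i * x 0 l) *
  (2 * P (sqn x) * x 0 j * x 0 k + Q (sqn x) * kd j k * sqn x
   + S (sqn x) * x 0 j * x 0 k * sqn x).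
Proof.
transitivity (\sum_b (P (sqn x) * x 0 i * (kd b l * gam b j k x) +
   Q (sqn x) * x 0 l * (kd i b * gam b j k x) +
   (P (sqn x) * kd i l + S (sqn x) * x 0 i * x 0 l) * (gam b j k x * x 0 b))).
  by apply: eq_bigr => b _; rewrite {2}/gam; ring.
rewrite !big_split /= -!mulr_sumr sum_delta sum_delta_r sum_gam.
by [].
Qed.

Lemma riemann_gmx l i j k x : riemann g l i j k x =
  K0 (sqn x) * (kd j k * kd i l - kd i k * kd j l) +
  K1 (sqn x) * x 0 k * (x 0 j * kd i l - x 0 i * kd j l) +
  K2 (sqn x) * x 0 l * (x 0 i * kd j k - x 0 j * kd i k).
Proof.
rewrite /riemann !christoffel_gmx.
under eq_bigr => b _ do rewrite !christoffel_gmx.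
rewrite !partial_gam sumrB !sum_gam_gam /gam /curv0 /curv1 /curv2.
rewrite (eq_sym j i) (eq_sym k i) (eq_sym k l) (eq_sym k j).
move: (P _) (Q _) (S _) (cfP' _ _ _) (cfQ' _ _ _) ('D_1 S _) => p q s p' q' s'.
rewrite (eq_sym l k).
move: (sqn x) (x 0 i) (x 0 j) (x 0 k) (x 0 l) => t xi xj xk xl.
move: (kd i j) (kd i k) (kd i l) (kd j k) (kd j l) (kd k l) => dij dik dil djk djl dkl.
ring.
Qed.

Lemma curvature_gmx x u v w : curvature g x u v w =
  K0 (sqn x) *: (dot v w *: u - dot u w *: v) +
  (K1 (sqn x) * dot x w) *: (dot x v *: u - dot x u *: v) +
  (K2 (sqn x) * (dot x u * dot v w - dot x v * dot u w)) *: x.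
Proof.
apply/rowP => l; rewrite !mxE; pose t := sqn x.
have sk i j : \sum_k riemann g l i j k x * u 0 i * v 0 j * w 0 k =
    (K0 t * (w 0 j * kd i l - w 0 i * kd j l) +
     K1 t * dot x w * (x 0 j * kd i l - x 0 i * kd j l) +
     K2 t * x 0 l * (x 0 i * w 0 j - x 0 j * w 0 i)) * u 0 i * v 0 j.
  transitivity (\sum_k (
      (K0 t * kd i l + K2 t * x 0 l * x 0 i) * u 0 i * v 0 j * (kd j k * w 0 k)
      - (K0 t * kd j l + K2 t * x 0 l * x 0 j) * u 0 i * v 0 j * (kd i k * w 0 k)
      + K1 t * (x 0 j * kd i l - x 0 i * kd j l) * u 0 i * v 0 j * (x 0 k * w 0 k))).
    by apply: eq_bigr => k _; rewrite riemann_gmx -/t; ring.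
  rewrite big_split sumrB /= -!mulr_sumr !sum_delta -/(dot x w).
  ring.
have sj i : \sum_j \sum_k riemann g l i j k x * u 0 i * v 0 j * w 0 k =
    K0 t * (dot v w * (kd i l * u 0 i) - u 0 i * w 0 i * v 0 l) +
    K1 t * dot x w * (dot x v * (kd i l * u 0 i) - x 0 i * u 0 i * v 0 l) +
    K2 t * x 0 l * (x 0 i * u 0 i * dot v w - dot x v * (u 0 i * w 0 i)).
  transitivity (\sum_j (
      (K0 t * kd i l + K2 t * x 0 l * x 0 i) * u 0 i * (v 0 j * w 0 j)
      + (K1 t * dot x w * kd i l - K2 t * x 0 l * w 0 i) * u 0 i * (x 0 j * v 0 j)
      - (K0 t * w 0 i + K1 t * dot x w * x 0 i) * u 0 i * (kd j l * v 0 j))).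
    by apply: eq_bigr => j _; rewrite sk; ring.
  rewrite sumrB big_split /= -!mulr_sumr sum_delta_r -/(dot v w) -/(dot x v).
  ring.
transitivity (\sum_i (
   (K0 t * dot v w + K1 t * dot x w * dot x v) * (kd i l * u 0 i)
   - (K0 t * v 0 l + K2 t * x 0 l * dot x v) * (u 0 i * w 0 i)
   + (K2 t * x 0 l * dot v w - K1 t * dot x w * v 0 l) * (x 0 i * u 0 i))).
  by apply: eq_bigr => i _; rewrite sj; ring.
rewrite big_split sumrB /= -!mulr_sumr sum_delta_r -/(dot u w) -/(dot x u) -/t.
ring.
Qed.

(** The planes containing x and those orthogonal to x realise the extreme
    sectional curvatures; the second factor below is at most |x|^2 times the
    first. *)
Let sectional_num x u v : inner g x (curvature g x u v v) u =
  A (sqn x) * (K0 (sqn x) * (sqn u * sqn v - dot u v ^+ 2) +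
    K1 (sqn x) * (dot x v ^+ 2 * sqn u - 2 * dot x u * dot x v * dot u v + dot x u ^+ 2 * sqn v)).
Proof.
rewrite curvature_gmx inner_gmx !(dotDl, dotDr) !(dotZl, dotZr) !dotBr -!sqnE.
rewrite !(dotC _ u) !dotBr !dotZr -!sqnE (dotC u x).
have h := curv_sym m a0 a1 (sqnD x).
have e : A (sqn x) = 1 - sqn x * B (sqn x) by rewrite -(AB x); ring.
have h2 : K2 (sqn x) = A (sqn x) * K1 (sqn x) - B (sqn x) * K0 (sqn x) by rewrite h; ring.
rewrite h2; clear h h2; move: e; move: (A _) (B _) => al be ->.
by ring.
Qed.

Lemma nonneg_sectional_gmx : nonneg_sectional g.
Proof.
move=> x u v _; rewrite /sectional sectional_num !inner_gmx -!sqnE.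
have hg := gram3 x u v; set W1 := _ - dot u v ^+ 2 in hg *.
set W2 := _ + dot x u ^+ 2 * sqn v in hg *.
have W10 : 0 <= W1 by rewrite subr_ge0 cauchy_schwarz.
have A0 : 0 < A (sqn x) by rewrite tangential_gt0.
have W20 : 0 <= W2.
  have := sqn_ge0 (dot x v *: u + (- dot x u) *: v).
  by rewrite sqn_comb2 /W2; congr (_ <= _); ring.
rewrite divr_ge0//.
  rewrite mulr_ge0 ?(ltW A0)//.
  have k0 := curv0_ge0 a0 a1 m0 m3 (sqn_ge0 x).
  have k1 := radial_curv_ge0 a0 a1 m0 m3 (sqn_ge0 x).
  have [K10|K10] := leP 0 (K1 (sqn x)); first by rewrite addr_ge0// mulr_ge0.
  have : K1 (sqn x) * (sqn x * W1) <= K1 (sqn x) * W2 by rewrite ler_nM2l.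
  have : 0 <= (K0 (sqn x) + sqn x * K1 (sqn x)) * W1 by rewrite mulr_ge0.
  lra.
rewrite (_ : _ - _ = A (sqn x) ^+ 2 * W1 + A (sqn x) * (B (sqn x) * W2)); last first.
  by rewrite /W1 /W2; ring.
apply: addr_ge0; apply: mulr_ge0 => //; rewrite ?sqr_ge0 ?(ltW A0)//.
have [x0|x0] := eqVneq x 0.
  have -> : W2 = 0 by rewrite /W2 x0 !dot0l; ring.
  by rewrite mulr0.
rewrite -(@pmulr_rge0 _ (sqn x)) ?sqn_gt0// mulrA mulr_ge0//.
have hA : A (sqn x) <= 1.
  by rewrite expr_le1// ?warp_le1 ?sqn_ge0// ltW// warp_gt0.
by have := AB x; lra.
Qed.

Lemma not_flat_gmx : (1 < n)%N -> ~ flat g.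
Proof.
move=> n1 fl; pose i := Ordinal (ltnW n1); pose j := Ordinal n1.
pose x : 'rV[R]_n := delta_mx 0 i; pose v : 'rV[R]_n := delta_mx 0 j.
have := sectional_num x x v; rewrite fl inner_gmx !(dot0l, dot0r) mulr0 mul0r mulr0 addr0.
have xv : dot x v = 0 by rewrite dot_delta mxE.
have xx : sqn x = 1 by rewrite sqnE dot_delta mxE !eqxx.
have vv : sqn v = 1 by rewrite sqnE dot_delta mxE !eqxx.
rewrite xv -sqnE xx vv expr0n /= !(mulr0, mul0r, mulr1, subr0, oppr0, add0r, expr1n) => /esym/eqP.
rewrite mulf_eq0 gt_eqF ?tangential_gt0//= ?(lt_trans (ltrN10 _))//.
by have := radial_curv_gt0 a0 a1 m0 m3 ltr01; rewrite mul1r => /lt0r_neq0/negbTE ->.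
Qed.

Lemma scalar_curvature_gmx : scalar_curvature g 0 =
  n%:R * (n%:R - 1) * (2 * (1 - a) * (1 - 3 * m)).
Proof.
have A01 : A (sqn (0 : 'rV[R]_n)) = 1 by rewrite sqn0 tangential0.
have ric j k : ricci g j k 0 = K0 0 * (n%:R - 1) * kd j k.
  rewrite /ricci (eq_bigr (fun i => K0 0 * kd j k - K0 0 * (kd i k * kd j i))).
    rewrite sumrB sumr_const card_ord -mulr_sumr sum_delta_r -mulr_natl; ring.
  by move=> i _; rewrite riemann_gmx sqn0 !mxE !eqxx (eq_sym j i) /=; ring.
rewrite /scalar_curvature (proj2 (invmx_gmxE m a0 a1 0)).
transitivity (\sum_(j < n) \sum_(k < n) (kd j k * (K0 0 * (n%:R - 1) * kd j k))).
  apply: eq_bigr => j _; apply: eq_bigr => k _.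
  by rewrite ric !mxE A01 invr1 mul1r mulr0 mulr0 subr0.
transitivity (\sum_(j < n) (K0 0 * (n%:R - 1))).
  by apply: eq_bigr => j _; rewrite sum_delta eqxx mulr1.
rewrite sumr_const card_ord -mulr_natl curv0_at0//; ring.
Qed.

End curvature.
(** * Distance and completeness *)

Section enorm.
Context {R : realType} {n : nat}.
Implicit Types (x y u v w : 'rV[R]_n).

Definition enorm x : R := Num.sqrt (sqn x).

Lemma enorm_ge0 x : 0 <= enorm x. Proof. exact: sqrtr_ge0. Qed.
Lemma enorm_sqr x : enorm x ^+ 2 = sqn x. Proof. by rewrite sqr_sqrtr// sqn_ge0. Qed.
Lemma enorm_gt0 x : (0 < enorm x) = (x != 0). Proof. by rewrite sqrtr_gt0 sqn_gt0. Qed.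
Lemma enormZ (c : R) x : enorm (c *: x) = `|c| * enorm x.
Proof. by rewrite /enorm sqnZ sqrtrM ?sqr_ge0// sqrtr_sqr. Qed.

Lemma coord_le_enorm x i : `|x 0 i| <= enorm x.
Proof.
rewrite -(@ler_pXn2r _ 2)// ?nnegrE// ?enorm_ge0// enorm_sqr real_normK ?num_real//.
by rewrite /sqn (bigD1 i)//= lerDl sumr_ge0// => j _; exact: sqr_ge0.
Qed.

Lemma norm_le_enorm x : `|x| <= enorm x.
Proof.
rewrite /Num.norm/= mx_normrE; apply: bigmax_le => [|[i j] _]; first exact: enorm_ge0.
by rewrite /= ord1; exact: coord_le_enorm.
Qed.

Lemma continuous_enorm : continuous enorm.
Proof.
move=> x; apply: (@continuous_comp _ _ _ sqn (@Num.sqrt R)); first exact: continuous_sqn.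
exact: sqrt_continuous.
Qed.

End enorm.

Section distance.
Context {R : realType} {n : nat}.
Variables a m : R.
Hypotheses (a0 : 0 < a) (a1 : a < 1) (m0 : 0 < m) (m3 : m <= 3^-1).
Implicit Types (x y u v w p q : 'rV[R]_n) (t : R) (c : R -> 'rV[R]_n).
Local Notation g := (@gmx R n a m).
Local Notation A := (tangential a m).
Local Notation B := (radial a m).
Local Notation leb := (@lebesgue_measure R).

Let sqnD x : [set t : R | -1 < t] (sqn x).
Proof. by rewrite /= (lt_le_trans (ltrN10 _))// sqn_ge0. Qed.

Let speedc (c : R -> 'rV[R]_n) t : R := Num.sqrt (inner g (c t) (derive1 c t) (derive1 c t)).

Lemma arc_coord (c : R -> 'rV[R]_n) t i : C1_arc c ->
  is_derive t 1 (fun t => c t 0 i) (derive1 c t 0 i).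
Proof.
move=> [dc _]; have /derivable_mxP h := dc t; split; first exact: h.
by rewrite derive1E derive_mx// mxE.
Qed.

Lemma continuous_arc_coord (c : R -> 'rV[R]_n) i : C1_arc c -> continuous (fun t => c t 0 i).
Proof. by move=> hc t; exact: is_derive_continuous (arc_coord t i hc). Qed.

Lemma continuous_arc_derive (c : R -> 'rV[R]_n) i :
  C1_arc c -> continuous (fun t => derive1 c t 0 i).
Proof.
move=> [_ cc] t; apply: (@continuous_comp _ _ _ (derive1 c) (fun x : 'rV[R]_n => x 0 i)).
  exact: cc.
exact: continuous_coord.
Qed.

Lemma continuous_dot_fun (c d : R -> 'rV[R]_n) : (forall i, continuous (fun t => c t 0 i)) ->
  (forall i, continuous (fun t => d t 0 i)) -> continuous (fun t => dot (c t) (d t)).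
Proof.
move=> hc hd t; rewrite /dot; apply: cvg_big => [|i _]; first exact: add_continuous.
by apply: cvgM; [exact: hc|exact: hd].
Qed.

Lemma continuous_speed c : C1_arc c -> continuous (speedc c).
Proof.
move=> hc t; rewrite /speedc.
apply: (@continuous_comp _ _ _ (fun t => inner g (c t) (derive1 c t) (derive1 c t)) (@Num.sqrt R)).
  2: exact: sqrt_continuous.
have cc i : continuous (fun t => c t 0 i) by exact: continuous_arc_coord.
have cd i : continuous (fun t => derive1 c t 0 i) by exact: continuous_arc_derive.
have csq : {for t, continuous (fun t => sqn (c t))}.
  rewrite (_ : (fun t => sqn (c t)) = fun t => dot (c t) (c t)); first exact: continuous_dot_fun.
  by apply/funext => s; rewrite sqnE.
rewrite (_ : (fun t => _) = (fun t => A (sqn (c t)) * dot (derive1 c t) (derive1 c t) +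
   B (sqn (c t)) * (dot (c t) (derive1 c t) * dot (c t) (derive1 c t)))); last first.
  by apply/funext => s; rewrite inner_gmx.
apply: continuousD; apply: continuousM.
- apply: (@continuous_comp _ _ _ (fun t => sqn (c t)) A) => //.
  exact: smooth_continuous (smooth_tangential m a0 a1) (sqnD _).
- exact: continuous_dot_fun.
- apply: (@continuous_comp _ _ _ (fun t => sqn (c t)) B) => //.
  exact: smooth_continuous (smooth_radial m a0 a1) (sqnD _).
- by apply: continuousM; exact: continuous_dot_fun.
Qed.

(** A function whose derivative along every arc is at most the speed bounds
    lengths from below. *)
Lemma arc_length_ge (c : R -> 'rV[R]_n) (F d : R -> R) : C1_arc c ->
  (forall t, is_derive t 1 F (d t)) -> continuous d -> (forall t, d t <= speedc c t) ->
  F 1 - F 0 <= arc_length g c.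
Proof.
move=> hc dF cd ds.
have dF' t : 0 <= t <= 1 -> is_derive t 1 F (d t) by [].
have cd' t : 0 <= t <= 1 -> {for t, continuous d} by move=> _; exact: cd.
rewrite -(FTC01 dF' cd') /arc_length; apply: le_Rintegral => //.
  exact: integrable_cont01.
by apply: integrable_cont01 => t _; exact: continuous_speed.
Qed.

Lemma path_length_ge (F : 'rV[R]_n -> R) : (forall c, C1_arc c -> F (c 1) - F (c 0) <= arc_length g c) ->
  forall s p q, path_between p q s -> F q - F p <= \sum_(c <- s) arc_length g c.
Proof.
move=> h; elim => [|c s IH] p q /=; first by move=> ->; rewrite big_nil subrr.
move=> [hc <- /IH hs]; rewrite big_cons; have := h c hc; lra.
Qed.

Lemma is_derive_dot_arc c t w : C1_arc c ->
  is_derive t 1 (fun t => dot (c t) w) (dot (derive1 c t) w).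
Proof.
move=> hc; apply: (isd_eq (isd_sum (fun i => isd_mul (arc_coord t i hc) (isd_cst (w 0 i) t 1)))).
by apply: eq_bigr => i _; rewrite mulr0 addr0.
Qed.

Lemma is_derive_sqn_arc c t : C1_arc c ->
  is_derive t 1 (fun t => sqn (c t)) (2 * dot (c t) (derive1 c t)).
Proof.
move=> hc; have h := isd_sum (fun i => isd_mul (arc_coord t i hc) (arc_coord t i hc)).
rewrite (_ : (fun t => sqn (c t)) = (fun t => \sum_i c t 0 i * c t 0 i)).
  by apply: (isd_eq h); rewrite mulr_sumr; apply: eq_bigr => i _; ring.
by apply/funext => s; rewrite sqnE.
Qed.

Let le_speed (c : R -> 'rV[R]_n) t (b : R) :
  b ^+ 2 <= inner g (c t) (derive1 c t) (derive1 c t) -> b <= speedc c t.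
Proof.
move=> h; apply: le_trans (ler_norm _) _; rewrite -sqrtr_sqr.
exact: ler_wsqrtr.
Qed.

Lemma path_length_lower s p q : path_between p q s ->
  a * enorm (q - p) <= \sum_(c <- s) arc_length g c.
Proof.
move=> hs; have [->|pq] := eqVneq q p.
  rewrite subrr /enorm sqn0 sqrtr0 mulr0; apply: sumr_ge0 => c _.
  by apply: Rintegral_ge0 => t _; exact: sqrtr_ge0.
have e0 : 0 < enorm (q - p) by rewrite enorm_gt0 subr_eq0.
pose w := (a / enorm (q - p)) *: (q - p).
have := @path_length_ge (dot ^~ w) _ s p q hs.
have -> : dot q w - dot p w = a * enorm (q - p).
  rewrite !(dotC _ w) -dotBr dotZl -sqnE -enorm_sqr; field.
  by rewrite gt_eqF.
apply=> c hc; apply: (@arc_length_ge c (fun t => dot (c t) w) (fun t => dot (derive1 c t) w)) => //.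
- by move=> t; exact: is_derive_dot_arc.
- apply: continuous_dot_fun => i; first exact: continuous_arc_derive.
  exact: continuous_fun_cst.
- move=> t; apply: le_speed; apply: le_trans (cauchy_schwarz _ _) _.
  have -> : sqn w = a ^+ 2.
    rewrite /w sqnZ -enorm_sqr; field; by rewrite gt_eqF.
  apply: le_trans (inner_gmx_lower a0 a1 m0 m3 _ _).
  rewrite mulrC ler_wpM2r ?sqn_ge0// ler_pXn2r ?nnegrE ?(ltW a0)//.
    exact: warp_ge (sqn_ge0 _).
  exact: ltW (warp_gt0 m a0 a1 (sqnD _)).
Qed.

(** The function sqrt (|x|^2 + e^2) regularises the norm at the origin. *)
Lemma path_length_radial s q : path_between 0 q s ->
  enorm q <= \sum_(c <- s) arc_length g c.
Proof.
move=> hs; apply/ler_addgt0Pr => e e0.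
pose N x : R := Num.sqrt (sqn x + e ^+ 2).
have Np x : 0 < sqn x + e ^+ 2 by rewrite ltr_wpDl ?sqn_ge0// exprn_gt0.
have h := @path_length_ge N _ s 0 q hs.
have {}h : N q - N 0 <= \sum_(c <- s) arc_length g c.
  apply: h => c hc.
  have cN : continuous (fun t => N (c t)).
    move=> t; apply: (@continuous_comp _ _ _ (fun t => sqn (c t) + e ^+ 2) (@Num.sqrt R)).
      apply: continuousD; last exact: cst_continuous.
      exact: is_derive_continuous (is_derive_sqn_arc t hc).
    exact: sqrt_continuous.
  apply: (@arc_length_ge c (fun t => N (c t)) (fun t => dot (c t) (derive1 c t) / N (c t))) => //.
  - move=> t.
    have h1 := isd_add (is_derive_sqn_arc t hc) (isd_cst (e ^+ 2) t 1).
    apply: (isd_eq (isd_comp h1 (is_derive1_sqrt (Np (c t))))).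
    rewrite addr0 -/(N (c t)); field.
    by rewrite gt_eqF// sqrtr_gt0.
  - move=> t; apply: cvgM.
      apply: continuous_dot_fun => i; first exact: continuous_arc_coord.
      exact: continuous_arc_derive.
    by apply: cvgV; [rewrite gt_eqF// sqrtr_gt0|exact: cN].
  - move=> t; apply: le_speed; rewrite expr_div_n sqr_sqrtr ?(ltW (Np _))//.
    rewrite ler_pdivrMr//; apply: le_trans (inner_gmx_radial m a0 a1 _ _) _.
    rewrite mulrC ler_wpM2l//.
      apply: le_trans (inner_gmx_lower a0 a1 m0 m3 _ _).
      by rewrite mulr_ge0 ?sqn_ge0// sqr_ge0.
    by rewrite lerDl sqr_ge0.
have N0 : N 0 = e by rewrite /N sqn0 add0r sqrtr_sqr gtr0_norm.
have : enorm q <= N q by apply: ler_wsqrtr; rewrite lerDl sqr_ge0.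
by move: h; rewrite N0; lra.
Qed.

Let line p q (t : R) : 'rV[R]_n := p + t *: (q - p).

Let derive_line p q t : is_derive t 1 (line p q) (q - p).
Proof.
have h i j : is_derive t 1 (fun t => line p q t i j) ((q - p) i j).
  rewrite (_ : (fun t => _) = fun t => p i j + t * (q - p) i j).
    by apply: (isd_eq (isd_add (isd_cst (p i j) t 1) (isd_mul (isd_id t) (isd_cst ((q - p) i j) t 1))));
      rewrite mulr0 addr0 add0r mul1r.
  by apply/funext => s; rewrite !mxE.
have d : derivable (line p q) t 1 by apply/derivable_mxP => i j; have [] := h i j.
split => //; rewrite derive_mx//; apply/matrixP => i j; rewrite mxE.
by have [_ ->] := h i j.
Qed.

Let derive1_line p q : derive1 (line p q) = fun=> q - p.
Proof. by apply/funext => t; rewrite derive1E; have [_ ->] := derive_line p q t. Qed.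

Let line_arc p q : C1_arc (line p q).
Proof.
split; first by move=> t; have [] := derive_line p q t.
by rewrite derive1_line => t; exact: cst_continuous.
Qed.

Let line_length p q : arc_length g (line p q) <= enorm (q - p).
Proof.
have hc := line_arc p q.
apply: (@le_trans _ _ (\int[leb]_(t in `[0, 1]) enorm (q - p))).
  apply: le_Rintegral => //.
  - by apply: integrable_cont01 => t _; exact: continuous_speed.
  - by apply: integrable_cont01 => t _; exact: cst_continuous.
  - by move=> t _; rewrite derive1_line; apply: ler_wsqrtr; exact: inner_gmx_upper.
rewrite Rintegral_cst//= lebesgue_measure_itv/= lte_fin ltr01.
by rewrite oppr0 adde0 mulr1.
Qed.

Let lengths p q := [set \sum_(c <- s) arc_length g c | s in path_between p q].

Let lengths_line p q : lengths p q (arc_length g (line p q)).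
Proof.
exists [:: line p q]; last by rewrite big_seq1.
by split; [exact: line_arc|rewrite /line scale0r addr0|rewrite /line scale1r addrC subrK].
Qed.

Lemma dist_upper p q : dist g p q <= enorm (q - p).
Proof.
apply: le_trans (line_length p q); apply: ge_inf; last exact: lengths_line.
exists (a * enorm (q - p)) => _ [s hs <-]; exact: path_length_lower.
Qed.

Lemma dist_lower p q : a * enorm (q - p) <= dist g p q.
Proof.
apply: lb_le_inf; first by exists (arc_length g (line p q)); exact: lengths_line.
by move=> _ [s hs <-]; exact: path_length_lower.
Qed.

Lemma dist0 x : dist g 0 x = enorm x.
Proof.
apply/eqP; rewrite eq_le; apply/andP; split.
  by have := dist_upper 0 x; rewrite subr0.
apply: lb_le_inf; first by exists (arc_length g (line 0 x)); exact: lengths_line.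
by move=> _ [s hs <-]; exact: path_length_radial.
Qed.

Lemma complete_gmx : complete_metric g.
Proof.
move=> s hs.
have hcoord k : cvg ((fun i => s i 0 k) @ \oo).
  apply/cauchy_cvgP/cauchy_ballP => e e0; have ae : 0 < a * e by rewrite mulr_gt0.
  have [N HN] := hs _ ae.
  pose T : set R := (fun i => s i 0 k) @` [set i | (N <= i)%N].
  have oT : \forall i \near \oo, T (s i 0 k) by exists N => // i Ni; exists i.
  exists (T, T) => //= -[_ _] /= [[i /= Ni <-] [j /= Nj <-]]; rewrite /ball/=.
  have := le_lt_trans (dist_lower _ _) (HN j i Nj Ni); rewrite ltr_pM2l//.
  apply: le_lt_trans; apply: le_trans (coord_le_enorm _ k).
  by rewrite !mxE.
pose l : 'rV[R]_n := \row_k lim ((fun i => s i 0 k) @ \oo).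
exists l.
have h1 : (fun i => enorm (l - s i)) @ \oo --> 0.
  have h : (fun i => l - s i) @ \oo --> (0 : 'rV[R]_n).
    apply/cvgrPdist_le => e e0; near=> i.
    rewrite sub0r normrN /Num.norm/= mx_normrE; apply: bigmax_le; first exact: ltW.
    move=> [j k] _ /=; rewrite !ord1 !mxE.
    by move: k; near: i; apply: filter_forall => k; exact: (cvgrPdist_le _ _).1 (hcoord k) e e0.
  have := cvg_comp _ _ h (@continuous_enorm R n 0).
  by rewrite /enorm sqn0 sqrtr0.
apply: (@squeeze_cvgr _ _ _ _ (fun=> 0) (fun i => enorm (l - s i)) _ _ _) => //; last exact: cvg_cst.
near=> i; rewrite dist_upper andbT.
by apply: le_trans (dist_lower _ _); rewrite mulr_ge0 ?enorm_ge0// ltW.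
Unshelve. all: by end_near. Qed.

End distance.
(** * Lebesgue measure on R^n *)

Section affine_maps.
Context {R : realType}.
Local Notation leb := (@lebesgue_measure R).

Definition affine1 (s c : R) (t : measurableTypeR R) : measurableTypeR R := s * t + c.

Lemma measurable_affine1 s c : measurable_fun setT (affine1 s c).
Proof. apply: measurable_funD; last exact: measurable_cst.
by apply: measurable_funM; [exact: measurable_cst|exact: measurable_id]. Qed.

Lemma lebesgue_measure_affine1 (s c : R) (A : set (measurableTypeR R)) : 0 < s ->
  measurable A -> leb (affine1 s c @^-1` A) = (s^-1%:E * leb A)%E.
Proof.
move=> s0 mA; have s0' := ltW s0.
have E : forall B, measurable B -> leb B = mscale (NngNum s0') (pushforward leb (affine1 s c)) B.
  move=> mf; apply: lebesgue_measure_unique => _ [[u v] _ <-].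
  transitivity (s%:E * leb (affine1 s c @^-1` `]u, v]))%E; last by [].
  have -> : affine1 s c @^-1` `]u, v] = [set` `](u - c) / s, (v - c) / s]].
    apply/seteqP; split => t; rewrite /= !in_itv/= /affine1.
      by rewrite ltr_pdivrMr// ler_pdivlMr// ltrBlDr lerBrDr mulrC.
    by rewrite ltr_pdivrMr// ler_pdivlMr// ltrBlDr lerBrDr mulrC.
  rewrite !lebesgue_measure_itv/= !lte_fin ltr_pM2r ?invr_gt0// ltrD2r.
  case: ifP => uv; last by rewrite mule0.
  rewrite -!EFinB -EFinM; congr _%:E; field.
  by rewrite gt_eqF.
rewrite (E (measurable_affine1 s c) A mA).
rewrite (_ : mscale _ _ _ = s%:E * leb (affine1 s c @^-1` A))%E// muleA -EFinM.
by rewrite mulVf ?mul1e// gt_eqF.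
Qed.

End affine_maps.

Section lebesgue_rV.
Context {R : realType} {n : nat}.
Local Notation leb := (@lebesgue_measure R).
Local Notation lam := (@lebesgue_rV R n).
Implicit Types (x y v : 'rV[R]_n).

Definition rV_box (A : 'I_n -> set (measurableTypeR R)) : set 'rV[R]_n :=
  [set x | forall i, A i (x 0 i)].

Lemma measurable_rV_box A : (forall i, measurable (A i)) -> measurable (rV_box A).
Proof.
move=> mA.
rewrite (_ : rV_box A = \bigcap_(i in [set: 'I_n]) [set x : 'rV[R]_n | A i (x 0 i)]).
  apply: fin_bigcap_measurable => // i _.
  by rewrite -[X in measurable X]setTI; exact: measurable_coord.
by apply/seteqP; split => [x Ax i _|x Ax i]; exact: Ax.
Qed.

(** A measure with the values of the Lebesgue measure on boxes is the Lebesgue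
    measure, boxes being stable under intersection. *)
Lemma lebesgue_rV_unique (mu : {measure set 'rV[R]_n -> \bar R}) :
  (forall A : 'I_n -> set (measurableTypeR R), (forall i, measurable (A i)) ->
    mu [set x | forall i, A i (x 0 i)] = (\prod_(i < n) leb (A i))%E) ->
  forall B, measurable B -> mu B = lam B.
Proof.
move=> H B mB.
pose G : set (set 'rV[R]_n) := [set C | exists A, (forall i, measurable (A i)) /\ C = rV_box A].
pose gk (k : nat) := rV_box (fun=> [set` `[- k%:R, k%:R]]).
apply: (measure_unique G gk) => //.
- apply/seteqP; split.
    apply: smallest_sub; first exact: smallest_sigma_algebra.
    rewrite -bigcup_seq; apply: bigcup_sub => i _ C [A mA <-].
    apply: sub_sigma_algebra.
    exists (fun j => if j == i then A else setT); split; first by move=> j; case: ifP.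
    rewrite setTI; apply/seteqP; split => [x /= Ax j|x /= /(_ i)]; last by rewrite eqxx.
    by case: ifP => // /eqP ->.
  apply: smallest_sub; first exact: sigma_algebra_measurable.
  by move=> C [A [mA ->]]; exact: measurable_rV_box.
- move=> C1 C2 [A1 [m1 ->]] [A2 [m2 ->]]; exists (fun i => A1 i `&` A2 i); split.
    by move=> i; exact: measurableI.
  apply/seteqP; split => [x [h1 h2] i|x h]; first by split; [exact: h1|exact: h2].
  by split => i; have [] := h i.
- by move=> k; exists (fun=> [set` `[- k%:R, k%:R]]).
- apply/seteqP; split => // x _.
  exists (Num.truncn (enorm x)).+1 => // i /=; rewrite in_itv/= -ler_norml.
  by rewrite (le_trans (coord_le_enorm x i))// ltW// truncnS_gt.
- by move=> C [A [mA ->]]; exact: etrans (H A mA) (esym (lebesgue_rV_box mA)).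
- move=> k; have -> : mu (gk k) = (\prod_(i < n) leb [set` `[- k%:R, k%:R]%R])%E.
    by apply: (H (fun=> [set` `[- k%:R, k%:R]])) => i; exact: measurable_itv.
  suff : (0 <= \prod_(i < n) leb [set` `[- k%:R, k%:R]%R] < +oo)%E by case/andP.
  elim/big_ind: _ => [|u w /andP[u0 uoo] /andP[w0 woo]|i _]; first by rewrite lee01 ltry.
    by rewrite mule_ge0//= lte_mul_pinfty// ge0_fin_numE.
  by rewrite measure_ge0/= lebesgue_measure_itv/=; case: ifP => _; rewrite ltry.
Qed.

Definition affine (s : R) v x : 'rV[R]_n := s *: x + v.

Lemma measurable_affine s v : measurable_fun setT (affine s v).
Proof.
apply: measurable_fun_rV => i.
rewrite (_ : (fun _ => _) = (fun x : 'rV[R]_n => s * x 0 i + v 0 i)); last first.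
  by apply/funext => x; rewrite !mxE.
apply: measurable_funD; last exact: measurable_cst.
by apply: measurable_funM; [exact: measurable_cst|exact: measurable_coord].
Qed.

Lemma lebesgue_rV_affine (s : R) v (A : set 'rV[R]_n) : 0 < s -> measurable A ->
  (lam (affine s v @^-1` A) = (s ^- n)%:E * lam A)%E.
Proof.
move=> s0 mA; have sn0 : 0 <= s ^+ n by rewrite exprn_ge0// ltW.
have E : forall B, measurable B -> mscale (NngNum sn0) (pushforward lam (affine s v)) B = lam B.
  move=> mf; apply: lebesgue_rV_unique => B mB.
  transitivity ((s ^+ n)%:E * lam (affine s v @^-1` (rV_box B)))%E; first by [].
  have -> : affine s v @^-1` (rV_box B) =
      [set x | forall i, (affine1 s (v 0 i) @^-1` (B i)) (x 0 i)].
    by apply/seteqP; split => x /= h i; have := h i; rewrite /affine /affine1 !mxE.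
  rewrite (_ : lam _ = \prod_(i < n) leb (affine1 s (v 0%R i) @^-1` (B i)))%E; last first.
    apply: (lebesgue_rV_box (A := fun i => affine1 s (v 0 i) @^-1` (B i))) => i.
    by rewrite -[X in measurable X]setTI; exact: measurable_affine1.
  rewrite (eq_bigr (fun i => s^-1%:E * leb (B i))%E); last first.
    by move=> i _; rewrite lebesgue_measure_affine1.
  rewrite big_split/= prodEFin prodr_const card_ord muleA -EFinM -exprMn.
  by rewrite divff ?expr1n ?mul1e// gt_eqF.
rewrite -(E (measurable_affine s v) A mA).
rewrite (_ : mscale _ _ _ = (s ^+ n)%:E * lam (affine s v @^-1` A))%E// muleA -EFinM.
by rewrite mulVf ?mul1e// expf_neq0// gt_eqF.
Qed.

Lemma ge0_integral_affine (s : R) v (f : 'rV[R]_n -> \bar R) : 0 < s ->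
  measurable_fun setT f -> (forall x, 0 <= f x)%E ->
  (\int[lam]_x f (affine s v x) = (s ^- n)%:E * \int[lam]_x f x)%E.
Proof.
move=> s0 mf f0; have sn0 : 0 <= s ^- n by rewrite invr_ge0 exprn_ge0// ltW.
transitivity (\int[pushforward lam (affine s v)]_x f x)%E.
  by rewrite ge0_integral_pushforward//; exact: measurable_affine.
transitivity (\int[mscale (NngNum sn0) lam]_x f x)%E; last by rewrite ge0_integral_mscale.
apply: eq_measure_integral => [|mf' A mA _]; first exact: measurable_affine.
exact: lebesgue_rV_affine.
Qed.

End lebesgue_rV.
Section borel.
Context {R : realType} {n : nat}.
Local Notation leb := (@lebesgue_measure R).
Local Notation lam := (@lebesgue_rV R n).
Implicit Types (x y v : 'rV[R]_n).

(** Open sets are countable unions of rational cubes. *)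
Lemma open_measurable_rV (U : set 'rV[R]_n) : open U -> measurable U.
Proof.
move=> oU.
pose cube (q : 'rV[int]_n * nat) : set 'rV[R]_n :=
  [set y | forall i, `|y 0 i - (q.1 0 i)%:~R / q.2.+1%:R| < 2 / q.2.+1%:R].
have mcube q : measurable (cube q).
  pose c i : R := (q.1 0 i)%:~R / q.2.+1%:R; pose r : R := 2 / q.2.+1%:R.
  rewrite (_ : cube q = rV_box (fun i => [set` `]c i - r, c i + r[])).
    by apply: measurable_rV_box => i; exact: measurable_itv.
  by apply/seteqP; split => y h i; have := h i; rewrite /= in_itv/= -/(c i) -/r ltr_distl.
rewrite (_ : U = \bigcup_(q in [set: 'rV[int]_n * nat]) (if `[< cube q `<=` U >] then cube q else set0)).
  apply: countable_bigcupT_measurable => [|q]; first exact: countableP.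
  by case: ifP.
apply/seteqP; split => [x Ux|x [q _]]; last by case: ifPn => // /asboolP; apply.
have /nbhs_ballP[e /= e0 He] : nbhs x U by exact: open_nbhs_nbhs.
pose k := Num.truncn (4 / e); have k0 : 0 < k.+1%:R :> R by rewrite ltr0n.
have ke : 4 / k.+1%:R < e by rewrite ltr_pdivrMr// mulrC -ltr_pdivrMr// truncnS_gt.
pose q : 'rV[int]_n := \row_i Num.floor (x 0 i * k.+1%:R).
have xq i : `|x 0 i - (q 0 i)%:~R / k.+1%:R| < 2 / k.+1%:R.
  rewrite ltr_distl -mulrBl -mulrDl ltr_pdivrMr// ltr_pdivlMr// mxE.
  have h1 := floor_le (x 0 i * k.+1%:R); have h2 := floorD1_gt (x 0 i * k.+1%:R).
  by move: h2; rewrite intrD => h2; apply/andP; split; lra.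
have sub : cube (q, k) `<=` U.
  move=> y /= yq; apply: He; split => // i j; rewrite ord1 /ball/=.
  apply: le_lt_trans ke.
  have := ltW (xq j); have := ltW (yq j); rewrite !ler_distl => /andP[h1 h2] /andP[h3 h4].
  move: h1 h2 h3 h4 => /=; move: (k.+1%:R^-1) => z; move: (_%:~R * z) => c.
  by move=> h1 h2 h3 h4; apply/andP; split; lra.
by exists (q, k) => //; rewrite (asboolT sub).
Qed.

Lemma continuous_measurable_rV (f : 'rV[R]_n -> R) : continuous f ->
  measurable_fun setT f.
Proof.
move=> /continuousP cf; apply: (measurability _ (RGenOpens.measurableE R)).
move=> _ [_ [u [v ->] <-]]; rewrite setTI; apply: open_measurable_rV.
exact/cf/interval_open.
Qed.

Definition eball (r : R) : set 'rV[R]_n := [set x | enorm x < r].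

Lemma measurable_eball r : measurable (eball r).
Proof.
apply: open_measurable_rV.
rewrite (_ : eball r = enorm @^-1` [set t | t < r])//.
apply: open_comp; last exact: open_lt.
by move=> x _; exact: continuous_enorm.
Qed.

Lemma lebesgue_eball r : 0 < r -> (lam (eball r) = (r ^+ n)%:E * lam (eball 1))%E.
Proof.
move=> r0.
have -> : eball r = affine r^-1 0 @^-1` eball 1.
  apply/seteqP; split => x; rewrite /eball/= /affine addr0 enormZ gtr0_norm ?invr_gt0//.
    by rewrite mulrC ltr_pdivrMr// mul1r.
  by rewrite mulrC ltr_pdivrMr// mul1r.
by rewrite lebesgue_rV_affine ?invr_gt0 ?exprVn ?invrK//; exact: measurable_eball.
Qed.

Lemma lebesgue_eball1_fin : (lam (eball 1) < +oo)%E.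
Proof.
pose A : 'I_n -> set (measurableTypeR R) := fun=> [set` `[-1, 1]%R].
have mA i : measurable (A i) by exact: measurable_itv.
apply: (@le_lt_trans _ _ (lam (rV_box A))).
  apply: le_measure; rewrite ?inE; [exact: measurable_eball|exact: measurable_rV_box|].
  move=> x /= x1 i; rewrite /A/= in_itv/= -ler_norml.
  by rewrite (le_trans (coord_le_enorm x i))// ltW.
have -> : lam (rV_box A) = (\prod_(i < n) leb (A i))%E by exact: lebesgue_rV_box.
rewrite (eq_bigr (fun=> (2 : R)%:E)) ?prodEFin ?ltry// => i _.
have lt1 : -1 < 1 :> R by lra.
by rewrite lebesgue_measure_itv/= lte_fin lt1 -EFinB opprK.
Qed.

Lemma lebesgue_eball1_gt0 : (0 < lam (eball 1))%E.
Proof.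
pose d : R := n.+1%:R^-1; have d0 : 0 < d by rewrite invr_gt0 ltr0n.
pose A : 'I_n -> set (measurableTypeR R) := fun=> [set` `]0, d[%R].
have mA i : measurable (A i) by exact: measurable_itv.
apply: (@lt_le_trans _ _ (lam (rV_box A))); last first.
  apply: le_measure; rewrite ?inE; [exact: measurable_rV_box|exact: measurable_eball|].
  move=> x /= hx; rewrite /eball/= -(@ltr_pXn2r _ 2)// ?nnegrE ?enorm_ge0// enorm_sqr expr1n.
  apply: (@le_lt_trans _ _ (\sum_(i < n) d)).
    apply: ler_sum => i _; have := hx i; rewrite /A/= in_itv/= => /andP[x0 xd].
    have d1 : d <= 1 by rewrite invf_le1 ?ltr0n// ler1n.
    by rewrite expr2 -[leRHS]mulr1 ler_pM ?(ltW x0) ?(ltW xd)// (le_trans (ltW xd)).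
  by rewrite sumr_const card_ord -mulr_natl ltr_pdivrMr ?ltr0n// mul1r ltr_nat.
have -> : lam (rV_box A) = (\prod_(i < n) leb (A i))%E by exact: lebesgue_rV_box.
rewrite (eq_bigr (fun=> d%:E)) ?prodEFin ?lte_fin ?prodr_const ?exprn_gt0// => i _.
by rewrite lebesgue_measure_itv/= lte_fin d0 -EFinB subr0.
Qed.

Local Notation omega := (@unit_ball_volume R n).

Lemma lebesgue_eball1 : lam (eball 1) = omega%:E.
Proof.
have E : eball 1 = [set x : 'rV[R]_n | \sum_i x 0 i ^+ 2 < 1].
  apply/seteqP; split => x; rewrite /eball/= -/(sqn x) -enorm_sqr.
    by move=> h; rewrite expr_lt1 ?enorm_ge0.
  by rewrite expr_lt1 ?enorm_ge0.
rewrite /unit_ball_volume -E fineK// ge0_fin_numE//; exact: lebesgue_eball1_fin.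
Qed.

Lemma unit_ball_volume_gt0 : 0 < omega.
Proof. by rewrite -lte_fin -lebesgue_eball1; exact: lebesgue_eball1_gt0. Qed.

Lemma lebesgue_eballE r : 0 < r -> lam (eball r) = (omega * r ^+ n)%:E.
Proof. by move=> r0; rewrite lebesgue_eball// lebesgue_eball1 -EFinM mulrC. Qed.

Lemma measurable_rV0 : measurable [set (0 : 'rV[R]_n)].
Proof.
rewrite (_ : [set 0] = rV_box (fun=> [set 0])).
  by apply: measurable_rV_box => i; exact: measurable_set1.
apply/seteqP; split => [x -> i|x h]; first by rewrite mxE.
by apply/rowP => i; rewrite h mxE.
Qed.

Lemma lebesgue_rV0 : (0 < n)%N -> lam [set 0] = 0%E.
Proof.
move=> n0; apply/eqP; rewrite -measure_le0; apply/lee_addgt0Pr => e e0; rewrite add0e.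
pose r := Num.min 1 (e / omega).
have o0 := unit_ball_volume_gt0.
have r0 : 0 < r by rewrite /r lt_min ltr01 divr_gt0.
apply: (@le_trans _ _ (lam (eball r))).
  apply: le_measure; rewrite ?inE; [exact: measurable_rV0|exact: measurable_eball|].
  by move=> x ->; rewrite /eball/= /enorm sqn0 sqrtr0.
rewrite lebesgue_eballE// lee_fin.
have r1 : r <= 1 by rewrite /r ge_min lexx.
have re : r <= e / omega by rewrite /r ge_min lexx orbT.
apply: (@le_trans _ _ (omega * r)); last by rewrite mulrC -ler_pdivlMr.
by rewrite ler_pM2l// -[leRHS]expr1; apply: ler_wiXn2l; rewrite ?(ltW r0).
Qed.

Lemma unit_sphere_areaE : (0 < n)%N -> @unit_sphere_area R n = n%:R * omega.
Proof.
move=> n0; rewrite /unit_sphere_area /sphere_measure.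
set C := (X in lebesgue_rV X).
have CE : C = [set x | 0 < enorm x <= 1].
  apply/seteqP; split => [_ [t /= /andP[t0 t1]] [u /= u1 <-]|x /= /andP[x0 x1]].
    have un : enorm u = 1 by rewrite /enorm /sqn u1 sqrtr1.
    by rewrite enormZ un mulr1 gtr0_norm// t0.
  exists (enorm x) => /=; first by rewrite x0.
  exists ((enorm x)^-1 *: x); last by rewrite scalerA divff ?scale1r// gt_eqF.
  by rewrite /= -/(sqn _) sqnZ -enorm_sqr -exprMn mulVf ?expr1n// gt_eqF.
have mC : measurable C.
  have -> : C = ~` (~` [set x | enorm x <= 1] `|` [set 0]).
    rewrite CE setCU setCK; apply/seteqP; split => x /=; rewrite enorm_gt0.
      by move=> /andP[x0 x1]; split => //; exact/eqP.
    by move=> [-> /eqP ->].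
  apply: measurableC; apply: measurableU.
    apply: open_measurable_rV; rewrite (_ : ~` _ = enorm @^-1` [set t | 1 < t]).
      by apply: open_comp; [move=> x _; exact: continuous_enorm|exact: open_gt].
    by apply/seteqP; split => x /=; [move=> /negP; rewrite -ltNge|move=> h; apply/negP; rewrite -ltNge].
  exact: measurable_rV0.
suff -> : lebesgue_rV C = omega%:E by [].
apply/eqP; rewrite eq_le; apply/andP; split.
  have o0 := unit_ball_volume_gt0.
  have H r : 1 < r -> (lam C <= (omega * r ^+ n)%:E)%E.
    move=> r1; have r0 : 0 < r by rewrite (lt_trans ltr01).
    rewrite -lebesgue_eballE//; apply: le_measure; rewrite ?inE//; first exact: measurable_eball.
    by rewrite CE => x /= /andP[_ x1]; rewrite /eball/= (le_lt_trans x1).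
  apply/lee_addgt0Pr => e e0; rewrite -EFinD.
  have cv : (fun r : R => omega * r ^+ n) x @[x --> 1^'+] --> omega * 1 ^+ n.
    apply: cvg_at_right_filter; apply: cvgM; first exact: cvg_cst.
    exact: exprn_continuous.
  rewrite expr1n mulr1 in cv.
  have hn : \forall r \near (1 : R)^'+, omega * r ^+ n < omega + e.
    by apply: (cvgr_lt _ cv); rewrite ltrDl.
  near (1 : R)^'+ => r.
  apply: (le_trans (H r _)); first by near: r; exact: nbhs_right_gt.
  by rewrite lee_fin ltW//; near: r.
rewrite -lebesgue_eball1 -[leRHS]adde0 -(lebesgue_rV0 n0).
apply: (@le_trans _ _ (lam (C `|` [set 0]))).
  apply: le_measure; rewrite ?inE; first exact: measurable_eball.
    by apply: measurableU => //; exact: measurable_rV0.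
  move=> x x1; have [->|x0] := eqVneq x 0; [by right|left].
  by rewrite CE /= enorm_gt0 x0 ltW.
by apply: measureU2 => //; exact: measurable_rV0.
Unshelve. all: by end_near. Qed.

End borel.
(** * Volume *)

Section rank_one.
Context {F : fieldType}.

(** Two triangular factorisations of one bordered matrix. *)
Lemma det_scalar_rank1 n (c : F) (z : 'cV[F]_n) (w : 'rV[F]_n) : c != 0 ->
  \det (c%:M + z *m w) = c ^+ n * (1 + c^-1 * (w *m z) 0 0).
Proof.
move=> c0; pose X := block_mx (1%:M : 'M[F]_1) w (- z) (c%:M : 'M[F]_n).
have e1 : block_mx (1%:M : 'M[F]_1) 0 z (1%:M : 'M[F]_n) *m X = block_mx 1%:M w 0 (c%:M + z *m w).
  rewrite mulmx_block !mul1mx !mul0mx !addr0 mulmx1 addrN.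
  by rewrite addrC.
have e2 : X *m block_mx (1%:M : 'M[F]_1) 0 (c^-1 *: z) (1%:M : 'M[F]_n) =
    block_mx (1%:M + c^-1 *: (w *m z)) w 0 c%:M.
  rewrite mulmx_block !mulmx1 !mulmx0 !add0r -scalemxAr mul_scalar_mx scalerA divff// scale1r.
  by rewrite addNr.
have := congr1 determinant e1; rewrite det_mulmx det_lblock det_ublock !det1 !mul1r => <-.
have := congr1 determinant e2; rewrite det_mulmx det_lblock det_ublock !det1 !mulr1 => ->.
by rewrite det_scalar det_mx11 !mxE eqxx mulrC.
Qed.

End rank_one.

Section volume.
Context {R : realType} {n : nat}.
Variable a : R.
Hypotheses (a0 : 0 < a) (a1 : a < 1) (n4 : (4 <= n)%N).
Local Notation m := (@warp_exp R n).
Local Notation g := (@gmx R n a m).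
Local Notation lam := (@lebesgue_rV R n).
Local Notation h := (density a n).
Local Notation omega := (@unit_ball_volume R n).
Implicit Types x : 'rV[R]_n.

Let m0 := @warp_exp_gt0 R n n4.
Let m3 := @warp_exp_le R n n4.
Let n0 : (0 < n)%N. Proof. exact: leq_trans n4. Qed.
Let sqnD x : [set t : R | -1 < t] (sqn x).
Proof. by rewrite /= (lt_le_trans (ltrN10 _))// sqn_ge0. Qed.

Lemma volume_density_gmx x : volume_density g x = h (sqn x).
Proof.
rewrite /volume_density; have A0 := tangential_gt0 m a0 a1 (sqnD x).
have -> : g x = (tangential a m (sqn x))%:M + (radial a m (sqn x) *: x^T) *m x.
  apply/matrixP => i j; rewrite !mxE big_ord1 !mxE; congr (_ + _); last by rewrite mulrA.
  by rewrite mulr_natr.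
rewrite det_scalar_rank1 ?gt_eqF// -scalemxAr mxE -dotE -sqnE.
have AB := tangential_radial m a0 a1 (sqnD x).
have -> : tangential a m (sqn x) ^+ n * (1 + (tangential a m (sqn x))^-1 * (radial a m (sqn x) * sqn x)) =
   tangential a m (sqn x) ^+ n.-1.
  have -> (z : R) : z ^+ n = z ^+ n.-1 * z by rewrite -exprSr prednK.
  rewrite -mulrA -[RHS]mulr1; congr (_ * _).
  by rewrite -[RHS]AB; field; rewrite gt_eqF.
rewrite /tangential -exprM mulnC exprM sqrtr_sqr ger0_norm//.
by rewrite exprn_ge0// ltW// warp_gt0.
Qed.

Lemma continuous_density : continuous (fun x : 'rV[R]_n => h (sqn x)).
Proof.
have hs : smooth1 [set t : R | -1 < t] (warp a m) := smooth_warp m a0 a1.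
move=> x; apply: (@continuous_comp _ _ _ (@sqn R n) h); first exact: continuous_sqn.
apply: (@continuous_comp _ _ _ (warp a m) (fun z : R => z ^+ n.-1)).
  exact: smooth_continuous hs (sqnD x).
exact: exprn_continuous.
Qed.

Lemma density_sqn_gt0 x : 0 < h (sqn x).
Proof. exact: density_gt0. Qed.

Lemma density_sqn_le1 x : h (sqn x) <= 1.
Proof. by apply: density_le1 => //; exact: sqn_ge0. Qed.

Lemma geodesic_ball_gmx r : geodesic_ball g 0 r = eball r.
Proof.
by apply/seteqP; split => x; rewrite /geodesic_ball/= dist0.
Qed.

Let mh : measurable_fun setT (fun x : 'rV[R]_n => h (sqn x)).
Proof. by apply: continuous_measurable_rV; exact: continuous_density. Qed.

Let mhE D : measurable_fun D (fun x : 'rV[R]_n => (h (sqn x))%:E).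
Proof. by apply/measurable_EFinP; apply: measurable_funTS. Qed.

Let L : R := a ^+ (n - 2).
Let L0 : 0 < L. Proof. exact: exprn_gt0. Qed.

Let mball (r : R) : measurable (@eball R n r). Proof. exact: measurable_eball. Qed.

Let volume_upper (e r r0 : R) : 0 <= e -> 0 < r0 -> r0 <= r ->
  (forall x, r0 <= enorm x -> h (sqn x) <= L + e) ->
  (volume g (eball r) <= ((L + e) * (omega * r ^+ n) + omega * r0 ^+ n)%:E)%E.
Proof.
move=> e0 r00 r0r H; have Le : 0 <= L + e by rewrite addr_ge0// ltW.
have rp : 0 < r by exact: lt_le_trans r0r.
rewrite /volume; under eq_integral do rewrite volume_density_gmx.
apply: (@le_trans _ _ (\int[lam]_(x in eball r) ((L + e)%:E + (\1_(eball r0) x)%:E)))%E.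
  apply: ge0_le_integral => //.
  - by move=> x _; rewrite lee_fin ltW// density_sqn_gt0.
  - by apply: emeasurable_funD => //; apply/measurable_EFinP; exact: measurable_indic.
  - move=> x _; rewrite -EFinD lee_fin indicE.
    have [xr|xr] := leP r0 (enorm x).
      by apply: le_trans (H x xr) _; rewrite lerDl ler0n.
    by rewrite mem_set//= (le_trans (density_sqn_le1 x))// lerDr.
rewrite ge0_integralD//; last by apply/measurable_EFinP; exact: measurable_indic.
have I1 : (\int[lam]_(x in eball r) (L + e)%:E = ((L + e) * (omega * r ^+ n))%:E)%E.
  apply: etrans (integral_cst _ _ _) _ => //; rewrite EFinM; congr (_ * _)%E.
  exact: lebesgue_eballE.
rewrite I1 EFinD leeD2l// integral_indic//.
apply: (@le_trans _ _ (lam (eball r0))); last by rewrite lebesgue_eballE.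
by apply: le_measure; rewrite ?inE//; exact: measurableI.
Qed.

Let volume_lower (e r r0 : R) : 0 <= e -> e <= L -> 0 < r0 -> r0 <= r ->
  (forall x, r0 <= enorm x -> L - e <= h (sqn x)) ->
  (((L - e) * (omega * r ^+ n))%:E <= volume g (eball r) + (L * (omega * r0 ^+ n))%:E)%E.
Proof.
move=> e0 eL r00 r0r H; have Le : 0 <= L - e by rewrite subr_ge0.
have rp : 0 < r by exact: lt_le_trans r0r.
rewrite /volume; under eq_integral do rewrite volume_density_gmx.
have I1 : (\int[lam]_(x in eball r) (L - e)%:E = ((L - e) * (omega * r ^+ n))%:E)%E.
  apply: etrans (integral_cst _ _ _) _ => //; rewrite EFinM; congr (_ * _)%E.
  exact: lebesgue_eballE.
rewrite -I1.
have mi : measurable_fun (eball r) (fun x => (L * \1_(eball r0) x)%:E).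
  by apply/measurable_EFinP; apply: measurable_funM => //; exact: measurable_indic.
have I2 : (\int[lam]_(x in eball r) (L * \1_(eball r0) x)%:E <= (L * (omega * r0 ^+ n))%:E)%E.
  under eq_integral do rewrite EFinM.
  rewrite ge0_integralZl_EFin// ?(ltW L0)//; last first.
    by apply/measurable_EFinP; exact: measurable_indic.
  rewrite EFinM lee_pmul2l// ?lte_fin// integral_indic//.
  apply: (@le_trans _ _ (lam (eball r0))); last by rewrite lebesgue_eballE.
  by apply: le_measure; rewrite ?inE//; exact: measurableI.
apply: (le_trans _ (leeD2l _ I2)).
rewrite -ge0_integralD//; last 2 first.
- by move=> x _; rewrite lee_fin ltW// density_sqn_gt0.
- by move=> x _; rewrite lee_fin mulr_ge0 ?(ltW L0).
apply: ge0_le_integral => //.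
- exact: emeasurable_funD.
- move=> x _; rewrite -EFinD lee_fin indicE; have [xr|xr] := leP r0 (enorm x).
    by apply: le_trans (H x xr) _; rewrite lerDl mulr_ge0 ?ler0n ?(ltW L0).
  rewrite mem_set//= mulr1; apply: (@le_trans _ _ L); first by rewrite gerBl.
  by rewrite lerDr ltW// density_sqn_gt0.
Qed.

(** The density is at most 1 and tends to a^(n - 2), so do its averages. *)
Lemma volume_ratio :
  (volume g (geodesic_ball g 0 r) * ((omega * r ^+ n)^-1)%:E)%E @[r --> +oo] --> (a ^+ (n - 2))%:E.
Proof.
have o0 : 0 < omega by exact: unit_ball_volume_gt0.
pose V r := fine (volume g (eball r)).
have Vfin r : 0 < r -> (volume g (eball r) = (V r)%:E).
  move=> r0; rewrite /V fineK// ge0_fin_numE; last first.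
    by apply: integral_ge0 => x _; rewrite volume_density_gmx lee_fin ltW// density_sqn_gt0.
  apply: (le_lt_trans (volume_upper (e := 1) (r0 := r) _ _ _ _)) => //; last by rewrite ltry.
  by move=> x _; rewrite (le_trans (density_sqn_le1 x))// lerDr ltW.
suff H : V r / (omega * r ^+ n) @[r --> +oo] --> L.
  have : (V r / (omega * r ^+ n))%:E @[r --> +oo] --> L%:E by apply: cvg_EFin H; exact: nearW.
  apply: cvg_trans; apply: near_eq_cvg; near=> r.
  have r0 : 0 < r by near: r; exact: nbhs_pinfty_gt.
  by rewrite geodesic_ball_gmx Vfin// -EFinM.
apply/cvgrPdist_le => e e0.
pose d := Num.min (e / 2) L.
have d0 : 0 < d by rewrite lt_min L0 divr_gt0.
have dL : d <= L by rewrite ge_min lexx orbT.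
have de : d <= e / 2 by rewrite ge_min lexx.
have [r0 [r00 Hr0]] : exists r0, 0 < r0 /\ forall r, r0 <= r -> `|L - h (r ^+ 2)| <= d.
  have /cvgrPdist_le/(_ _ d0) [M [_ HM]] := cvg_density_infty a0 a1 n4.
  exists (Num.max (M + 1) 1); split; first by rewrite lt_max ltr01 orbT.
  move=> r; rewrite ge_max => /andP[Mr _]; apply: HM; apply: lt_le_trans Mr; by rewrite ltrDl.
have hE x : h (sqn x) = h (enorm x ^+ 2) by rewrite enorm_sqr.
near=> r.
have rr0 : r0 <= r by near: r; apply: nbhs_pinfty_ge; exact: num_real.
have r1 : 1 <= r by near: r; apply: nbhs_pinfty_ge; exact: num_real.
have rk : (1 + L) * r0 ^+ n / (e / 2) <= r by near: r; apply: nbhs_pinfty_ge; exact: num_real.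
have rp : 0 < r by exact: lt_le_trans rr0.
have rn : r <= r ^+ n by rewrite -[leLHS]expr1; apply: ler_weXn2l.
have Up := volume_upper (e := d) (ltW d0) r00 rr0.
have Lo := volume_lower (e := d) (ltW d0) dL r00 rr0.
rewrite Vfin// lee_fin in Up; rewrite Vfin// -EFinD lee_fin in Lo.
have {}Up := Up _; have {}Up : V r <= (L + d) * (omega * r ^+ n) + omega * r0 ^+ n.
  by apply: Up => x /Hr0; rewrite hE ler_distl => /andP[h1 _]; lra.
have {}Lo : (L - d) * (omega * r ^+ n) <= V r + L * (omega * r0 ^+ n).
  by apply: Lo => x /Hr0; rewrite hE ler_distl => /andP[_ h2]; lra.
have P0 : 0 < omega * r ^+ n by rewrite mulr_gt0// exprn_gt0.
have small : (1 + L) * (omega * r0 ^+ n) <= e / 2 * (omega * r ^+ n).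
  rewrite mulrCA [leRHS]mulrCA ler_pM2l// -[leRHS]mulrC -ler_pdivrMr; last by rewrite divr_gt0.
  exact: le_trans rn.
have or0 : 0 <= omega * r0 ^+ n by rewrite mulr_ge0 ?ltW// exprn_gt0.
have dP : d * (omega * r ^+ n) <= e / 2 * (omega * r ^+ n) by rewrite ler_wpM2r// ltW.
have LP : 0 <= L * (omega * r0 ^+ n) by rewrite mulr_ge0 ?(ltW L0).
rewrite ler_distlC; apply/andP; split.
  rewrite ler_pdivlMr//; lra.
rewrite ler_pdivrMr//; lra.
Unshelve. all: by end_near. Qed.

End volume.
(** * Directional derivatives of C^1 functions *)

Section C1_functions.
Context {R : realType} {n : nat}.
Implicit Types (x y v w : 'rV[R]_n) (i : 'I_n) (U : set 'rV[R]_n) (t h c s : R).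

Lemma MVT0 (f df : R -> R) t : (forall s, `|s| <= `|t| -> is_derive s 1 f (df s)) ->
  exists2 s, `|s| <= `|t| & f t - f 0 = df s * t.
Proof.
move=> H; have [t0|t0] := leP 0 t.
  have d s : s \in `]0, t[ -> is_derive s 1 f (df s).
    rewrite in_itv/= => /andP[s0 st]; apply: H.
    by rewrite !ger0_norm// ltW.
  have cf : {within `[0, t], continuous f}.
    apply: continuous_in_subspaceT => s; rewrite inE/= in_itv/= => /andP[s0 st].
    have hs : is_derive s 1 f (df s) by apply: H; rewrite !ger0_norm.
    exact: is_derive_continuous hs.
  have [s] := MVT_segment t0 d cf; rewrite in_itv/= => /andP[s0 st] e.
  by exists s; [rewrite !ger0_norm|rewrite e subr0].
have t0' := ltW t0.
have d s : s \in `]t, 0[ -> is_derive s 1 f (df s).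
  rewrite in_itv/= => /andP[st s0]; apply: H.
  by rewrite !ler0_norm ?lerN2// ltW.
have cf : {within `[t, 0], continuous f}.
  apply: continuous_in_subspaceT => s; rewrite inE/= in_itv/= => /andP[st s0].
  have hs : is_derive s 1 f (df s) by apply: H; rewrite !ler0_norm// lerN2.
  exact: is_derive_continuous hs.
have [s] := MVT_segment t0' d cf; rewrite in_itv/= => /andP[st s0] e.
exists s; first by rewrite !ler0_norm// lerN2.
by rewrite -opprB e sub0r mulrN opprK.
Qed.

Variables (U : set 'rV[R]_n) (f : 'rV[R]_n -> R) (p : 'I_n -> 'rV[R]_n -> R).
Hypotheses (oU : open U) (dp : forall i x, U x -> is_derive x (delta_mx 0 i) f (p i x))
  (cp : forall i x, U x -> {for x, continuous (p i)}).

(** The mean value theorem along the segment in the i-th direction. *)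
Let quotient_step x w i c : U x ->
  h^-1 *: (f (x + h *: (w + c *: delta_mx 0 i)) - f (x + h *: w)) @[h --> 0^'] --> c * p i x.
Proof.
move=> Ux; apply/cvgrPdist_le => e e0.
pose e' := e / (`|c| + 1); have c1 : 0 < `|c| + 1 by rewrite ltr_wpDl.
have e'0 : 0 < e' by rewrite divr_gt0.
have /cvgrPdist_le/(_ _ e'0) near_p := @cp i x Ux.
have near_U : \forall y \near x, U y by exact: open_nbhs_nbhs.
have /nbhs_normP[d /= d0 Hd] : nbhs x [set y | U y /\ `|p i x - p i y| <= e'].
  by apply: filterS2 near_U near_p.
have {}Hd y : `|x - y| < d -> U y /\ `|p i x - p i y| <= e'.
  by move=> xy; apply: Hd.
pose M := `|w| + `|c| * `|delta_mx 0 i : 'rV[R]_n| + 1.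
have M0 : 0 < M by rewrite ltr_wpDl// addr_ge0// mulr_ge0.
near=> h.
have hn0 : h != 0 by near: h; exact: nbhs_dnbhs_neq.
have hd : `|h| * M < d.
  rewrite -ltr_pdivlMr//; near: h; apply: dnbhs0_lt; exact: divr_gt0.
have inb s : `|s| <= `|h * c| -> `|x - (x + h *: w + s *: delta_mx 0 i)| < d.
  move=> sb; rewrite opprD addrA opprD addrA subrr sub0r -opprD normrN.
  apply: le_lt_trans hd; apply: le_trans (ler_normD _ _) _; rewrite !normrZ.
  rewrite /M !mulrDr mulr1 -addrA lerD2l ler_wpDr// mulrA -normrM.
  by rewrite ler_wpM2r.
have [s sb es] := MVT0 (f := fun s => f (x + h *: w + s *: delta_mx 0 i))
   (df := fun s => p i (x + h *: w + s *: delta_mx 0 i)) (t := h * c)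
   (fun s sb => is_derive_line (@dp i _ (proj1 (Hd _ (inb s sb))))).
rewrite scale0r addr0 in es.
have -> : x + h *: (w + c *: delta_mx 0 i) = x + h *: w + (h * c) *: delta_mx 0 i.
  by rewrite scalerDr scalerA addrA.
rewrite es /GRing.scale /= [_ * (h * c)]mulrCA mulKf// mulrC -mulrBl normrM.
have [_ pe] := Hd _ (inb s sb).
apply: (@le_trans _ _ (e' * (`|c| + 1))); last by rewrite divfK// gt_eqF.
by rewrite ler_pM// lerDl.
Unshelve. all: by end_near. Qed.

(** The increment h v is split into its coordinate increments, [tr k] keeping
    the first k coordinates of v; each of them contributes one partial
    derivative. *)
Lemma C1_directional x v : U x -> is_derive x v f (\sum_i v 0 i * p i x).
Proof.
move=> Ux.
pose tr (k : nat) : 'rV[R]_n := \row_j (if (j < k)%N then v 0 j else 0).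
have trS (i : 'I_n) : tr i.+1 = tr i + v 0 i *: delta_mx 0 i.
  apply/rowP => j; rewrite !mxE ltnS leq_eqVlt eqxx/=.
  have [->|ji] := eqVneq j i; first by rewrite eqxx ltnn add0r mulr1.
  by rewrite -val_eqE in ji; rewrite (negbTE ji)/= mulr0 addr0.
have E : (fun h : R => h^-1 *: ((f \o shift x) (h *: v) - f x)) =
    (fun h => \sum_(i < n) h^-1 *: (f (x + h *: tr i.+1) - f (x + h *: tr i))).
  apply/funext => h; rewrite -scaler_sumr; congr (_ *: _).
  rewrite -(big_mkord xpredT (fun i : nat => f (x + h *: tr i.+1) - f (x + h *: tr i))).
  rewrite telescope_sumr//=; congr (f _ - f _).
    rewrite addrC; congr (_ + _ *: _); apply/rowP => j; rewrite mxE ltn_ord//.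
  by rewrite (_ : tr 0 = 0) ?scaler0 ?addr0//; apply/rowP => j; rewrite !mxE.
have cv : h^-1 *: ((f \o shift x) (h *: v) - f x) @[h --> 0^'] --> \sum_i v 0 i * p i x.
  rewrite E; apply: cvg_big => [|i _]; first exact: add_continuous.
  by under eq_cvg do rewrite trS; exact: quotient_step.
by split; [apply/cvg_ex; eexists; exact: cv|exact/cvg_lim].
Qed.

End C1_functions.

Lemma smooth_directional {R : realType} {n : nat} (U : set 'rV[R]_n) (f : 'rV[R]_n -> R) x v :
  open U -> smooth cdirs U f -> U x -> is_derive x v f (\sum_i v 0 i * partial i f x).
Proof.
move=> oU sf Ux; apply: (C1_directional (p := fun i x => partial i f x) oU) => //.
- by move=> i y Uy; exact: (smooth_is_derive i sf Uy).
- by move=> i y Uy; exact: (smooth_continuous (smooth_partial i sf) Uy).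
Qed.
(** * Integration by parts *)

Section integration.
Context {R : realType} {n : nat}.
Local Notation leb := (@lebesgue_measure R).
Local Notation lam := (@lebesgue_rV R n).
Implicit Types (x y v : 'rV[R]_n) (F f : 'rV[R]_n -> R) (r M : R).

Definition supported r f := forall x, r <= enorm x -> f x = 0.

Lemma enormD x y : enorm (x + y) <= enorm x + enorm y.
Proof.
rewrite -(@ler_pXn2r _ 2)// ?nnegrE ?addr_ge0 ?enorm_ge0//.
rewrite enorm_sqr sqnD sqrrD !enorm_sqr lerD2r lerD2l mulr2n mulrDl mul1r.
suff : dot x y <= enorm x * enorm y by lra.
apply: le_trans (ler_norm _) _.
rewrite -(@ler_pXn2r _ 2)// ?nnegrE ?mulr_ge0 ?enorm_ge0//.
by rewrite real_normK ?num_real// exprMn !enorm_sqr cauchy_schwarz.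
Qed.

Lemma compact_cball r : compact [set x : 'rV[R]_n | enorm x <= r].
Proof.
apply: bounded_closed_compact.
  exists r; split; [exact: num_real|move=> M rM x /= xr].
  by rewrite (le_trans (norm_le_enorm x))// (le_trans xr)// ltW.
rewrite (_ : mkset _ = enorm @^-1` [set t | t <= r])//.
apply: closed_comp; last exact: closed_le.
by move=> x _; exact: continuous_enorm.
Qed.

Lemma supported_bounded r f : continuous f -> supported r f -> exists2 M, 0 <= M & forall x, `|f x| <= M.
Proof.
move=> cf sf.
have /compact_bounded[M [_ HM]] : compact (f @` [set x | enorm x <= r]).
  by apply: continuous_compact; [exact: continuous_subspaceT|exact: compact_cball].
exists (`|M| + 1); first by rewrite addr_ge0.
move=> x; have [xr|xr] := leP r (enorm x); first by rewrite sf// normr0 addr_ge0.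
apply: HM; first by rewrite (le_lt_trans (ler_norm M))// ltrDl.
by exists x => //=; exact: ltW.
Qed.

Lemma integrable_indic_eball r M : lam.-integrable setT (fun x => (M * \1_(eball r) x)%:E).
Proof.
under eq_fun do rewrite EFinM.
apply: integrableZl => //.
apply/integrableP; split.
  by apply/measurable_EFinP; apply: measurable_indic; exact: measurable_eball.
under eq_integral do rewrite gee0_abs ?lee_fin//.
rewrite integral_indic ?setIT//; last exact: measurable_eball.
have [r0|r0] := ltP 0 r.
  by apply: le_lt_trans (ltry (unit_ball_volume n * r ^+ n)); rewrite -lebesgue_eballE.
rewrite (_ : eball r = set0) ?measure0 ?ltry// -subset0 => x; rewrite /eball/= => xr.
by have := lt_le_trans xr r0; rewrite ltNge enorm_ge0.
Qed.

Lemma integrable_supported r f M : measurable_fun setT f -> (forall x, `|f x| <= M) ->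
  supported r f -> lam.-integrable setT (EFin \o f).
Proof.
move=> mf fM sf; apply: (le_integrable _ _ _ (integrable_indic_eball r M)) => //.
  exact/measurable_EFinP.
move=> x _ /=; rewrite lee_fin indicE; have [xr|xr] := leP r (enorm x).
  by rewrite sf// normr0.
by rewrite mem_set//= mulr1 (le_trans (fM x))// ler_norm.
Qed.

Lemma continuous_measurable_EFin f : continuous f -> measurable_fun setT (EFin \o f).
Proof. by move=> cf; apply/measurable_EFinP; exact: continuous_measurable_rV. Qed.

Lemma integrable_continuous_supported r f : continuous f -> supported r f ->
  lam.-integrable setT (EFin \o f).
Proof.
move=> cf sf; have [M _ fM] := supported_bounded cf sf.
exact: integrable_supported (continuous_measurable_rV cf) fM sf.
Qed.

Lemma continuous_translate v : continuous (fun x => x + v).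
Proof.
move=> x; apply: (cvgD (F := nbhs x) (f := id) (g := fun=> v)); first exact: cvg_id.
exact: cvg_cst.
Qed.

Lemma integral_translate (f : 'rV[R]_n -> \bar R) v : measurable_fun setT f ->
  (\int[lam]_x f (x + v)%R = \int[lam]_x f x)%E.
Proof.
move=> mf; rewrite [LHS]integralE [RHS]integralE.
have H (h : 'rV[R]_n -> \bar R) : measurable_fun setT h -> (forall x, 0 <= h x)%E ->
    (\int[lam]_x h (x + v)%R = \int[lam]_x h x)%E.
  move=> mh h0; have := ge0_integral_affine v ltr01 mh h0.
  rewrite expr1n invr1 mul1e => <-; apply: eq_integral => x _.
  by rewrite /affine scale1r.
congr (_ - _)%E.
  apply: etrans (H _ (measurable_funepos mf) _); last by move=> x; exact: funepos_ge0.
  by apply: eq_integral => x _; rewrite funeposE funeposE.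
apply: etrans (H _ (measurable_funeneg mf) _); last by move=> x; exact: funeneg_ge0.
  by apply: eq_integral => x _; rewrite funenegE funenegE.
Qed.

(** The difference quotients have integral zero by translation invariance, and
    they converge boundedly on a common ball. *)
Lemma integral_derive0 F f v r : continuous F -> continuous f ->
  (forall x, is_derive x v F (f x)) -> supported r F -> supported r f ->
  (\int[lam]_x (f x)%:E = 0)%E.
Proof.
move=> cF cf dF sF sf.
have [M M0 fM] := supported_bounded cf sf.
pose h (k : nat) : R := k.+1%:R^-1.
have h0 k : 0 < h k by rewrite invr_gt0 ltr0n.
have h1 k : h k <= 1 by rewrite invf_le1 ?ltr0n// ler1n.
pose q k x : R := (h k)^-1 * (F (x + h k *: v) - F x).
pose r' := r + enorm v.
have IF := integrable_continuous_supported cF sF.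
have mF : measurable_fun setT (EFin \o F) by exact: continuous_measurable_EFin.
have cFt w : continuous (fun x => F (x + w)).
  move=> x; apply: (@continuous_comp _ _ _ (fun x => x + w) F); last exact: cF.
  exact: continuous_translate.
have cq k : continuous (q k).
  by move=> x; exact: (cvgM (cvg_cst _) (cvgB (cFt (h k *: v) x) (cF x))).
have qM k x : `|q k x| <= M.
  have H (s : R) : `|s| <= `|h k| -> is_derive s 1 (fun s : R => F (x + s *: v)) (f (x + s *: v)).
    by move=> _; exact: is_derive_line (dF _).
  have [s _] := MVT0 H; rewrite scale0r addr0 /q => ->.
  by rewrite mulrC mulfK ?gt_eqF.
have q0 k : (\int[lam]_x (q k x)%:E = 0)%E.
  have I1 : lam.-integrable setT (EFin \o (fun x => F (x + h k *: v))).
    apply/integrableP; split; first exact: continuous_measurable_EFin.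
    have := integral_translate (h k *: v) (measurableT_comp (@abse_measurable _ setT) mF).
    by move=> /= ->; have /integrableP[] := IF.
  under eq_integral do rewrite /q EFinM EFinB.
  rewrite (integralZl measurableT (integrableB measurableT I1 IF))//.
  rewrite integralB_EFin// (integral_translate (h k *: v) mF) subee ?mule0//.
  exact: integrable_fin_num.
have sq k : supported r' (q k).
  move=> x xr; rewrite /q sF ?sF ?subrr ?mulr0//.
    by apply: le_trans xr; rewrite lerDl enorm_ge0.
  have : enorm x <= enorm (x + h k *: v) + enorm (- h k *: v).
    by rewrite -[in leLHS](addrK (h k *: v) x) -scaleNr enormD.
  rewrite enormZ normrN gtr0_norm// => xh.
  have : h k * enorm v <= enorm v by rewrite ler_piMl ?enorm_ge0.
  by move: xr; rewrite /r'; lra.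
have mq k : measurable_fun setT (fun x => (q k x)%:E).
  exact: continuous_measurable_EFin.
have mf : measurable_fun setT (EFin \o f).
  exact: continuous_measurable_EFin.
have qf x : (q k x)%:E @[k --> \oo] --> (EFin \o f) x.
  apply: cvg_EFin; first exact: nearW.
  have [dv <-] := dF x.
  have hd : h k @[k --> \oo] --> (0 : R)^'.
    move=> A; rewrite /dnbhs /within /= => /(@cvg_harmonic R) /= HA.
    apply: (@filterS _ \oo _ (fun k => h k != 0 -> A (h k))) => // k; apply.
    by rewrite gt_eqF.
  have := cvg_comp _ _ hd dv; rewrite /comp/=; apply: cvg_trans.
  by apply: near_eq_cvg; near=> k; rewrite /q /GRing.scale/= [_ + x]addrC.
have qg x k : (`|(q k x)%:E| <= (M * \1_(eball r') x)%:E)%E.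
  rewrite lee_fin indicE; have [xr|xr] := leP r' (enorm x).
    by rewrite sq// normr0 mulr_ge0.
  by rewrite mem_set//= mulr1.
have [_ _] := dominated_convergence measurableT mq mf (aeW lam (fun x _ => qf x))
   (integrable_indic_eball r' M) (aeW lam (fun x k _ => qg x k)).
rewrite (_ : [sequence _]_k = cst 0%E) => [cv|]; last by apply/funext => k; exact: q0.
by apply: cvg_unique cv (cvg_cst _).
Unshelve. all: by end_near. Qed.

End integration.
(** * Polar coordinates *)

Section polar.
Context {R : realType} {n : nat}.
Local Notation leb := (@lebesgue_measure R).
Local Notation lam := (@lebesgue_rV R n).
Local Notation omega := (@unit_ball_volume R n).
Implicit Types (x y : 'rV[R]_n) (s r : R).

Hypothesis n0 : (0 < n)%N.

Let is_derive_tail s : 0 < s -> is_derive s 1 (fun s => - s `^ (- n%:R)) (n%:R * s `^ (- n.+1%:R)).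
Proof.
move=> s0; apply: (isd_eq (isd_opp (is_derive1_powR _ s0))).
by rewrite -mulNr opprK; congr (_ * _ `^ _); rewrite -natr1; lra.
Qed.

Let integral_tail r : 0 < r ->
  (\int[leb]_(s in `]r, +oo[) (n%:R * s `^ (- n.+1%:R))%:E = (r ^- n)%:E)%E.
Proof.
move=> r0; rewrite integral_itv_obnd_cbnd; last first.
  apply/measurable_EFinP; apply: measurable_funM; first exact: measurable_cst.
  by apply: measurable_funTS; exact: measurable_powR.
have pos s : r <= s -> 0 < s by exact: lt_le_trans.
rewrite (@ge0_continuous_FTC2y _ _ (fun s => - s `^ (- n%:R)) _ 0).
- by rewrite sub0e -EFinN opprK powRN powR_mulrn// ltW.
- by move=> s _; rewrite mulr_ge0// powR_ge0.
- apply: continuous_in_subspaceT => s; rewrite inE/= in_itv/= andbT => /pos s0.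
  have c : {for s, continuous (fun s : R => n%:R * s `^ (- n.+1%:R))}.
    have h := smooth_mul open_pos (smooth_cst _ (n%:R : R) open_pos) (smooth_powR (- n.+1%:R)).
    exact: smooth_continuous h s0.
  exact: c.
- apply/cvgrPdist_le => e e0; near=> s.
  have s1 : 1 <= s by near: s; apply: nbhs_pinfty_ge; exact: num_real.
  have se : e^-1 <= s by near: s; apply: nbhs_pinfty_ge; exact: num_real.
  have s0 : 0 < s by exact: lt_le_trans s1.
  rewrite sub0r opprK powRN powR_mulrn ?(ltW s0)// ger0_norm ?invr_ge0 ?exprn_ge0 ?(ltW s0)//.
  rewrite invf_ple ?posrE ?exprn_gt0// (le_trans se)// -[leLHS]expr1.
  exact: ler_weXn2l.
- by move=> s /ltW/pos s0; have [] := is_derive_tail s0.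
- apply: cvg_at_right_filter; exact: is_derive_continuous (is_derive_tail r0).
- move=> s; rewrite in_itv/= andbT => /ltW/pos s0; rewrite derive1E.
  by have [] := is_derive_tail s0.
Unshelve. all: by end_near. Qed.

Variables (Psi : 'rV[R]_n -> R) (c : R).
Hypotheses (mPsi : measurable_fun setT Psi) (Psi_ge0 : forall x, 0 <= Psi x) (Psi0 : Psi 0 = 0).
Hypothesis ray : forall y, y != 0 -> enorm y < 1 ->
  (\int[leb]_(s in `]0%R, +oo[) (Psi (s *: y)%R / s)%:E = c%:E)%E.

Let K1 (p : 'rV[R]_n * measurableTypeR R) : R :=
  if enorm p.1 < p.2 then Psi p.1 * (n%:R * p.2 `^ (- n.+1%:R)) else 0.

Let K2 (p : 'rV[R]_n * measurableTypeR R) : R :=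
  if (enorm p.1 < 1) && (0 < p.2) then n%:R * (Psi (p.2 *: p.1) * p.2 `^ (- 1)) else 0.

Let menorm : measurable_fun setT (fun p : 'rV[R]_n * measurableTypeR R => enorm p.1).
Proof.
apply: measurableT_comp; last exact: measurable_fst.
by apply: continuous_measurable_rV; exact: continuous_enorm.
Qed.

Let mK1 : measurable_fun setT (EFin \o K1).
Proof.
apply/measurable_EFinP; apply: measurable_fun_ifT => //.
  by apply: measurable_fun_ltr => //; exact: measurable_snd.
apply: measurable_funM; first exact: measurableT_comp.
apply: measurable_funM; first exact: measurable_cst.
exact: (measurableT_comp (@measurable_powR R _) (@measurable_snd _ _ _ (measurableTypeR R))).
Qed.

Let mK2 : measurable_fun setT (EFin \o K2).
Proof.
apply/measurable_EFinP; apply: measurable_fun_ifT => //.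
  apply: measurable_and.
    by apply: measurable_fun_ltr => //; exact: measurable_cst.
  by apply: measurable_fun_ltr => //; exact: measurable_snd.
apply: measurable_funM; first exact: measurable_cst.
apply: measurable_funM.
  apply: (measurableT_comp mPsi); apply: measurable_fun_rV => i.
  rewrite (_ : (fun _ => _) = (fun p : 'rV[R]_n * measurableTypeR R => (p.2 : R) * p.1 0 i)); last first.
    by apply/funext => p; rewrite !mxE.
  apply: measurable_funM; first exact: measurable_snd.
  exact: (measurableT_comp (@measurable_coord R n i) (@measurable_fst _ _ 'rV[R]_n _)).
exact: (measurableT_comp (@measurable_powR R _) (@measurable_snd _ _ _ (measurableTypeR R))).
Qed.

Let K1_ge0 p : (0 <= (K1 p)%:E)%E.
Proof. by rewrite lee_fin /K1; case: ifP => // _; rewrite !mulr_ge0 ?powR_ge0. Qed.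

Let K2_ge0 p : (0 <= (K2 p)%:E)%E.
Proof. by rewrite lee_fin /K2; case: ifP => // _; rewrite !mulr_ge0 ?powR_ge0. Qed.

Let int_K1 x : (\int[leb]_s (K1 (x, s))%:E = (Psi x * enorm x ^- n)%:E)%E.
Proof.
have [->|x0] := eqVneq x 0.
  rewrite Psi0 mul0r; under eq_integral do rewrite /K1/= Psi0 mul0r if_same.
  exact: integral0.
have r0 : 0 < enorm x by rewrite enorm_gt0.
transitivity (\int[leb]_(s in `]enorm x, +oo[) ((Psi x)%:E * (n%:R * s `^ (- n.+1%:R))%:E))%E.
  rewrite [RHS]integral_mkcond; apply: eq_integral => s _.
  by rewrite /patch mem_setE in_itv/= andbT /K1/=; case: ifP.
rewrite ge0_integralZl_EFin//.
- by rewrite integral_tail// EFinM.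
- by move=> s _; rewrite lee_fin mulr_ge0// powR_ge0.
- apply/measurable_EFinP; apply: measurable_funM; first exact: measurable_cst.
  by apply: measurable_funTS; exact: measurable_powR.
Qed.

(** The substitution x = s y. *)
Let K1_K2 s : (\int[lam]_x (K1 (x, s))%:E = \int[lam]_x (K2 (x, s))%:E)%E.
Proof.
have [s0|s0] := leP s 0.
  rewrite !integral0_eq// => x _; first by rewrite /K2/= [0 < s]ltNge s0 andbF.
  by rewrite /K1/= ltNge (le_trans s0) ?enorm_ge0.
have mK : measurable_fun setT (fun x => (K1 (x, s))%:E) by exact: measurableT_comp mK1 _.
have K0 x : (0 <= (K1 (x, s))%:E)%E by [].
have := ge0_integral_affine 0 s0 mK K0.
move=> /(congr1 (fun z => (s ^+ n)%:E * z)%E).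
rewrite muleA -EFinM divff ?expf_neq0 ?gt_eqF// mul1e => <-.
rewrite -ge0_integralZl_EFin ?exprn_ge0 ?(ltW s0)//; last first.
  by apply: (measurableT_comp mK); exact: measurable_affine.
apply: eq_integral => x _; rewrite -EFinM; congr _%:E.
rewrite /K1 /K2/= /affine addr0 s0 andbT enormZ gtr0_norm// -[ltRHS]mulr1 ltr_pM2l//.
case: ifP => _; last by rewrite mulr0.
rewrite powRN powR_mulrn ?(ltW s0)// powR_inv1 ?(ltW s0)//.
rewrite exprSr invfM; field; rewrite ?expf_neq0 ?gt_eqF//.
Qed.

Let int_K2 y : y != 0 -> (\int[leb]_s (K2 (y, s))%:E = (n%:R * c)%:E * (\1_(eball 1) y)%:E)%E.
Proof.
move=> y0; rewrite indicE; have [y1|y1] := ltP (enorm y) 1; last first.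
  rewrite memNset ?mule0; last by rewrite /eball/= ltNge y1.
  by apply: integral0_eq => s _; rewrite /K2/= ltNge y1.
have ray' : (\int[leb]_(s in `]0%R, +oo[) (Psi (s *: y)%R * s `^ (- 1))%:E = c%:E)%E.
  rewrite -(ray y0 y1); apply: eq_integral => s.
  by rewrite inE/= in_itv/= andbT => s0; rewrite powR_inv1// ltW.
rewrite mem_set// mule1 EFinM -ray' -ge0_integralZl_EFin//; last 2 first.
- by move=> s; rewrite lee_fin mulr_ge0// powR_ge0.
- apply/measurable_EFinP; apply: measurable_funTS; apply: measurable_funM; last exact: measurable_powR.
  apply: (measurableT_comp mPsi); apply: measurable_fun_rV => i.
  rewrite (_ : (fun _ => _) = (fun s : measurableTypeR R => s * y 0 i)).
    by apply: measurable_funM; [exact: measurable_id|exact: measurable_cst].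
  by apply/funext => s; rewrite !mxE.
rewrite [RHS]integral_mkcond; apply: eq_integral => s _.
by rewrite /patch mem_setE in_itv/= andbT /K2/= y1/=; case: ifP.
Qed.

(** Writing |x|^-n as the integral of n s^(-n-1) over s > |x| and substituting
    x = s y, an integral of Psi |x|^-n becomes one of Psi (s y) / s over the
    unit ball and the half-line. *)
Lemma polar_integral : (\int[lam]_x (Psi x * enorm x ^- n)%:E = (n%:R * omega * c)%:E)%E.
Proof.
under eq_integral do rewrite -int_K1.
apply: etrans (fubini_tonelli (m1 := lam) (m2 := leb) (EFin \o K1) mK1 K1_ge0) _.
under eq_integral do rewrite /= K1_K2.
apply: etrans (esym (fubini_tonelli (m1 := lam) (m2 := leb) (EFin \o K2) mK2 K2_ge0)) _.
have nc : 0 <= n%:R * c.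
  pose y : 'rV[R]_n := 2^-1 *: delta_mx 0 (Ordinal n0).
  have ey : enorm y = 2^-1.
    by rewrite enormZ /enorm sqnE dot_delta mxE !eqxx sqrtr1 mulr1 gtr0_norm ?invr_gt0.
  have y0 : y != 0 by rewrite -enorm_gt0 ey invr_gt0.
  have y1 : enorm y < 1 by rewrite ey invf_lt1// ltr1n.
  rewrite mulr_ge0// -lee_fin -(ray y0 y1); apply: integral_ge0 => s.
  by rewrite /= in_itv/= andbT lee_fin => s0; rewrite divr_ge0// ltW.
transitivity (\int[lam]_x ((n%:R * c)%:E * (\1_(eball 1) x)%:E))%E.
  apply: ae_eq_integral => //.
  - exact: measurable_fun_fubini_tonelli_F.
  - apply: measurable_funeM; apply/measurable_EFinP; apply: measurable_indic.
    exact: measurable_eball.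
  - exists [set 0]; split; [exact: measurable_rV0|exact: lebesgue_rV0|].
    move=> y /= h; apply/eqP; apply: contra_notT h => y0 _; exact: int_K2.
rewrite ge0_integralZl_EFin//; last first.
  by apply/measurable_EFinP; apply: measurable_indic; exact: measurable_eball.
rewrite integral_indic ?setIT//; last exact: measurable_eball.
by rewrite mulrAC [RHS]EFinM; congr (_ * _)%E; exact: lebesgue_eball1.
Qed.

End polar.

Section pole.
Context {R : realType} {n : nat}.
Local Notation leb := (@lebesgue_measure R).
Local Notation lam := (@lebesgue_rV R n).
Local Notation omega := (@unit_ball_volume R n).
Implicit Types (x y : 'rV[R]_n) (s r k : R) (phi : 'rV[R]_n -> R).

Hypothesis n0 : (0 < n)%N.

(** The derivative of phi along the Euler field x. *)
Definition euler phi x : R := \sum_i x 0 i * partial i phi x.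

Definition smooth_supported r phi :=
  [/\ smooth cdirs setT phi, supported r phi & forall i, supported r (partial i phi)].

Lemma continuous_smooth phi : smooth cdirs setT phi -> continuous phi.
Proof. by move=> sp x; exact: smooth_continuous sp I. Qed.

Lemma smooth_euler (U : set 'rV[R]_n) phi : open U -> smooth cdirs U phi -> smooth cdirs U (euler phi).
Proof.
move=> oU sp; rewrite /euler; apply: smooth_sum => [//|i].
by apply: (smooth_mul oU); [exact: smooth_coord|exact: smooth_partial].
Qed.

Lemma euler_bound phi r : smooth_supported r phi ->
  exists2 k, 0 <= k & forall x, `|euler phi x| <= k * enorm x.
Proof.
move=> [sp _ spi].
have H i : exists M, 0 <= M /\ forall x, `|partial i phi x| <= M.
  have [M M0 HM] := supported_bounded (continuous_smooth (smooth_partial i sp)) (spi i).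
  by exists M.
have [M HM] := choice H.
exists (\sum_i M i) => [|x]; first by apply: sumr_ge0 => i _; have [] := HM i.
apply: le_trans (ler_norm_sum _ _ _) _; rewrite mulr_suml; apply: ler_sum => i _.
have [M0 Mi] := HM i.
by rewrite normrM mulrC ler_pM// coord_le_enorm.
Qed.

(** Nonnegative once k dominates the gradient of phi, as Tonelli's theorem
    requires. *)
Let cone k r phi x : R := k * enorm x * \1_(eball r) x + euler phi x.

(** The integrand is the derivative of k |y| s + phi (s y). *)
Let ray k r phi y : 0 < r -> smooth_supported r phi -> y != 0 ->
  (\int[leb]_(s in `]0%R, +oo[) (cone k r phi (s *: y)%R / s)%:E = (k * r - phi 0)%:E)%E.
Proof.
move=> r0 [sp sr spi] y0; have ey : 0 < enorm y by rewrite enorm_gt0.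
pose L := r / enorm y; have L0 : 0 < L by rewrite divr_gt0.
pose f s := k * enorm y + \sum_i y 0 i * partial i phi (s *: y).
pose F s := k * enorm y * s + phi (s *: y).
have dF s : is_derive s 1 F (f s).
  apply: isd_add; first by apply: (isd_eq (isd_cmul _ (isd_id _))); rewrite mulr1.
  have h := smooth_directional y openT sp (I : setT (0 + s *: y)).
  have := is_derive_line h; rewrite add0r.
  by rewrite (_ : (fun _ => _) = (fun s : R => phi (s *: y)))//; apply/funext => t; rewrite add0r.
have cf : continuous f.
  move=> s; apply: cvgD; first exact: cvg_cst.
  apply: cvg_big => [|i _]; first exact: add_continuous.
  apply: cvgM; first exact: cvg_cst.
  apply: (@continuous_comp _ _ _ (fun s : R => s *: y) (partial i phi)).
    by apply: cvgZr_tmp; exact: cvg_id.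
  exact: continuous_smooth (smooth_partial i sp) _.
transitivity (\int[leb]_(s in `]0%R, L[) (f s)%:E)%E.
  rewrite [LHS]integral_mkcond [RHS]integral_mkcond; apply: eq_integral => s _.
  rewrite /patch !mem_setE !in_itv/= andbT; have [s0|//] := ltP 0 s.
  have es : enorm (s *: y) = s * enorm y by rewrite enormZ gtr0_norm.
  have [sL|sL]/= := ltP s L.
    have sr' : s * enorm y < r by rewrite -ltr_pdivlMr.
    rewrite /cone indicE mem_set /eball/= ?es// mulr1 /f mulrDl; congr (_ + _)%:E.
      by field; rewrite gt_eqF.
    rewrite mulr_suml; apply: eq_bigr => i _; rewrite mxE; field; by rewrite gt_eqF.
  have sr' : r <= enorm (s *: y) by rewrite es -ler_pdivrMr.
  rewrite /cone indicE memNset ?mulr0 ?add0r; last by rewrite /eball/= ltNge sr'.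
  by rewrite /euler big1 ?mul0r// => i _; rewrite spi ?mulr0.
have mf : measurable_fun setT (EFin \o f).
  by apply/measurable_EFinP; exact: continuous_measurable_fun.
rewrite integral_itv_obnd_cbnd ?integral_itv_bndo_bndc; try exact: measurable_funTS.
rewrite (continuous_FTC2 (F := F) L0).
- rewrite /F mulr0 add0r scale0r sr ?addr0 -?EFinD; last first.
    by rewrite enormZ gtr0_norm// /L divfK// gt_eqF.
  by rewrite /L -mulrA [enorm y * _]mulrC divfK// gt_eqF.
- exact: continuous_subspaceT.
- split => [s _||].
  + by have [] := dF s.
  + by apply: cvg_at_right_filter; exact: is_derive_continuous (dF 0).
  + by apply: cvg_at_left_filter; exact: is_derive_continuous (dF L).
- by move=> s _; rewrite derive1E; have [] := dF s.
Qed.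

Lemma measurable_enorm_expN m : measurable_fun setT (fun x : 'rV[R]_n => enorm x ^- m).
Proof.
rewrite (_ : (fun _ => _) = (fun x : 'rV[R]_n => enorm x `^ (- m%:R))).
  apply: (measurableT_comp (@measurable_powR R _)).
  by apply: continuous_measurable_rV; exact: continuous_enorm.
by apply/funext => x; rewrite powRN powR_mulrn// enorm_ge0.
Qed.

Let mcone k r phi : smooth cdirs setT phi -> measurable_fun setT (cone k r phi).
Proof.
move=> sp; apply: measurable_funD.
  apply: measurable_funM; last by apply: measurable_indic; exact: measurable_eball.
  apply: measurable_funM; first exact: measurable_cst.
  by apply: continuous_measurable_rV; exact: continuous_enorm.
by apply: continuous_measurable_rV; exact/continuous_smooth/(smooth_euler openT).
Qed.

Let cone_ge0 k r phi x : smooth_supported r phi -> 0 <= k ->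
  (forall x, `|euler phi x| <= k * enorm x) -> 0 <= cone k r phi x.
Proof.
move=> [_ _ h] k0 kp; rewrite /cone indicE; have [xr|xr] := leP r (enorm x).
  by rewrite /euler big1 ?addr0 ?mulr_ge0 ?enorm_ge0// => i _; rewrite h ?mulr0.
by rewrite mem_set// mulr1; have := kp x; rewrite ler_norml => /andP[H _]; lra.
Qed.

Let integral_cone k r phi : 0 < r -> smooth_supported r phi -> 0 <= k ->
  (forall x, `|euler phi x| <= k * enorm x) ->
  (\int[lam]_x (cone k r phi x * enorm x ^- n)%:E = (n%:R * omega * (k * r - phi 0))%:E)%E.
Proof.
move=> r0 sp k0 kp; apply: polar_integral => //.
- by have [h _ _] := sp; exact: mcone.
- by move=> x; exact: cone_ge0.
- by rewrite /cone /enorm sqn0 sqrtr0 mulr0 mul0r add0r /euler big1// => i _; rewrite mxE mul0r.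
- by move=> y y0 _; exact: ray.
Qed.

Let integrable_cone k r phi : 0 < r -> smooth_supported r phi -> 0 <= k ->
  (forall x, `|euler phi x| <= k * enorm x) ->
  lam.-integrable setT (fun x => (cone k r phi x * enorm x ^- n)%:E).
Proof.
move=> r0 sp k0 kp; apply/integrableP; split.
  apply/measurable_EFinP; apply: measurable_funM; last exact: measurable_enorm_expN.
  by have [h _ _] := sp; exact: mcone.
under eq_integral do rewrite gee0_abs ?lee_fin ?mulr_ge0 ?invr_ge0 ?exprn_ge0 ?enorm_ge0 ?cone_ge0//.
by rewrite integral_cone// ltry.
Qed.

Let smooth_supported0 r : smooth_supported r (fun=> 0).
Proof.
split => [||i x _]; [by apply: smooth_cst; exact: openT|by []|].
exact: derive_cst.
Qed.

Let euler0 x : euler (fun=> 0) x = 0.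
Proof. by rewrite /euler big1// => i _; rewrite /partial derive_cst mulr0. Qed.

Let euler0_le k x : 0 <= k -> `|euler (fun=> 0) x| <= k * enorm x.
Proof. by move=> k0; rewrite euler0 normr0 mulr_ge0 ?enorm_ge0. Qed.

Lemma integrable_enorm_expN k r : 0 < r -> 0 <= k ->
  lam.-integrable setT (fun x => (k * enorm x * \1_(eball r) x * enorm x ^- n)%:E).
Proof.
move=> r0 k0; have := integrable_cone r0 (smooth_supported0 r) k0 (fun x => euler0_le x k0).
by rewrite /cone; under eq_fun do rewrite euler0 addr0.
Qed.

(** Up to sign this is the flux of the Euclidean fundamental solution: the
    positive function k|x| on a large ball is added to the Euler derivative to
    make the polar integral of a positive function out of it. *)
Lemma integral_euler r phi : 0 < r -> smooth_supported r phi ->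
  lam.-integrable setT (fun x => (euler phi x * enorm x ^- n)%:E) /\
  (\int[lam]_x (euler phi x * enorm x ^- n)%:E = (- (n%:R * omega * phi 0%R))%:E)%E.
Proof.
move=> r0 sp; have [k k0 kp] := euler_bound sp.
have I1 := integrable_cone r0 sp k0 kp.
have I0 := integrable_enorm_expN r0 k0.
have E : (fun x => (euler phi x * enorm x ^- n)%:E) = (fun x => (cone k r phi x * enorm x ^- n)%:E -
    (k * enorm x * \1_(eball r) x * enorm x ^- n)%:E)%E.
  by apply/funext => x; rewrite -EFinB -mulrBl /cone addrAC subrr add0r.
have := integral_cone r0 (smooth_supported0 r) k0 (fun x => euler0_le x k0).
rewrite /cone; under eq_integral do rewrite euler0 addr0.
move=> J0; split; first by rewrite E; exact: integrableB.
rewrite E integralB// integral_cone//; rewrite J0 -EFinB; congr _%:E; ring.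
Qed.

End pole.
(** * The Laplacian *)

Section inverse_of_smooth.
Context {R : realType}.

Lemma smooth_inv (D : set R) (h : R -> R) : open D -> smooth1 D h -> (forall t, D t -> 0 < h t) ->
  smooth1 D (fun t => (h t)^-1).
Proof.
move=> oD sh h0; have hp := smooth_comp oD open_pos (smooth_powR (-1)) sh h0.
by apply: smooth_ext hp => // t /h0 t0; rewrite powR_inv1// ltW.
Qed.

Lemma smooth_exp (D : set R) (h : R -> R) k : open D -> smooth1 D h -> smooth1 D (fun t => h t ^+ k).
Proof.
move=> oD sh; elim: k => [|k IH].
  by apply: smooth_ext (smooth_cst _ (1 : R) oD) => // t _; rewrite expr0.
by apply: smooth_ext (smooth_mul oD sh IH) => // t _; rewrite exprS.
Qed.

End inverse_of_smooth.

Section flux.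
Context {R : realType} {n : nat}.
Variable a : R.
Hypotheses (a0 : 0 < a) (a1 : a < 1) (n4 : (4 <= n)%N).
Local Notation m := (@warp_exp R n).
Local Notation g := (@gmx R n a m).
Local Notation h := (density a n).
Local Notation A := (tangential a m).
Local Notation B := (radial a m).
Local Notation D := [set t : R | -1 < t].
Implicit Types (x : 'rV[R]_n) (f phi : 'rV[R]_n -> R) (i : 'I_n) (U : set 'rV[R]_n).

Let m0 := @warp_exp_gt0 R n n4.
Let m3 := @warp_exp_le R n n4.
Let sqnD x : D (sqn x).
Proof. by rewrite /= (lt_le_trans (ltrN10 _))// sqn_ge0. Qed.
Let oD : open D. Proof. exact: open_gtm1. Qed.

Let A0 (t : R) : D t -> 0 < A t. Proof. exact: tangential_gt0. Qed.
Let An0 x : A (sqn x) != 0. Proof. by rewrite gt_eqF// A0. Qed.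

Lemma gradE f x i : grad g f x 0 i =
  (A (sqn x))^-1 * partial i f x - B (sqn x) / A (sqn x) * x 0 i * euler f x.
Proof.
rewrite /grad mxE (proj2 (invmx_gmxE m a0 a1 x)).
transitivity (\sum_j ((A (sqn x))^-1 * ((j == i)%:R * partial j f x) -
    B (sqn x) / A (sqn x) * x 0 i * (x 0 j * partial j f x))).
  by apply: eq_bigr => j _; rewrite !mxE; ring.
by rewrite sumrB -!mulr_sumr sum_delta_r.
Qed.

(** The gradient times the volume density, whose Euclidean divergence is the
    Laplacian times the volume density. *)
Definition flux f i x : R := h (sqn x) * grad g f x 0 i.

Lemma laplacian_flux f x :
  laplacian g f x * volume_density g x = \sum_i partial i (flux f i) x.
Proof.
rewrite /laplacian /divergence mulrAC volume_density_gmx// mulVf ?mul1r; last first.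
  by rewrite gt_eqF// density_sqn_gt0.
by apply: eq_bigr => i _; congr (partial i _ x); apply/funext => y; rewrite volume_density_gmx.
Qed.

(** Radial covectors are raised by the Euclidean metric, so only the volume
    density is left of the metric here. *)
Lemma euler_flux f x : \sum_i x 0 i * flux f i x = h (sqn x) * euler f x.
Proof.
under eq_bigr do rewrite /flux gradE.
transitivity (\sum_i (h (sqn x) * (A (sqn x))^-1 * (x 0 i * partial i f x) -
   h (sqn x) * (B (sqn x) / A (sqn x)) * euler f x * x 0 i ^+ 2)).
  by apply: eq_bigr => i _; ring.
rewrite sumrB -!mulr_sumr -/(euler f x) -/(sqn x).
have AB := tangential_radial m a0 a1 (sqnD x).
have e : (A (sqn x))^-1 - sqn x * (B (sqn x) / A (sqn x)) = 1.
  apply/eqP; rewrite subr_eq mulrA -[X in X + _](divff (An0 x)) -mulrDl AB mul1r//.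
rewrite -[RHS]mulr1 -e; ring.
Qed.

Lemma smooth_flux U f i : open U -> smooth cdirs U f -> smooth cdirs U (flux f i).
Proof.
move=> oU sf.
have sA := smooth_inv oD (smooth_tangential m a0 a1) A0.
have sBA := smooth_mul oD (smooth_radial m a0 a1) sA.
have sh : smooth1 D h := smooth_exp n.-1 oD (smooth_warp m a0 a1).
have rad (k : R -> R) : smooth1 D k -> smooth cdirs U (fun x => k (sqn x)).
  by move=> sk; exact: (smooth_radial_fun oU oD sk).
have spf j : smooth cdirs U (partial j f) := smooth_partial j sf.
apply: (smooth_ext oU (f := fun x => h (sqn x) * ((A (sqn x))^-1 * partial i f x -
    B (sqn x) / A (sqn x) * x 0 i * euler f x))) => [x _|].
  by rewrite /flux gradE.
apply: (smooth_mul oU); first exact: rad.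
apply: (smooth_sub oU); apply: (smooth_mul oU) => //; first exact: (rad _ sA).
  by apply: (smooth_mul oU); [exact: (rad _ sBA)|exact: smooth_coord].
exact: smooth_euler.
Qed.

End flux.

Section supports.
Context {R : realType} {n : nat}.
Implicit Types (x : 'rV[R]_n) (f phi : 'rV[R]_n -> R) (i : 'I_n) (r : R).

Lemma open_enorm_gt r : open [set x : 'rV[R]_n | r < enorm x].
Proof.
rewrite (_ : mkset _ = enorm @^-1` [set t | r < t])//.
by apply: open_comp; [move=> x _; exact: continuous_enorm|exact: open_gt].
Qed.

Lemma supported_partial r r' f i : r < r' -> supported r f -> supported r' (partial i f).
Proof.
move=> rr' sf x xr; rewrite /partial -[RHS](derive_cst (0 : R) x (delta_mx 0 i)).
apply: near_eq_derive.
have xr0 : [set x | r < enorm x] x by exact: lt_le_trans xr.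
have nx : \forall y \near x, r < enorm y by apply: open_nbhs_nbhs; split; [exact: open_enorm_gt|].
by apply: filterS nx => y /ltW; exact: sf.
Qed.

(** The divergence theorem for compactly supported fields. *)
Lemma integral_divergence0 (K : 'I_n -> 'rV[R]_n -> R) r :
  (forall i, smooth cdirs setT (K i)) -> (forall i, supported r (K i)) ->
  (\int[@lebesgue_rV R n]_x (\sum_i partial i (K i) x)%:E = 0)%E.
Proof.
move=> sK suppK; have r1 : r < r + 1 by rewrite ltrDl.
have cdK i : continuous (partial i (K i)) := continuous_smooth (smooth_partial i (sK i)).
have sdK i := supported_partial i r1 (suppK i).
have IK i := integrable_continuous_supported (cdK i) (sdK i).
under eq_integral do rewrite -sumEFin.
rewrite integral_sum//; apply: big1 => i _.
apply: (@integral_derive0 _ _ (K i) _ (delta_mx 0 i) (r + 1)) => //.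
- exact: continuous_smooth (sK i).
- by move=> x; exact: (smooth_is_derive i (sK i) (I : setT x)).
- by move=> x xr; apply: suppK; rewrite (le_trans _ xr)// ltW.
Qed.

Lemma test_function_supported f : test_function f -> exists2 r, 0 < r & smooth_supported r f.
Proof.
move=> [/smooth_onE sf cf].
have /compact_bounded[M [_ HM]] : compact (enorm @` closure [set x | f x != 0]).
  by apply: continuous_compact => //; apply: continuous_subspaceT; exact: continuous_enorm.
have M0 : 0 < `|M| + 1 by rewrite ltr_wpDl.
have sr : supported (`|M| + 2) f.
  move=> x xr; apply/eqP; apply: contraTT xr => fx; rewrite -ltNge.
  have : `|enorm x| <= `|M| + 1.
    apply: HM; first by rewrite (le_lt_trans (ler_norm M))// ltrDl.
    by exists x => //; exact: subset_closure.
  by rewrite ger0_norm ?enorm_ge0//; lra.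
exists (`|M| + 3); first by rewrite ltr_wpDl.
split => // [x xr|i]; first by rewrite sr// (le_trans _ xr)//; lra.
by apply: supported_partial sr; lra.
Qed.

End supports.
(** * The Green function *)

Lemma open_off0 {R : realType} {n : nat} : open (~` [set (0 : 'rV[R]_n)]).
Proof.
rewrite (_ : ~` _ = [set x | 0 < enorm x]); first exact: open_enorm_gt.
by apply/seteqP; split => x /=; rewrite enorm_gt0; [move=> /eqP|move=> /eqP].
Qed.

Section green.
Context {R : realType} {n : nat}.
Variable a : R.
Hypotheses (a0 : 0 < a) (a1 : a < 1) (n4 : (4 <= n)%N).
Local Notation lam := (@lebesgue_rV R n).
Local Notation omega := (@unit_ball_volume R n).
Local Notation m := (@warp_exp R n).
Local Notation g := (@gmx R n a m).
Local Notation h := (density a n).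
Local Notation p := (height a).
Local Notation gamma := (green_profile a n).
Implicit Types (x : 'rV[R]_n) (phi : 'rV[R]_n -> R) (i : 'I_n) (r t e : R) (k : nat).

Let n0 : (0 < n)%N. Proof. exact: leq_trans n4. Qed.
Let n2 : (2 <= n)%N. Proof. exact: leq_trans n4. Qed.
Let sqnD x : [set t : R | -1 < t] (sqn x).
Proof. by rewrite /= (lt_le_trans (ltrN10 _))// sqn_ge0. Qed.

Definition green x : R := gamma (sqn x).

Lemma smooth_green : smooth cdirs (~` [set 0]) green.
Proof.
have pos x : (~` [set 0]) x -> [set t : R | 0 < t] (sqn x) by move=> x0 /=; rewrite sqn_gt0; exact/eqP.
exact: (smooth_radial_fun open_off0 open_pos (smooth_green_profile n a0 a1) pos).
Qed.

Lemma green_gt0 x : x != 0 -> 0 < green x.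
Proof. by move=> x0; rewrite /green green_profile_gt0// sqn_gt0. Qed.

Lemma green_profile_le r t : 0 < r -> r ^+ 2 <= t -> gamma t <= (a * r) ^- (n - 2).
Proof.
move=> r0 rt; have t0 : 0 < t by rewrite (lt_le_trans _ rt)// exprn_gt0.
have s0 : 0 < Num.sqrt t by rewrite sqrtr_gt0.
have rs : r <= Num.sqrt t by rewrite -(@ler_pXn2r _ 2)// ?nnegrE ?(ltW r0) ?(ltW s0)// sqr_sqrtr// ltW.
rewrite -{1}(sqr_sqrtr (ltW t0)) green_profile_sqr// sqr_sqrtr ?(ltW t0)//.
have /andP[ap _] := height_bounds a0 a1 (ltW t0).
have p0 := lt_le_trans a0 ap.
rewrite lef_pV2 ?posrE ?exprn_gt0 ?mulr_gt0// lerXn2r ?nnegrE ?mulr_ge0 ?(ltW a0) ?(ltW s0) ?(ltW p0)//.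
  by rewrite ltW.
by rewrite mulrC ler_pM// ltW.
Qed.

Lemma ae_off0 (P : 'rV[R]_n -> Prop) : (forall x, x != 0 -> P x) -> {ae lam, forall x, P x}.
Proof.
move=> H; exists [set 0]; split; [exact: measurable_rV0|exact: lebesgue_rV0|].
by move=> x /= nP; apply/eqP; apply: contra_notT nP; exact: H.
Qed.

(** Dominated convergence with the one majorant that the polar formula makes
    available near the pole. *)
Lemma cvg_integral_off0 (f_ : nat -> 'rV[R]_n -> R) (f : 'rV[R]_n -> R) (c r : R) :
  0 < r -> 0 <= c -> (forall k, measurable_fun setT (f_ k)) -> measurable_fun setT f ->
  (forall x, x != 0 -> f_ k x @[k --> \oo] --> f x) ->
  (forall x k, x != 0 -> `|f_ k x| <= c * enorm x * \1_(eball r) x * enorm x ^- n) ->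
  lam.-integrable setT (EFin \o f) /\
  (\int[lam]_x (f_ k x)%:E @[k --> \oo] --> \int[lam]_x (f x)%:E)%E.
Proof.
move=> r0 c0 mf_ mf f_f f_g.
have mfE k : measurable_fun setT (EFin \o f_ k) by exact/measurable_EFinP.
have mfE' : measurable_fun setT (EFin \o f) by exact/measurable_EFinP.
have cv : {ae lam, forall x, setT x -> (EFin \o f_ k) x @[k --> \oo] --> (EFin \o f) x}.
  by apply: ae_off0 => x x0 _; apply: cvg_EFin; [exact: nearW|exact: f_f].
have dom : {ae lam, forall x k, setT x ->
    (`|(EFin \o f_ k) x| <= (c * enorm x * \1_(eball r) x * enorm x ^- n)%:E)%E}.
  by apply: ae_off0 => x x0 k _; rewrite lee_fin f_g.
have [I _ C] := dominated_convergence measurableT mfE mfE' cv (integrable_enorm_expN n0 r0 c0) dom.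
by split.
Qed.

Lemma density_ge t : 0 <= t -> a ^+ n.-1 <= h t.
Proof.
move=> t0; have Dt : -1 < t by rewrite (lt_le_trans (ltrN10 _)).
rewrite densityE//; have /andP[ap _] := height_bounds a0 a1 t0.
have /andP[_ b1] := slope_bounds a0 a1 t0; have b0 := slope_gt0 a0 a1 Dt.
rewrite ler_pdivlMr//; apply: (@le_trans _ _ (a ^+ n.-1)).
  by rewrite ler_piMr// exprn_ge0// ltW.
by apply: lerXn2r; rewrite ?nnegrE ?(ltW a0)// ltW// (lt_le_trans a0).
Qed.

Lemma measurable_green : measurable_fun setT green.
Proof.
apply: (measurableT_comp (@measurable_powR R _)); apply: continuous_measurable_rV => x.
have oD := @open_gtm1 R.
have sf := smooth_mul oD (smooth_id oD) (smooth_exp 2 oD (smooth_height a)).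
exact: (continuous_comp (@continuous_sqn R n x) (smooth_continuous sf (sqnD x))).
Qed.

Section identity.
Variables (phi : 'rV[R]_n -> R) (r : R).
Hypotheses (r0 : 0 < r) (sphi : smooth_supported r phi).

Let W := flux a phi.
Let L x : R := \sum_i partial i (W i) x.

Let sW i : smooth cdirs setT (W i).
Proof. by have [s _ _] := sphi; apply: smooth_flux => //; exact: openT. Qed.

Let suppW i : supported r (W i).
Proof.
move=> x xr; have [_ _ s] := sphi.
by rewrite /W /flux gradE// s// /euler big1 ?mulr0 ?subr0 ?mulr0// => j _; rewrite s ?mulr0.
Qed.

Let r1 : r < r + 1. Proof. by rewrite ltrDl. Qed.

Let suppL : supported (r + 1) L.
Proof. by move=> x xr; rewrite /L big1// => i _; exact: (supported_partial i r1 (@suppW i) xr). Qed.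

Let sL : smooth cdirs setT L.
Proof.
rewrite /L; apply: smooth_sum => [|i]; first exact: openT.
exact: smooth_partial.
Qed.

Let cL : continuous L. Proof. exact: continuous_smooth. Qed.

Let dgamma t : R := (2 - n%:R) / 2 * t `^ (- (n%:R / 2)) / h t.

Let P e x : R := 2 * dgamma (sqn x + e) * h (sqn x) * euler phi x.
Let Q e x : R := gamma (sqn x + e) * L x.

Let smooth_shift e : 0 < e -> smooth cdirs setT (fun x : 'rV[R]_n => gamma (sqn x + e)).
Proof.
move=> e0; apply: (smooth_comp openT open_pos (smooth_green_profile n a0 a1)).
  by apply: (smooth_add openT); [apply: smooth_sqn|apply: smooth_cst]; exact: openT.
by move=> x _ /=; rewrite ltr_wpDl// sqn_ge0.
Qed.

Let F e i x : R := gamma (sqn x + e) * W i x.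

Let sF e i : 0 < e -> smooth cdirs setT (F e i).
Proof. by move=> e0; exact: (smooth_mul openT (smooth_shift e0) (sW i)). Qed.

Let sum_dF e x : 0 < e -> \sum_i partial i (F e i) x = P e x + Q e x.
Proof.
move=> e0; have t0 : 0 < sqn x + e by rewrite ltr_wpDl// sqn_ge0.
have dg v : is_derive x v (fun x : 'rV[R]_n => gamma (sqn x + e)) (2 * dgamma (sqn x + e) * dot x v).
  have d := isd_comp (isd_add (isd_sqn x v) (isd_cst e x v)) (is_derive_green_profile a0 a1 n4 t0).
  by apply: (isd_eq d); rewrite /dgamma addr0; ring.
transitivity (\sum_i (2 * dgamma (sqn x + e) * (x 0 i * W i x) + gamma (sqn x + e) * partial i (W i) x)).
  apply: eq_bigr => i _; apply: isd_partial.
  apply: (isd_eq (isd_mul (dg _) (smooth_is_derive i (sW i) (I : setT x)))).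
  by rewrite /cdirs dot_delta /partial; ring.
by rewrite big_split/= -!mulr_sumr euler_flux// /P /Q !mulrA.
Qed.

Let integral_sum_dF e : 0 < e -> (\int[lam]_x (P e x + Q e x)%:E = 0)%E.
Proof.
move=> e0.
have suppF i : supported r (F e i) by move=> x xr; rewrite /F suppW ?mulr0.
under eq_integral do rewrite -sum_dF//.
by apply: integral_divergence0 => // i; exact: sF.
Qed.

Let smooth_pos (f : R -> R) : smooth1 [set t : R | -1 < t] f -> smooth1 [set t : R | 0 < t] f.
Proof. by apply: smooth_sub_set => t /= t0; rewrite (lt_trans _ t0)// ltrN10. Qed.

Let smooth_dgamma : smooth1 [set t : R | 0 < t] dgamma.
Proof.
have sh : smooth1 [set t : R | 0 < t] h.
  exact: (smooth_exp n.-1 open_pos (smooth_pos (smooth_warp m a0 a1))).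
have h0 t : [set t : R | 0 < t] t -> 0 < h t.
  by move=> /= t0; rewrite density_gt0//= (lt_trans _ t0)// ltrN10.
exact: (smooth_mul open_pos (smooth_mul open_pos (smooth_cst _ _ open_pos) (smooth_powR _))
  (smooth_inv open_pos sh h0)).
Qed.

Let e_ k : R := k.+1%:R^-1.
Let e_gt0 k : 0 < e_ k. Proof. by rewrite invr_gt0 ltr0n. Qed.

Let cvg_shift (f : R -> R) x : smooth1 [set t : R | 0 < t] f -> x != 0 ->
  f (sqn x + e_ k) @[k --> \oo] --> f (sqn x).
Proof.
move=> sf x0; have t0 : [set t : R | 0 < t] (sqn x) by rewrite /= sqn_gt0.
have cs : sqn x + e_ k @[k --> \oo] --> sqn x.
  by rewrite -[X in _ --> X]addr0; apply: cvgD; [exact: cvg_cst|exact: cvg_harmonic].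
exact: cvg_comp cs (smooth_continuous sf t0).
Qed.

Let continuous_Q e : 0 < e -> continuous (Q e).
Proof. by move=> e0; exact: (continuous_smooth (smooth_mul openT (smooth_shift e0) sL)). Qed.

Let continuous_P e : 0 < e -> continuous (P e).
Proof.
move=> e0; have -> : P e = (fun x => \sum_i partial i (F e i) x - Q e x).
  by apply/funext => x; rewrite sum_dF// addrK.
have sS : smooth cdirs setT (fun x => \sum_i partial i (F e i) x).
  apply: smooth_sum => [|i]; first exact: openT.
  exact/smooth_partial/sF.
exact: (continuous_smooth (smooth_sub openT sS (smooth_mul openT (smooth_shift e0) sL))).
Qed.

Let suppP e : supported r (P e).
Proof.
move=> x xr; have [_ _ s] := sphi.
by rewrite /P /euler big1 ?mulr0// => j _; rewrite s ?mulr0.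
Qed.

Let suppQ e : supported (r + 1) (Q e).
Proof. by move=> x xr; rewrite /Q suppL ?mulr0. Qed.

Let integral_PQ e : 0 < e -> (\int[lam]_x (Q e x)%:E = - \int[lam]_x (P e x)%:E)%E.
Proof.
move=> e0; have IP := integrable_continuous_supported (continuous_P e0) (@suppP e).
have IQ := integrable_continuous_supported (continuous_Q e0) (@suppQ e).
have := integral_sum_dF e0; under eq_integral do rewrite EFinD.
rewrite integralD_EFin//.
have fP : (\int[lam]_x (EFin \o P e) x \is a fin_num)%E by exact: integrable_fin_num.
have fQ : (\int[lam]_x (EFin \o Q e) x \is a fin_num)%E by exact: integrable_fin_num.
move: fP fQ => /=; case: (\int[lam]_x (P e x)%:E)%E => // u _.
case: (\int[lam]_x (Q e x)%:E)%E => // v _ [] /eqP.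
by rewrite addrC addr_eq0 => /eqP ->.
Qed.

Let sqn_powR x : x != 0 -> sqn x `^ (- (n%:R / 2)) = enorm x ^- n.
Proof.
move=> x0; rewrite powRN -enorm_sqr -powR_mulrn ?enorm_ge0// -powRrM mulrC divfK//.
by rewrite powR_mulrn ?enorm_ge0.
Qed.

(** The factor a^(1-n) bounds the quotient of two values of the volume density,
    which lies between a^(n-1) and 1. *)
Let bound_P x e : x != 0 -> 0 < e ->
  `|2 * dgamma (sqn x + e) * h (sqn x)| <= (n%:R - 2) * a ^- n.-1 * enorm x ^- n.
Proof.
move=> x0 e0; have t0 : 0 < sqn x by rewrite sqn_gt0.
have t1 : 0 < sqn x + e by rewrite addr_gt0.
have hn : 0 < h (sqn x + e) by rewrite density_gt0//= (lt_trans _ t1)// ltrN10.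
have n2' : 0 <= n%:R - 2 :> R by rewrite subr_ge0 ler_nat.
have -> : 2 * dgamma (sqn x + e) * h (sqn x) =
    - ((n%:R - 2) * ((sqn x + e) `^ (- (n%:R / 2)) * (h (sqn x) / h (sqn x + e)))).
  by rewrite /dgamma; field; rewrite gt_eqF.
rewrite normrN ger0_norm; last first.
  by rewrite !mulr_ge0 ?powR_ge0 ?invr_ge0 ?(ltW hn)// ltW// density_sqn_gt0.
rewrite -mulrA ler_wpM2l// mulrC; apply: ler_pM; rewrite ?powR_ge0//.
- by rewrite divr_ge0 ?(ltW hn)// ltW// density_sqn_gt0.
- rewrite ler_pdivrMr// (le_trans (density_sqn_le1 a0 a1 n4 x))//.
  have an : 0 < a ^+ n.-1 by rewrite exprn_gt0.
  by rewrite mulrC ler_pdivlMr// mul1r density_ge// ltW.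
- rewrite -sqn_powR// !powRN lef_pV2 ?posrE ?powR_gt0//.
  by apply: ge0_ler_powR; rewrite ?nnegrE ?divr_ge0 ?(ltW t0) ?(ltW t1)// lerDl ltW.
Qed.

(** Green's identity on the whole space: with G regularised as gamma (|x|^2 + e)
    there is no boundary term, and the pole appears in the limit e -> 0 as the
    flux of x / |x|^n. *)
Lemma green_identity :
  lam.-integrable setT (fun x => (green x * L x)%:E) /\
  (\int[lam]_x (green x * L x)%:E = (- ((n%:R - 2) * (n%:R * omega) * phi 0%R))%:E)%E.
Proof.
have [k k0 kphi] := euler_bound sphi.
have [M M0 LM] := supported_bounded cL suppL.
have n2' : 0 <= n%:R - 2 :> R by rewrite subr_ge0 ler_nat.
have an0 j : 0 <= a ^- j by rewrite invr_ge0 exprn_ge0// ltW.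
have [IG cQ] : lam.-integrable setT (EFin \o (fun x => green x * L x)) /\
    (\int[lam]_x (Q (e_ j) x)%:E @[j --> \oo] --> \int[lam]_x (green x * L x)%:E)%E.
  apply: (cvg_integral_off0 (f_ := fun j => Q (e_ j)) (c := M * a ^- (n - 2) * (r + 1)) (r := r + 1)).
  - by rewrite addr_gt0.
  - by rewrite !mulr_ge0// addr_ge0// ltW.
  - by move=> j; apply: continuous_measurable_rV; exact: continuous_Q.
  - by apply: measurable_funM; [exact: measurable_green|exact: continuous_measurable_rV].
  - move=> x x0; apply: cvgM; last exact: cvg_cst.
    exact: (cvg_shift (smooth_green_profile n a0 a1) x0).
  - move=> x j x0; have ex : 0 < enorm x by rewrite enorm_gt0.
    rewrite indicE; have [xr|xr] := leP (r + 1) (enorm x).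
      by rewrite suppQ// normr0 !mulr_ge0 ?addr_ge0 ?invr_ge0 ?exprn_ge0 ?(ltW ex)// ltW.
    rewrite mem_set// mulr1 normrM.
    have t1 : 0 < sqn x + e_ j by rewrite ltr_pwDl ?sqn_gt0// ltW.
    rewrite ger0_norm ?(ltW (green_profile_gt0 _ a0 a1 t1))//.
    have gl : gamma (sqn x + e_ j) <= (a * enorm x) ^- (n - 2).
      by apply: green_profile_le => //; rewrite enorm_sqr lerDl ltW.
    apply: (le_trans (ler_pM _ _ gl (LM x))) => //; first by rewrite ltW// green_profile_gt0.
    have -> : (a * enorm x) ^- (n - 2) * M = M * a ^- (n - 2) * enorm x * enorm x * enorm x ^- n.
      have -> : enorm x ^+ n = enorm x ^+ (n - 2) * enorm x ^+ 2 by rewrite -exprD subnK.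
      rewrite exprMn invfM; field.
      by rewrite !expf_neq0 ?gt_eqF.
    rewrite ler_wpM2r ?invr_ge0 ?exprn_ge0 ?(ltW ex)// ler_wpM2r ?(ltW ex)//.
    by rewrite ler_wpM2l ?mulr_ge0// ltW.
have [_ cP] : lam.-integrable setT (EFin \o (fun x => (2 - n%:R) * (euler phi x * enorm x ^- n))) /\
    (\int[lam]_x (P (e_ j) x)%:E @[j --> \oo] -->
     \int[lam]_x ((2 - n%:R) * (euler phi x * enorm x ^- n))%:E)%E.
  apply: (cvg_integral_off0 (f_ := fun j => P (e_ j)) (c := (n%:R - 2) * a ^- n.-1 * k) (r := r)) => //.
  - by rewrite !mulr_ge0.
  - by move=> j; apply: continuous_measurable_rV; exact: continuous_P.
  - apply: measurable_funM; first exact: measurable_cst.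
    apply: measurable_funM; last exact: measurable_enorm_expN.
    have [s _ _] := sphi; apply: continuous_measurable_rV.
    exact/continuous_smooth/(smooth_euler openT).
  - move=> x x0; rewrite mulrCA mulrC.
    apply: cvgM; last exact: cvg_cst.
    have -> : (2 - n%:R) * enorm x ^- n = 2 * dgamma (sqn x) * h (sqn x).
      rewrite /dgamma sqn_powR//; field.
      have hx : 0 < h (sqn x) by exact: density_sqn_gt0.
      by rewrite (gt_eqF hx)/= expf_neq0// gt_eqF// enorm_gt0.
    apply: cvgM; last exact: cvg_cst.
    by apply: cvgM; [exact: cvg_cst|exact: cvg_shift].
  - move=> x j x0; rewrite indicE; have [xr|xr] := leP r (enorm x).
      by rewrite suppP// normr0 !mulr_ge0 ?invr_ge0 ?exprn_ge0 ?enorm_ge0 ?(ltW a0).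
    rewrite mem_set// mulr1 normrM.
    apply: (le_trans (ler_pM _ _ (bound_P x0 (e_gt0 j)) (kphi x))) => //.
    by rewrite le_eqVlt; apply/orP; left; apply/eqP; ring.
split => //; have [IE JE] := integral_euler n0 r0 sphi.
have cQ' : (\int[lam]_x (Q (e_ j) x)%:E @[j --> \oo] -->
    - \int[lam]_x ((2 - n%:R) * (euler phi x * enorm x ^- n))%:E)%E.
  by under eq_cvg do rewrite integral_PQ//; exact: cvgeN.
rewrite (cvg_unique _ cQ cQ')//.
under eq_integral do rewrite EFinM.
rewrite integralZl// JE -EFinM -EFinN; congr _%:E; ring.
Qed.

End identity.
End green.
Section green_function.
Context {R : realType} {n : nat}.
Variable a : R.
Hypotheses (a0 : 0 < a) (a1 : a < 1) (n4 : (4 <= n)%N).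
Local Notation lam := (@lebesgue_rV R n).
Local Notation m := (@warp_exp R n).
Local Notation g := (@gmx R n a m).
Local Notation h := (density a n).
Local Notation p := (height a).
Local Notation G := (@green R n a).
Implicit Types (x : 'rV[R]_n) (r t : R).

Let n0 : (0 < n)%N. Proof. exact: leq_trans n4. Qed.
Let n2 : (2 <= n)%N. Proof. exact: leq_trans n4. Qed.
Let m0 := @warp_exp_gt0 R n n4.
Let m3 := @warp_exp_le R n n4.
Let sqnD x : [set t : R | -1 < t] (sqn x).
Proof. by rewrite /= (lt_le_trans (ltrN10 _))// sqn_ge0. Qed.

Lemma green_enorm x : x != 0 -> G x = (enorm x * p (sqn x)) ^- (n - 2).
Proof. by move=> x0; rewrite /green -enorm_sqr green_profile_sqr// enorm_gt0. Qed.

Lemma green0 : G 0 = 0.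
Proof.
rewrite /green sqn0 /green_profile mul0r powR0// mulf_neq0// ?invr_eq0//.
by rewrite subr_eq0 eqr_nat; move: n4; case: eqP => // <-.
Qed.

(** On a ball of radius r the integrand is at most a constant times
    |x|^(2-n) <= r |x| |x|^(-n), whose integral is known in polar coordinates. *)
Lemma locally_integrable_green : locally_integrable_wrt g G.
Proof.
split; first exact: measurable_green.
move=> K cK.
have /compact_bounded[M [_ HM]] : compact (enorm @` K).
  by apply: continuous_compact => //; apply: continuous_subspaceT; exact: continuous_enorm.
pose r := `|M| + 2; have r0 : 0 < r by rewrite ltr_wpDl.
have Kr x : K x -> enorm x < r.
  move=> Kx; have : `|enorm x| <= `|M| + 1.
    by apply: HM; [rewrite (le_lt_trans (ler_norm M))// ltrDl|exists x].
  by rewrite ger0_norm ?enorm_ge0//; rewrite /r; lra.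
pose c := a ^- (n - 2) * r; have c0 : 0 <= c by rewrite mulr_ge0 ?invr_ge0 ?exprn_ge0 ?ltW.
have an0 : 0 <= a ^- (n - 2) by rewrite invr_ge0 exprn_ge0// ltW.
have /integrableP[mI foo] := integrable_enorm_expN n0 r0 c0.
have mK : measurable K by rewrite -[K]setCK; apply: measurableC; apply: open_measurable_rV; rewrite openC; exact: (compact_closed _ cK).
apply: le_lt_trans foo.
apply: (@le_trans _ _ (\int[lam]_(x in K) `|(c * enorm x * \1_(eball r) x * enorm x ^- n)%:E|)%E); last first.
  apply: ge0_subset_integral => //; exact: measurableT_comp.
apply: ge0_le_integral => //.
- by move=> x _; rewrite lee_fin mulr_ge0// sqrtr_ge0.
- apply/measurable_EFinP; apply: measurable_funTS; apply: measurable_funM.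
    by apply: measurableT_comp => //; exact: measurable_green.
  apply: continuous_measurable_rV.
  rewrite (_ : volume_density g = (fun x => h (sqn x))); first exact: continuous_density.
  by apply/funext => x; rewrite volume_density_gmx.
- by apply: measurable_funTS; exact: measurableT_comp.
move=> x Kx; rewrite lee_fin volume_density_gmx// indicE mem_set ?mulr1; last exact: Kr.
have [->|x0] := eqVneq x 0; first by rewrite green0 normr0 mul0r.
have ex : 0 < enorm x by rewrite enorm_gt0.
have G0 : 0 <= G x by rewrite ltW// green_gt0.
have c0' : 0 <= c * enorm x / enorm x ^+ n.
  by rewrite divr_ge0 ?exprn_ge0 ?enorm_ge0// mulr_ge0// ltW.
rewrite (ger0_norm G0) (ger0_norm c0').
have h0 : 0 <= h (sqn x) by rewrite ltW// density_sqn_gt0.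
apply: (@le_trans _ _ ((a * enorm x) ^- (n - 2) * 1)).
  apply: ler_pM => //; last exact: density_sqn_le1.
  by apply: green_profile_le => //; rewrite enorm_sqr.
have -> : enorm x ^+ n = enorm x ^+ (n - 2) * enorm x ^+ 2 by rewrite -exprD subnK.
have -> : (a * enorm x) ^- (n - 2) * 1 =
    a ^- (n - 2) * enorm x * enorm x / (enorm x ^+ (n - 2) * enorm x ^+ 2).
  by rewrite exprMn invfM mulr1; field; rewrite !expf_neq0 ?gt_eqF.
rewrite ler_wpM2r ?invr_ge0 ?mulr_ge0 ?exprn_ge0 ?(ltW ex)// ler_wpM2r ?(ltW ex)//.
by rewrite ler_wpM2l// ltW// Kr.
Qed.

Lemma green_pole : (fun x => G x / dist g 0 x `^ (2 - n%:R)) @ (0 : 'rV[R]_n)^' --> (1 : R).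
Proof.
have cp : (fun x => p (sqn x) ^- (n - 2)) @ (0 : 'rV[R]_n)^' --> (1 : R).
  rewrite -(invr1 R) -(expr1n R (n - 2)) -(height0 a); apply: cvgV.
    by rewrite height0 expr1n oner_eq0.
  apply: cvg_within_filter.
  have cs : sqn x @[x --> (0 : 'rV[R]_n)] --> (0 : R).
    by have := @continuous_sqn R n 0; rewrite /continuous_at sqn0.
  have cp : p t @[t --> (0 : R)] --> p 0 by exact: (smooth_continuous (smooth_height a) (ltrN10 _)).
  have cpn := cvg_comp _ _ (cvg_comp _ _ cs cp) (@exprn_continuous R (n - 2) (p 0)).
  exact: cpn.
apply: cvg_trans cp; apply: near_eq_cvg; near=> x.
have x0 : x != 0 by near: x; exact: nbhs_dnbhs_neq.
have ex : 0 < enorm x by rewrite enorm_gt0.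
have p0 : 0 < p (sqn x) by exact: height_gt0.
rewrite dist0// green_enorm// -opprB -natrB// powR_invn ?(ltW ex)//.
by rewrite exprMn; field; rewrite !expf_neq0// gt_eqF.
Unshelve. all: by end_near. Qed.

Lemma green_function_green : green_function g 0 G.
Proof.
split.
- by apply/smooth_onE; exact: smooth_green.
- exact: locally_integrable_green.
- move=> phi /test_function_supported[r r0 sphi].
  have [IG E] := green_identity a0 a1 n4 r0 sphi.
  transitivity (\int[lam]_x - (G x * \sum_i partial i (flux a phi i) x)).
    by apply: eq_Rintegral => x _; rewrite -laplacian_flux//; ring.
  have -> : \int[lam]_x - (G x * \sum_i partial i (flux a phi i) x) =
      - \int[lam]_x (G x * \sum_i partial i (flux a phi i) x).
    under eq_Rintegral do rewrite -mulN1r.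
    by rewrite RintegralZl// mulN1r.
  by rewrite /Rintegral E /= opprK unit_sphere_areaE.
- exact: green_pole.
Qed.

(** The metric is Euclidean in the radial direction. *)
Lemma grad_radial (f : 'rV[R]_n -> R) x c : (forall i, partial i f x = c * x 0 i) ->
  grad g f x = c *: x.
Proof.
move=> fx; apply/rowP => i; rewrite gradE// mxE fx /euler.
under eq_bigr do rewrite fx mulrCA -expr2.
rewrite -mulr_sumr -/(sqn x).
have AB := tangential_radial m a0 a1 (sqnD x).
have An0 : tangential a m (sqn x) != 0 by rewrite gt_eqF// tangential_gt0.
transitivity (c * x 0 i * ((tangential a m (sqn x))^-1 *
    (1 - sqn x * radial a m (sqn x)))); first by ring.
by rewrite -AB addrK mulVf// mulr1.
Qed.

(** In geodesic polar coordinates b is the function r p(r^2), and its radial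
    derivative is the slope. *)
Lemma grad_sqnorm_green x : x != 0 ->
  grad_sqnorm g (fun x => G x `^ (1 / (2 - n%:R))) x = slope a (sqn x) ^+ 2.
Proof.
move=> x0; pose t := sqn x; have t0 : 0 < t by rewrite sqn_gt0.
have Dt := sqnD x; have pt0 := height_gt0 a0 a1 Dt.
have E : (fun x => G x `^ (1 / (2 - n%:R))) = (fun x => (sqn x * p (sqn x) ^+ 2) `^ 2^-1).
  apply/funext => y; rewrite /green /green_profile -powRrM; congr (_ `^ _).
  field; rewrite subr_eq0 eqr_nat; by move: n4; case: eqP => // <-.
have dp : is_derive t 1 p ('D_1 p t) by exact: (smooth_is_derive tt (smooth_height a) Dt).
have i0 : 0 < t * p t ^+ 2 by rewrite mulr_gt0// exprn_gt0.
have d := isd_comp (isd_mul (isd_id t) (isd_sqr dp)) (is_derive1_powR 2^-1 i0).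
have hE := heightE a Dt; rewrite -/t in hE.
pose c := slope a t * t `^ (- 2^-1).
have gx : grad g (fun x => G x `^ (1 / (2 - n%:R))) x = c *: x.
  apply: grad_radial => i; rewrite E; apply: isd_partial.
  apply: (isd_eq (isd_radial _ d)); rewrite dot_delta.
  have -> : 2^-1 - 1 = - 2^-1 :> R by field.
  rewrite powRM ?sqr_ge0 ?(ltW t0)//.
  have -> : (p t ^+ 2) `^ (- 2^-1) = (p t)^-1.
    rewrite -powR_mulrn ?(ltW pt0)// -powRrM mulrN divff ?powR_inv1 ?(ltW pt0)//.
  rewrite /c -hE; field; by rewrite gt_eqF.
rewrite /grad_sqnorm gx inner_gmx dotZr dotZl dotZr -sqnE -/t.
have AB := tangential_radial m a0 a1 Dt; rewrite -/t in AB.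
transitivity (c ^+ 2 * t * (tangential a m t + t * radial a m t)); first by ring.
rewrite AB mulr1 /c exprMn -mulrA -[RHS]mulr1; congr (_ * _).
by rewrite -powR_mulrn ?powR_ge0// -powRrM mulNr mulVf// powR_inv1 ?(ltW t0)// mulVf// gt_eqF.
Qed.

End green_function.
(** * Bump functions *)

Section flatexp.
Context {R : realType}.
Implicit Types (t : R) (m k : nat).

(** These functions are stable under differentiation up to linear
    combinations, hence all smooth; [flatexp 0] is exp (-1/t) extended by 0. *)
Definition flatexp m t : R := if 0 < t then t ^- m * expR (- t^-1) else 0.

(** From exp s >= s^(m+2) / (m+2)! at s = 1/t. A quadratic bound is what makes
    the derivative at 0 exist and vanish. *)
Lemma flatexp_bound m t : `|flatexp m t| <= (m.+2)`!%:R * t ^+ 2.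
Proof.
rewrite /flatexp; case: ifP => t0; last by rewrite normr0 mulr_ge0// sqr_ge0.
have f0 : 0 < (m.+2)`!%:R :> R by rewrite ltr0n fact_gt0.
have ti : 0 < t^-1 by rewrite invr_gt0.
rewrite ger0_norm ?mulr_ge0 ?expR_ge0 ?invr_ge0 ?exprn_ge0 ?(ltW t0)//.
have E : (t^-1) ^+ m.+2 / (m.+2)`!%:R <= expR t^-1.
  by apply: le_trans (expR_ge1Dxn m.+1 (ltW ti)); rewrite lerDr.
rewrite expRN ler_pdivrMr ?expR_gt0//.
apply: (@le_trans _ _ ((m.+2)`!%:R * t ^+ 2 * ((t^-1) ^+ m.+2 / (m.+2)`!%:R))).
  rewrite le_eqVlt; apply/orP; left; apply/eqP.
  rewrite exprVn -addn2 exprD; field.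
  by rewrite !expf_neq0 ?gt_eqF// ?f0//.
by rewrite ler_pM2l// mulr_gt0// exprn_gt0.
Qed.

Lemma is_derive_flatexp m t : is_derive t 1 (flatexp m) (- m%:R * flatexp m.+1 t + flatexp m.+2 t).
Proof.
have [t0|t0|->] := ltgtP t 0.
- have nt : \forall s \near t, s < 0 by exact: lt_nbhsl.
  rewrite /flatexp !(ltNge 0) (ltW t0)/= mulr0 addr0.
  apply: near_eq_is_derive (isd_cst 0 t 1).
  by apply: filterS nt => s s0; rewrite ltNge (ltW s0).
- have nt : \forall s \near t, 0 < s by exact: lt_nbhsr.
  have d1 := isd_mul (is_derive1_powR (- m%:R) t0)
    (isd_comp (isd_opp (isd_inv (isd_id t) (lt0r_neq0 t0))) (is_derive_expR (- t^-1))).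
  have nf : \near t, t `^ (- m%:R) * expR (- t^-1) = if 0 < t then t ^- m * expR (- t^-1) else 0.
    by apply: filterS nt => s s0; rewrite s0 powR_invn// ltW.
  apply: (isd_eq (near_eq_is_derive nf d1)); rewrite /flatexp t0.
  have -> : - m%:R - 1 = - m.+1%:R :> R by rewrite -natr1; ring.
  rewrite !powR_invn ?(ltW t0)//.
  by rewrite !exprS; field; rewrite expf_neq0 gt_eqF.
rewrite /flatexp ltxx mulr0 addr0.
have cv : h^-1 *: ((flatexp m \o shift 0) (h *: 1) - flatexp m 0) @[h --> (0 : R)^'] --> (0 : R).
  apply/cvgr0Pnorm_le => e e0; near=> h.
  have h0 : h != 0 by near: h; exact: nbhs_dnbhs_neq.
  rewrite /= addr0 [h%:A]mulr1 {2}/flatexp ltxx subr0 normrM normfV.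
  rewrite ler_pdivrMl ?normr_gt0//.
  have f0 : 0 < (m.+2)`!%:R :> R by rewrite ltr0n fact_gt0.
  apply: (le_trans (flatexp_bound m h)); rewrite -real_normK ?num_real// expr2 mulrA mulrC.
  rewrite ler_pM2l ?normr_gt0// mulrC -ler_pdivlMr//.
  by near: h; apply: dnbhs0_le; rewrite divr_gt0.
by split; [apply/cvg_ex; eexists; exact: cv|exact/cvg_lim].
Unshelve. all: by end_near. Qed.

Lemma smooth_flatexp m : smooth1 setT (flatexp m).
Proof.
move=> k; elim: k m => [|k IH] m.
all: have c t : setT t -> {for t, continuous (flatexp m)} by
  move=> _; exact: is_derive_continuous (is_derive_flatexp m t).
  by split.
apply: (CkSI openT c (df := fun _ t => - m%:R * flatexp m.+1 t + flatexp m.+2 t)) => [i t _|i].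
  exact: is_derive_flatexp.
by apply: (Ck_add openT) => //; apply: (Ck_mul openT) => //; exact: Ck_cst openT.
Qed.

End flatexp.

Section bump.
Context {R : realType} {n : nat}.
Implicit Types (x y : 'rV[R]_n) (d r : R).

Definition bump x d y : R := flatexp 0 (d ^+ 2 - sqn (y - x)).

Lemma bump_ge0 x d y : 0 <= bump x d y.
Proof. by rewrite /bump /flatexp; case: ifP => // _; rewrite mulr_ge0 ?expR_ge0// invr_ge0. Qed.

Lemma bump_gt0 x d : 0 < d -> 0 < bump x d x.
Proof.
move=> d0; rewrite /bump subrr sqn0 subr0 /flatexp exprn_gt0//.
by rewrite mulr_gt0 ?expR_gt0// expr0 invr1.
Qed.

Lemma bump_eq0 x d y : 0 < d -> d <= enorm (y - x) -> bump x d y = 0.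
Proof.
move=> d0 dy; rewrite /bump /flatexp ltNge subr_le0 -enorm_sqr.
by rewrite ler_pXn2r// ?nnegrE ?enorm_ge0 ?(ltW d0)// dy.
Qed.

Lemma smooth_bump x d : smooth cdirs setT (bump x d).
Proof.
have E y : d ^+ 2 - (sqn y + 2 * dot (- x) y + sqn x) = d ^+ 2 - sqn (y - x).
  by rewrite sqnD [dot y _]dotC; congr (_ - (_ + _)); rewrite sqnE [RHS]sqnE dotNr dotC dotNr opprK.
have s : smooth cdirs setT (fun y => d ^+ 2 - sqn (y - x)).
  apply: (smooth_ext openT (f := fun y => d ^+ 2 - (sqn y + 2 * dot (- x) y + sqn x))) => [y _//|].
  apply: (smooth_sub openT); first exact: smooth_cst openT.
  apply: (smooth_add openT); last exact: smooth_cst openT.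
  apply: (smooth_add openT); first exact: smooth_sqn openT.
  apply: (smooth_mul openT); first exact: smooth_cst openT.
  rewrite /dot; apply: smooth_sum => [|i]; first exact: openT.
  by apply: (smooth_mul openT); [exact: smooth_cst openT|exact: smooth_coord openT].
exact: (smooth_comp openT openT (smooth_flatexp 0) s).
Qed.

Lemma test_function_bump x d : 0 < d -> test_function (bump x d).
Proof.
move=> d0; split; first by apply/smooth_onE; exact: smooth_bump.
apply: (subclosed_compact _ (@compact_cball R n (enorm x + d))).
  exact: closed_closure.
have cB : closed [set y : 'rV[R]_n | enorm y <= enorm x + d].
  rewrite (_ : mkset _ = enorm @^-1` [set t | t <= enorm x + d])//.
  by apply: closed_comp; [move=> y _; exact: continuous_enorm|exact: closed_le].
move/closure_id : cB => ->; apply: closureS => y /=.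
apply: contraTT; rewrite -ltNge => h.
have := enormD (y - x) x; rewrite subrK => h'.
by rewrite negbK bump_eq0//; lra.
Qed.

End bump.
(** * Distributional solutions are classical *)

Section cutoff.
Context {R : realType} {n : nat}.
Implicit Types (x y : 'rV[R]_n) (f psi : 'rV[R]_n -> R) (r : R) (U V : set 'rV[R]_n).

Lemma smooth_union U V f : smooth cdirs U f -> smooth cdirs V f -> smooth cdirs (U `|` V) f.
Proof.
move=> sU sV k; have := sV k; have := sU k; elim: k f {sU sV} => [|k IH] f [cU hU] [cV hV].
all: split; first by move=> x [/cU|/cV].
  by [].
move=> i; have [dU kU] := hU i; have [dV kV] := hV i.
by split; [move=> x [/dU|/dV]|exact: IH].
Qed.

Definition vanishing r f := forall x, enorm x < r -> f x = 0.

Lemma open_eball r : open (@eball R n r).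
Proof.
rewrite (_ : eball r = enorm @^-1` [set t | t < r])//.
by apply: open_comp; [move=> x _; exact: continuous_enorm|exact: open_lt].
Qed.

Lemma vanishing_partial r f i : vanishing r f -> vanishing r (partial i f).
Proof.
move=> vf x xr; rewrite /partial -[RHS](derive_cst (0 : R) x (delta_mx 0 i)).
apply: near_eq_derive.
have nx : \forall y \near x, enorm y < r.
  by apply: open_nbhs_nbhs; split; [exact: open_eball|].
by apply: filterS nx => y; exact: vf.
Qed.

(** The singularity of f at the origin is harmless where psi vanishes. *)
Lemma smooth_cutoff psi f r : 0 < r -> smooth cdirs setT psi -> vanishing r psi ->
  smooth cdirs (~` [set 0]) f -> smooth cdirs setT (fun x => psi x * f x).
Proof.
move=> r0 sp vp sf.
have -> : setT = (~` [set 0]) `|` eball r :> set 'rV[R]_n.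
  apply/seteqP; split => // x _; have [->|x0] := eqVneq x 0; last by left; exact/eqP.
  by right; rewrite /eball/= /enorm sqn0 sqrtr0.
apply: smooth_union.
  apply: (smooth_mul open_off0) => //; exact: smooth_sub_set sp.
have oB := @open_eball r.
have E x : eball r x -> 0 = psi x * f x by move=> xr; rewrite vp// mul0r.
exact: (smooth_ext oB E (smooth_cst _ (0 : R) oB)).
Qed.

Lemma integral_gt0 f x r : continuous f -> (forall y, 0 <= f y) -> 0 < f x ->
  (0 < \int[@lebesgue_rV R n]_y (f y)%:E)%E.
Proof.
move=> cf f0 fx; pose e := f x / 2; have e0 : 0 < e by rewrite divr_gt0.
have /cvgr_gt/(_ e _)/nbhs_normP[] := @cf x; first by rewrite ltr_pdivrMr// mulr_natr mulr2n ltrDl.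
move=> d /= d0 Hd.
pose B := affine 1 (- x) @^-1` eball d.
have mB : measurable B.
  by rewrite -[B]setTI; apply: measurable_affine => //; exact: measurable_eball.
have BE y : B y -> enorm (y - x) < d by rewrite /B/= /affine scale1r.
apply: (@lt_le_trans _ _ (\int[@lebesgue_rV R n]_y (e * \1_B y)%:E)%E); last first.
  apply: ge0_le_integral => //.
  - by move=> y _; rewrite lee_fin mulr_ge0// ltW.
  - by apply/measurable_EFinP; apply: measurable_funM => //; exact: measurable_indic.
  - exact: continuous_measurable_EFin.
  move=> y _; rewrite lee_fin indicE; case: (boolP (y \in B)) => [|_]; last by rewrite mulr0.
  rewrite inE mulr1 => /BE yd; apply/ltW/Hd; rewrite /= distrC.
  exact: le_lt_trans (norm_le_enorm _) yd.
under eq_integral do rewrite EFinM.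
rewrite ge0_integralZl_EFin ?(ltW e0)//; last by apply/measurable_EFinP; exact: measurable_indic.
rewrite integral_indic// setIT mule_gt0//.
apply: (@lt_le_trans _ _ (d ^+ n * unit_ball_volume n)%:E).
  by rewrite lte_fin mulr_gt0 ?exprn_gt0// unit_ball_volume_gt0.
rewrite le_eqVlt; apply/orP; left; apply/eqP; rewrite mulrC -lebesgue_eballE//.
have := lebesgue_rV_affine (- x) ltr01 (@measurable_eball R n d).
by rewrite expr1n invr1 mul1e => <-.
Qed.

End cutoff.

Section harmonic.
Context {R : realType} {n : nat}.
Variable a : R.
Hypotheses (a0 : 0 < a) (a1 : a < 1) (n4 : (4 <= n)%N).
Local Notation lam := (@lebesgue_rV R n).
Local Notation m := (@warp_exp R n).
Local Notation g := (@gmx R n a m).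
Implicit Types (x y : 'rV[R]_n) (f phi H : 'rV[R]_n -> R).

(** The Laplacian times the volume density, by [laplacian_flux]. *)
Definition div_flux f x : R := \sum_i partial i (@flux R n a f i) x.

Lemma smooth_div_flux U f : open U -> smooth cdirs U f -> smooth cdirs U (div_flux f).
Proof.
move=> oU sf; rewrite /div_flux; apply: smooth_sum => [//|i].
by apply: smooth_partial; exact: smooth_flux.
Qed.

Lemma flux_sym f phi x :
  \sum_i partial i phi x * flux a f i x = \sum_i partial i f x * flux a phi i x.
Proof.
pose A := tangential a m (sqn x); pose B := radial a m (sqn x); pose h := density a n (sqn x).
have E f1 f2 : \sum_i partial i f1 x * flux a f2 i x =
    h * A^-1 * (\sum_i partial i f1 x * partial i f2 x) - h * (B / A) * euler f1 x * euler f2 x.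
  transitivity (\sum_i (h * A^-1 * (partial i f1 x * partial i f2 x) -
      h * (B / A) * euler f2 x * (x 0 i * partial i f1 x))).
    by apply: eq_bigr => i _; rewrite /flux gradE// -/A -/B -/h; ring.
  rewrite sumrB -!mulr_sumr -/(euler f1 x); ring.
rewrite (E f phi) (E phi f) [h * (B / A) * euler f x * _]mulrAC; congr (_ * _ - _).
by apply: eq_bigr => i _; rewrite mulrC.
Qed.

Variables (H : 'rV[R]_n -> R).
Hypotheses (sH : smooth cdirs (~` [set 0]) H).
Hypothesis wH : forall phi, test_function phi -> phi 0 = 0 ->
  \int[lam]_x (H x * - laplacian g phi x * volume_density g x) = 0.

(** Integrating the divergence of the compactly supported field
    H flux(phi) - phi flux(H), whose first-order terms cancel by [flux_sym]. *)
Let symmetric_pairing phi r d : 0 < d -> smooth_supported r phi -> vanishing d phi ->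
  test_function phi -> (\int[lam]_x (phi x * div_flux H x)%:E = 0)%E.
Proof.
move=> d0 [sp sr spi] vp tp.
have r1 : r < r + 1 by rewrite ltrDl.
have sW i : smooth cdirs setT (flux a phi i) by apply: smooth_flux => //; exact: openT.
have sWH i : smooth cdirs (~` [set 0]) (flux a H i) by apply: smooth_flux => //; exact: open_off0.
have suppW i : supported r (flux a phi i).
  by move=> x xr; rewrite /flux gradE// spi// /euler big1 ?mulr0 ?subr0 ?mulr0// => j _; rewrite spi ?mulr0.
have vW i : vanishing d (flux a phi i).
  move=> x xd; have v j : partial j phi x = 0 by exact: (vanishing_partial j vp).
  by rewrite /flux gradE// v /euler big1 ?mulr0 ?subr0 ?mulr0// => j _; rewrite v mulr0.
have sL : smooth cdirs setT (div_flux phi) by apply: smooth_div_flux => //; exact: openT.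
have suppL : supported (r + 1) (div_flux phi).
  by move=> x xr; rewrite /div_flux big1// => i _; exact: (supported_partial i r1 (suppW i) xr).
have vL : vanishing d (div_flux phi).
  by move=> x xd; rewrite /div_flux big1// => i _; exact: (vanishing_partial i (vW i)).
have sLH : smooth cdirs (~` [set 0]) (div_flux H) by apply: smooth_div_flux => //; exact: open_off0.
have s1 := smooth_cutoff d0 sL vL sH.
have s2 := smooth_cutoff d0 sp vp sLH.
have I1 : lam.-integrable setT (EFin \o (fun x => div_flux phi x * H x)).
  apply: (integrable_continuous_supported (continuous_smooth s1) (r := r + 1)).
  by move=> x xr; rewrite suppL// mul0r.
have I2 : lam.-integrable setT (EFin \o (fun x => phi x * div_flux H x)).
  apply: (integrable_continuous_supported (continuous_smooth s2) (r := r)).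
  by move=> x xr; rewrite sr// mul0r.
pose K i x := flux a phi i x * H x - phi x * flux a H i x.
have sK i : smooth cdirs setT (K i).
  by apply: (smooth_sub openT); [exact: (smooth_cutoff d0)|exact: (smooth_cutoff d0)].
have suppK i : supported r (K i) by move=> x xr; rewrite /K suppW// sr// !mul0r subr0.
have dK x : \sum_i partial i (K i) x = div_flux phi x * H x - phi x * div_flux H x.
  have [->|x0] := eqVneq x 0.
    have e0 : enorm (0 : 'rV[R]_n) < d by rewrite /enorm sqn0 sqrtr0.
    rewrite vL// vp// !mul0r subr0 big1// => i _.
    apply: (vanishing_partial i (r := d)) => // y yd.
    by rewrite /K vW// vp// !mul0r subr0.
  have Ux : (~` [set 0]) x by exact/eqP.
  have dphi i := smooth_is_derive i sp (I : setT x).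
  have dKi i : is_derive x (delta_mx 0 i) (K i) (partial i (flux a phi i) x * H x +
      flux a phi i x * partial i H x - (partial i phi x * flux a H i x + phi x * partial i (flux a H i) x))
    := isd_sub (isd_mul (smooth_is_derive i (sW i) (I : setT x)) (smooth_is_derive i sH Ux))
     (isd_mul (dphi i) (smooth_is_derive i (sWH i) Ux)).
  transitivity (\sum_i (partial i (flux a phi i) x * H x - phi x * partial i (flux a H i) x
      + (partial i H x * flux a phi i x - partial i phi x * flux a H i x))).
    apply: eq_bigr => i _; apply: isd_partial; apply: (isd_eq (dKi i)).
    move: (partial i (flux a phi i) x) (partial i H x) (partial i phi x) (partial i (flux a H i) x).
    move: (flux a phi i x) (flux a H i x) (H x) (phi x) => z1 z2 z3 z4 z5 z6 z7 z8; ring.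
  rewrite big_split/= !sumrB flux_sym subrr addr0 -mulr_suml -mulr_sumr//.
have := integral_divergence0 sK suppK.
under eq_integral do rewrite dK EFinB.
rewrite integralB_EFin//.
have p0 : phi 0 = 0 by apply: vp; rewrite /enorm sqn0 sqrtr0.
have -> : (\int[lam]_x (div_flux phi x * H x)%:E = 0)%E.
  rewrite -[LHS]fineK; last exact: integrable_fin_num.
  congr _%:E; have := wH tp p0.
  rewrite (_ : \int[lam]_x _ = \int[lam]_x (- 1 * (div_flux phi x * H x))); last first.
    by apply: eq_Rintegral => x _; rewrite /div_flux -laplacian_flux//; ring.
  by rewrite RintegralZl// mulN1r => /eqP; rewrite oppr_eq0 => /eqP.
by rewrite sub0e => /eqP; rewrite oppe_eq0 => /eqP.
Qed.

Let div_flux_sign (s : R) x : x != 0 -> s * div_flux H x <= 0.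
Proof.
move=> x0; rewrite leNgt; apply/negP => pos.
have ex : 0 < enorm x by rewrite enorm_gt0.
have Ux : (~` [set 0]) x by exact/eqP.
have sLH : smooth cdirs (~` [set 0]) (fun y => s * div_flux H y).
  by apply: (smooth_mul open_off0); [exact: smooth_cst open_off0|apply: smooth_div_flux => //; exact: open_off0].
have /cvgr_gt/(_ 0 pos)/nbhs_normP[d' /= d'0 Hd] := smooth_continuous sLH Ux.
pose d := Num.min d' (enorm x / 2).
have d0 : 0 < d by rewrite lt_min d'0 divr_gt0.
have dd : d <= d' by rewrite ge_min lexx.
have dx : d <= enorm x / 2 by rewrite ge_min lexx orbT.
have tb := test_function_bump x d0.
have [r r0 sb] := test_function_supported tb.
have vb : vanishing (enorm x / 2) (bump x d).
  move=> y yd; apply: bump_eq0 => //; have := enormD (x - y) y; rewrite subrK.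
  by rewrite -[x - y]opprB -scaleN1r enormZ normrN normr1 mul1r; lra.
have ed0 : 0 < enorm x / 2 by rewrite divr_gt0.
have E := symmetric_pairing ed0 sb vb tb.
have sLH' : smooth cdirs (~` [set 0]) (div_flux H) by apply: smooth_div_flux => //; exact: open_off0.
have [sp _ _] := sb.
have s2 := smooth_mul openT (smooth_cst _ s openT) (smooth_cutoff ed0 sp vb sLH').
have : (0 < \int[lam]_y (s * (bump x d y * div_flux H y))%:E)%E.
  apply: (integral_gt0 (x := x) 0 (continuous_smooth s2)) => [y|].
    have [yd|yd] := leP d (enorm (y - x)); first by rewrite bump_eq0// mul0r mulr0.
    rewrite mulrCA; apply: (mulr_ge0 (bump_ge0 _ _ _)); apply: ltW; apply: Hd => /=.
    by apply: lt_le_trans dd; rewrite distrC; exact: le_lt_trans (norm_le_enorm _) yd.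
  by rewrite mulrCA mulr_gt0// bump_gt0.
under eq_integral do rewrite EFinM.
rewrite integralZl//; first by rewrite E mule0 ltxx.
have s3 := smooth_cutoff ed0 sp vb sLH'; have [_ sr _] := sb.
apply: (integrable_continuous_supported (continuous_smooth s3) (r := r)).
by move=> y yr; rewrite sr// mul0r.
Qed.

(** If the Laplacian of H were nonzero at x, it would keep its sign on a small
    ball; against a bump function supported there, Green's second identity would
    contradict that H solves the equation weakly. *)
Lemma div_flux_eq0 x : x != 0 -> div_flux H x = 0.
Proof.
move=> x0; have := div_flux_sign 1 x0; have := div_flux_sign (- 1) x0; lra.
Qed.

End harmonic.
(** * The maximum principle *)

Section second_order.
Context {R : realType}.

(** A negative second derivative would make f decrease on the right of 0. *)
Lemma second_derivative_min (f f1 : R -> R) (q e : R) : 0 < e ->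
  (forall s : R, `|s| < e -> is_derive s 1 f (f1 s)) ->
  (forall s : R, `|s| < e -> f 0 <= f s) -> is_derive (0 : R) 1 f1 q -> f1 0 = 0 /\ 0 <= q.
Proof.
move=> e0 df fmin dq.
have z0 : f1 0 = 0.
  apply: (is_derive_unique (df 0 _)); first by rewrite normr0.
  apply: (derive1_at_min (a := - e) (b := e)) => [|s|/=|s].
  - by rewrite ge0_cp// ltW.
  - by rewrite in_itv/= -ltr_norml => /df [].
  - by rewrite in_itv/= oppr_lt0 e0.
  - by rewrite in_itv/= -ltr_norml => /fmin.
split => //; rewrite leNgt; apply/negP => q0.
have [dv vq] := dq.
have cv : h^-1 *: ((f1 \o shift 0) (h *: 1) - f1 0) @[h --> (0 : R)^'] --> q by rewrite -vq; exact: dv.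
have /cvgr_lt/(_ 0 q0)/nbhs_normP[d /= d0 Hd] := cv.
pose t := Num.min d e / 2.
have m0 : 0 < Num.min d e by rewrite lt_min d0.
have t0 : 0 < t by rewrite divr_gt0.
have td : t < d by rewrite /t ltr_pdivrMr// (@le_lt_trans _ _ d)// ?ge_min ?lexx// mulr_natr mulr2n ltrDl.
have te : t < e by rewrite /t ltr_pdivrMr// (@le_lt_trans _ _ e)// ?ge_min ?lexx ?orbT// mulr_natr mulr2n ltrDl.
have dt s : s \in `]0, t[ -> is_derive s 1 f (f1 s).
  by rewrite in_itv/= => /andP[s0 st]; apply: df; rewrite ger0_norm ?ltW// (lt_trans st).
have ct : {within `[0, t], continuous f}.
  apply: continuous_in_subspaceT => s; rewrite inE/= in_itv/= => /andP[s0 st].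
  have ds : is_derive s 1 f (f1 s) by apply: df; rewrite ger0_norm// (le_lt_trans st).
  exact: is_derive_continuous ds.
have [s] := MVT t0 dt ct.
rewrite in_itv/= subr0 => /andP[s0 st] E.
have : f1 s < 0.
  have := Hd s; rewrite /= sub0r normrN ger0_norm ?(ltW s0)// => /(_ (lt_trans st td)).
  rewrite gt_eqF// => /(_ isT); rewrite addr0 [s%:A]mulr1 z0 subr0.
  by rewrite /GRing.scale/= pmulr_rlt0// invr_gt0.
have := fmin t; rewrite ger0_norm ?(ltW t0)// => /(_ te); rewrite -subr_ge0 E.
by rewrite pmulr_lge0// => h1 h2; have := le_lt_trans h1 h2; rewrite ltxx.
Qed.

End second_order.

Section interior_minimum.
Context {R : realType} {n : nat}.
Implicit Types (x c w : 'rV[R]_n) (u : 'rV[R]_n -> R) (U : set 'rV[R]_n).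

Definition hess u c w : R := \sum_i w 0 i * \sum_j w 0 j * partial j (partial i u) c.

Lemma interior_min U u c w : open U -> smooth cdirs U u -> U c -> (forall y, U y -> u c <= u y) ->
  \sum_i w 0 i * partial i u c = 0 /\ 0 <= hess u c w.
Proof.
move=> oU su Uc umin.
have [e /= e0 He] : exists2 e : R, 0 < e & forall s : R, `|s| < e -> U (c + s *: w).
  have cl : {for (0 : R), continuous (fun s : R => c + s *: w)}.
    by apply: cvgD; [exact: cvg_cst|apply: cvgZr_tmp; exact: cvg_id].
  have : nbhs ((fun s : R => c + s *: w) 0) U.
    by apply: open_nbhs_nbhs; split => //; rewrite scale0r addr0.
  move=> /cl /nbhs_normP[e e0 He]; exists e => // s se; apply: He.
  by rewrite /= sub0r normrN.
have H := second_derivative_min (f := fun s : R => u (c + s *: w))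
  (f1 := fun s : R => \sum_i w 0 i * partial i u (c + s *: w)) (q := hess u c w) e0.
have [|||H1 H2] := H.
- by move=> s se; apply: is_derive_line; exact: (smooth_directional w oU su (He s se)).
- by move=> s se; rewrite scale0r addr0; exact: umin (He s se).
- apply: (isd_sum (df := fun i => w 0 i * \sum_j w 0 j * partial j (partial i u) c)) => i.
  apply: isd_cmul; apply: is_derive_line; rewrite scale0r addr0.
  exact: (smooth_directional w oU (smooth_partial i su) Uc).
by move: H1; rewrite scale0r addr0.
Qed.

(** If the Hessian at c is nonnegative, its trace is at least its value in the
    direction of c: both sides are compared by evaluating it on the vectors
    |c|^2 e_k - c_k c. *)
Lemma trace_hess u c : (forall w, 0 <= hess u c w) ->
  hess u c c <= sqn c * \sum_i partial i (partial i u) c.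
Proof.
move=> hp; have [->|c0] := eqVneq c 0.
  by rewrite /hess sqn0 mul0r big1// => i _; rewrite mxE mul0r.
pose t := sqn c; have t0 : 0 < t by rewrite sqn_gt0.
rewrite -subr_ge0 -(pmulr_rge0 _ t0).
pose M i j := partial j (partial i u) c.
pose w k : 'rV[R]_n := \row_i (t * (k == i)%:R - c 0 k * c 0 i).
suff -> : t * (t * (\sum_i M i i) - hess u c c) = \sum_k hess u c (w k).
  by apply: sumr_ge0 => k _; exact: hp.
have S i j : \sum_k w k 0 i * w k 0 j = t * (t * (i == j)%:R - c 0 i * c 0 j).
  transitivity (\sum_k (t * (t * ((k == i)%:R * (k == j)%:R)) - t * c 0 j * ((k == i)%:R * c 0 k)
     - t * c 0 i * ((k == j)%:R * c 0 k) + c 0 i * c 0 j * c 0 k ^+ 2)).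
    by apply: eq_bigr => k _; rewrite !mxE; ring.
  rewrite big_split/= !sumrB -!mulr_sumr (sum_delta_r (fun k => (k == j)%:R) i).
  rewrite (sum_delta_r (fun k => c 0 k) i) (sum_delta_r (fun k => c 0 k) j) -/(sqn c) -/t; ring.
transitivity (\sum_i \sum_j (\sum_k w k 0 i * w k 0 j) * M i j).
  transitivity (\sum_i \sum_j (t * (t * ((i == j)%:R * M i j)) - t * (c 0 i * (c 0 j * M i j)))).
    rewrite mulrBr /hess !mulr_sumr -sumrB; apply: eq_bigr => i _.
    by rewrite sumrB -!mulr_sumr sum_delta.
  by apply: eq_bigr => i _; apply: eq_bigr => j _; rewrite S; ring.
symmetry; transitivity (\sum_k \sum_i \sum_j w k 0 i * w k 0 j * M i j).
  apply: eq_bigr => k _; apply: eq_bigr => i _.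
  by rewrite mulr_sumr; apply: eq_bigr => j _; rewrite mulrA.
rewrite exchange_big/=; apply: eq_bigr => i _.
by rewrite exchange_big/=; apply: eq_bigr => j _; rewrite mulr_suml.
Qed.

End interior_minimum.
(** * Minimality of the Green function *)

Lemma isd_exp {R : realType} (f : R -> R) (t d : R) k : is_derive t 1 f d ->
  is_derive t 1 (fun s => f s ^+ k) (k%:R * f t ^+ k.-1 * d).
Proof.
move=> df; elim: k => [|k IH]; first by apply: (isd_eq (isd_cst 1 t 1)); rewrite !mul0r.
have -> : (fun s => f s ^+ k.+1) = (fun s => f s * f s ^+ k) by apply/funext => s; rewrite exprS.
apply: (isd_eq (isd_mul df IH)); rewrite /= -natr1.
by case: k {IH} => [|k]; rewrite /= ?exprS; ring.
Qed.

Lemma sum_swap {R : realType} {n : nat} (c : 'rV[R]_n) (M : 'I_n -> 'I_n -> R) :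
  \sum_i c 0 i * (\sum_j c 0 j * M i j) = \sum_i c 0 i * (\sum_j c 0 j * M j i).
Proof.
transitivity (\sum_i \sum_j c 0 i * c 0 j * M i j).
  by apply: eq_bigr => i _; rewrite mulr_sumr; apply: eq_bigr => j _; rewrite mulrA.
rewrite exchange_big; apply: eq_bigr => i _; rewrite mulr_sumr.
by apply: eq_bigr => j _; rewrite mulrA [c 0 j * _]mulrC.
Qed.

Section minimality.
Context {R : realType} {n : nat}.
Variable a : R.
Hypotheses (a0 : 0 < a) (a1 : a < 1) (n4 : (4 <= n)%N).
Local Notation m := (@warp_exp R n).
Local Notation g := (@gmx R n a m).
Local Notation h := (density a n).
Local Notation A := (tangential a m).
Local Notation B := (radial a m).
Local Notation D := [set t : R | -1 < t].
Local Notation G := (@green R n a).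
Local Notation L := (@div_flux R n a).
Implicit Types (x y c : 'rV[R]_n) (u f : 'rV[R]_n -> R) (U : set 'rV[R]_n) (i : 'I_n) (r t k e : R).

Let n2 : (2 <= n)%N. Proof. exact: leq_trans n4. Qed.
Let m0 := @warp_exp_gt0 R n n4.
Let m3 := @warp_exp_le R n n4.
Let sqnD x : D (sqn x).
Proof. by rewrite /= (lt_le_trans (ltrN10 _))// sqn_ge0. Qed.
Let oD : open D. Proof. exact: open_gtm1. Qed.
Let A0 t : D t -> 0 < A t. Proof. exact: tangential_gt0. Qed.
Let h0 x : 0 < h (sqn x). Proof. exact: density_sqn_gt0. Qed.
Let sh : smooth1 D h. Proof. exact: (smooth_exp n.-1 oD (smooth_warp m a0 a1)). Qed.

Lemma div_flux_lin U f1 f2 k x : open U -> smooth cdirs U f1 -> smooth cdirs U f2 -> U x ->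
  L (fun y => f1 y + k * f2 y) x = L f1 x + k * L f2 x.
Proof.
move=> oU s1 s2 Ux; rewrite /div_flux mulr_sumr -big_split/=; apply: eq_bigr => i _.
have sf1 : smooth cdirs U (flux a f1 i) by exact: smooth_flux.
have sf2 : smooth cdirs U (flux a f2 i) by exact: smooth_flux.
have d : is_derive x (delta_mx 0 i) (fun y => flux a f1 i y + k * flux a f2 i y)
    (partial i (flux a f1 i) x + k * partial i (flux a f2 i) x)
  := isd_add (smooth_is_derive i sf1 Ux) (isd_cmul k (smooth_is_derive i sf2 Ux)).
rewrite -(isd_partial d); apply: near_eq_derive.
have nU : \forall y \near x, U y by apply: open_nbhs_nbhs; split.
apply: filterS nU => y Uy.
have pE j : partial j (fun y => f1 y + k * f2 y) y = partial j f1 y + k * partial j f2 y.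
  apply: isd_partial.
  exact: (isd_add (smooth_is_derive j s1 Uy) (isd_cmul k (smooth_is_derive j s2 Uy))).
have eE : euler (fun y => f1 y + k * f2 y) y = euler f1 y + k * euler f2 y.
  rewrite /euler mulr_sumr -big_split/=; apply: eq_bigr => j _; rewrite pE; ring.
by rewrite /flux !gradE// pE eE; ring.
Qed.

Lemma div_flux_cst k x : L (fun=> k) x = 0.
Proof.
rewrite /div_flux big1// => i _.
have -> : flux a (fun=> k) i = (fun=> 0).
  apply/funext => y; have pE j : partial j (fun=> k) y = 0 by exact: derive_cst.
  by rewrite /flux gradE// pE /euler big1 ?mulr0 ?subr0 ?mulr0// => j _; rewrite pE mulr0.
exact: derive_cst.
Qed.

(** The squared distance to the pole is strictly subharmonic, the warping
    function f being nondecreasing. *)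
Lemma div_flux_sqn_gt0 x : 0 < L sqn x.
Proof.
pose w := warp a m; pose w1 t := 'D_1 w t; pose t := sqn x; have Dt := sqnD x.
have dw : is_derive t 1 w (w1 t) := smooth_is_derive tt (smooth_warp m a0 a1) Dt.
have dh : is_derive t 1 h (n.-1%:R * w t ^+ n.-2 * w1 t).
  exact: (isd_exp n.-1 dw).
have E i : flux a sqn i = (fun y => h (sqn y) * (2 * y 0 i)).
  apply/funext => y; rewrite /flux (grad_radial a0 a1 (c := 2)) ?mxE// => j.
  by rewrite -dot_delta; apply: isd_partial; exact: isd_sqn.
have -> : L sqn x = \sum_i (4 * (n.-1%:R * w t ^+ n.-2 * w1 t) * x 0 i ^+ 2 + 2 * h t).
  rewrite /div_flux; apply: eq_bigr => i _; rewrite E; apply: isd_partial.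
  apply: (isd_eq (isd_mul (isd_radial (delta_mx 0 i) dh) (isd_cmul 2 (isd_coord x (delta_mx 0 i) i)))).
  rewrite dot_delta mxE !eqxx/= mulr1 -/t; move: (w1 t) (w t ^+ n.-2) (h t) => z1 z2 z3; ring.
rewrite big_split/= -mulr_sumr -/(sqn x) -/t sumr_const card_ord -[_ *+ n]mulr_natr.
have hE : h t = w t ^+ n.-2 * w t by rewrite /density -exprSr; congr (_ ^+ _); move: n2; case: (n) => [|[|]].
have wt : 0 < w t by exact: warp_gt0.
have dw0 := dwarp_ge0 a0 a1 m0 (sqn_ge0 x).
have nE : n%:R = n.-1%:R + 1 :> R by rewrite natr1 prednK// (leq_trans _ n2).
have -> : 4 * (n.-1%:R * w t ^+ n.-2 * w1 t) * t + 2 * h t * n%:R =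
    2 * w t ^+ n.-2 * (n.-1%:R * dwarp a m t + w t).
  by rewrite hE nE /dwarp -/w -/(w1 t); ring.
by rewrite mulr_gt0 ?mulr_gt0 ?exprn_gt0// ltr_wpDl// mulr_ge0.
Qed.

Let fluxE u i : flux a u i = (fun y => h (sqn y) * (A (sqn y))^-1 * partial i u y -
  h (sqn y) * (A (sqn y))^-1 * B (sqn y) * y 0 i * euler u y).
Proof.
apply/funext => y; rewrite /flux (gradE a0 a1).
move: (h (sqn y)) (A (sqn y))^-1 (B (sqn y)) (partial i u y) (y 0 i) (euler u y) => z1 z2 z3 z4 z5 z6.
ring.
Qed.

(** At a critical point the Laplacian is the trace of the Hessian against the
    inverse metric (1/A)(I - B c c^T), where B |c|^2 = 1 - A. *)
Lemma div_flux_min U u c : open U -> smooth cdirs U u -> U c -> (forall y, U y -> u c <= u y) ->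
  c != 0 -> 0 <= L u c.
Proof.
move=> oU su Uc umin c0; pose t := sqn c; have t0 : 0 < t by rewrite sqn_gt0.
have crit i : partial i u c = 0.
  have [+ _] := interior_min (delta_mx 0 i) oU su Uc umin.
  rewrite (eq_bigr (fun j => (i == j)%:R * partial j u c)) ?sum_delta// => j _.
  by rewrite mxE eqxx eq_sym.
have hp w : 0 <= hess u c w by have [_] := interior_min w oU su Uc umin.
have eu0 : euler u c = 0 by rewrite /euler big1// => i _; rewrite crit mulr0.
have sA := smooth_mul oD sh (smooth_inv oD (smooth_tangential m a0 a1) A0).
have sB := smooth_mul oD sA (smooth_radial m a0 a1).
pose k1 y := h (sqn y) * (A (sqn y))^-1; pose k2 y := k1 y * B (sqn y).
have sk1 : smooth cdirs U k1.
  by exact: (smooth_radial_fun oU oD sA (fun x _ => sqnD x)).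
have sk2 : smooth cdirs U k2.
  by exact: (smooth_radial_fun oU oD sB (fun x _ => sqnD x)).
have seu := smooth_euler oU su.
have hs : hess u c c = \sum_i c 0 i * \sum_j c 0 j * partial i (partial j u) c.
  exact: (sum_swap c (fun i j => partial j (partial i u) c)).
have E : L u c = k1 c * (\sum_i partial i (partial i u) c - B t * hess u c c).
  rewrite mulrBr mulrA -/(k2 c) hs !mulr_sumr -sumrB; apply: eq_bigr => i _.
  rewrite (fluxE u i : _ = (fun y => k1 y * partial i u y - k2 y * y 0 i * euler u y)).
  have de : partial i (euler u) c = \sum_j c 0 j * partial i (partial j u) c.
    apply: isd_partial; apply: isd_eq.
      apply: isd_sum => j.
      exact: (isd_mul (isd_coord c (delta_mx 0 i) j) (smooth_is_derive i (smooth_partial j su) Uc)).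
    by apply: eq_bigr => j _; rewrite /= (crit j : 'D_(cdirs j) u c = 0) mulr0 add0r.
  apply: isd_partial; apply: isd_eq.
    apply: isd_sub.
      exact: (isd_mul (smooth_is_derive i sk1 Uc) (smooth_is_derive i (smooth_partial i su) Uc)).
    exact: (isd_mul (isd_mul (smooth_is_derive i sk2 Uc) (isd_coord c (delta_mx 0 i) i)) (smooth_is_derive i seu Uc)).
  rewrite /= (crit i : 'D_(cdirs i) u c = 0) eu0 (de : 'D_(cdirs i) (euler u) c = _).
  by rewrite !mulr0 !add0r -mulrA.
have tr := trace_hess hp; rewrite -/t in tr.
have AB := tangential_radial m a0 a1 (sqnD c); rewrite -/t in AB.
have At := A0 (sqnD c); rewrite -/t in At.
have k10 : 0 < k1 c := divr_gt0 (h0 c) At.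
have tB : t * B t = 1 - A t by rewrite -AB addrC addKr.
rewrite E (pmulr_rge0 _ k10) -(pmulr_rge0 _ t0) mulrBr mulrA tB mulrBl mul1r subr_ge0.
by apply: le_trans tr; rewrite gerBl; exact: (mulr_ge0 (ltW At) (hp c)).
Qed.

Section comparison.
Variable H : 'rV[R]_n -> R.
Hypotheses (gH : green_function g 0 H) (pH : positive_off 0 H).

Let sH : smooth cdirs (~` [set 0]) H. Proof. by have [/smooth_onE] := gH. Qed.
Let sG : smooth cdirs (~` [set 0]) G. Proof. exact: smooth_green. Qed.

Let weak F : green_function g 0 F -> forall phi, test_function phi -> phi 0 = 0 ->
  \int[@lebesgue_rV R n]_x (F x * - laplacian g phi x * volume_density g x) = 0.
Proof. by move=> [_ _ E _] phi tp p0; rewrite E// p0 mulr0. Qed.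

(** Below any multiple k < 1 of G near the pole, H stays above it on large
    balls after subtracting the boundary value of G; delta |x|^2 makes the
    difference strictly superharmonic. *)
Let comparison k r d x : 0 < k -> k < 1 -> 0 < d -> x != 0 -> enorm x < r ->
  0 <= H x - k * (G x - green_profile a n (r ^+ 2)) + d * (r ^+ 2 - sqn x).
Proof.
move=> k0 k1 d0 x0 xr; have ex : 0 < enorm x by rewrite enorm_gt0.
have r0 : 0 < r by exact: lt_trans xr.
pose gr := green_profile a n (r ^+ 2).
have gr0 : 0 < gr by apply: green_profile_gt0 => //; rewrite exprn_gt0.
pose u y := H y - k * (G y - gr) + d * (r ^+ 2 - sqn y).
pose s y := dist g 0 y `^ (2 - n%:R).
have s0 y : y != 0 -> 0 < s y by move=> y0; rewrite powR_gt0// dist0// enorm_gt0.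
have [e /= e0 He] : exists2 e : R, 0 < e & forall y, y != 0 -> enorm y < e -> k * G y < H y.
  have cH : (fun y => H y / s y) @ (0 : 'rV[R]_n)^' --> (1 : R) by have [_ _ _] := gH.
  have cG : (fun y => G y / s y) @ (0 : 'rV[R]_n)^' --> (1 : R) by exact: green_pole.
  have cK : (fun y => H y / s y - k * (G y / s y)) @ (0 : 'rV[R]_n)^' --> 1 - k * 1.
    by apply: cvgB => //; apply: cvgM => //; exact: cvg_cst.
  have /cvgr_gt/(_ 0 _)/nbhs_normP[] := cK; first by rewrite mulr1 subr_gt0.
  move=> e e0 He; exists e => // y y0 ye; have := He y; rewrite /= sub0r normrN => /(_ _ y0).
  rewrite mulrA -mulrBl pmulr_lgt0 ?invr_gt0 ?s0// subr_gt0; apply.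
  exact: le_lt_trans (norm_le_enorm _) ye.
pose rho := Num.min (e / 2) (enorm x).
have rho0 : 0 < rho by rewrite lt_min ex divr_gt0.
have rhox : rho <= enorm x by rewrite ge_min lexx orbT.
have rhoe : rho < e.
  by rewrite (@le_lt_trans _ _ (e / 2))// ?ge_min ?lexx// ltr_pdivrMr// mulr_natr mulr2n ltrDl.
pose K := [set y : 'rV[R]_n | rho <= enorm y <= r].
have Kn0 y : K y -> y != 0 by move=> /andP[h1 _]; rewrite -enorm_gt0 (lt_le_trans rho0).
have cK : compact K.
  apply: (subclosed_compact _ (@compact_cball R n r)); last by move=> y /andP[].
  rewrite (_ : K = enorm @^-1` [set t | rho <= t] `&` enorm @^-1` [set t | t <= r]); last first.
    by apply/seteqP; split => y /=; [move=> /andP[]|move=> [h1 h2]; rewrite /K/= h1].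
  by apply: closedI; apply: closed_comp; try exact: closed_le; try exact: closed_ge; move=> y _; exact: continuous_enorm.
have oV := @open_off0 R n.
have sN : smooth cdirs (~` [set (0 : 'rV[R]_n)]) sqn by exact: smooth_sqn.
have s1 := smooth_add oV sH (smooth_mul oV (smooth_cst cdirs (- k) oV) sG).
have s2 := smooth_add oV s1 (smooth_mul oV (smooth_cst cdirs (- d) oV) sN).
have s3 := smooth_add oV (smooth_cst cdirs (k * gr + d * r ^+ 2) oV) (smooth_mul oV (smooth_cst cdirs 1 oV) s2).
have uE : u = (fun y => (k * gr + d * r ^+ 2) + 1 * (H y + - k * G y + - d * sqn y)).
  by apply/funext => y; rewrite /u; ring.
have su : smooth cdirs (~` [set 0]) u by rewrite uE.
have Kx : K x by rewrite /K/= rhox ltW.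
have cu : {within K, continuous u}.
  apply: continuous_in_subspaceT => y; rewrite inE => /Kn0/eqP y0.
  exact: (smooth_continuous su y0).
have [c] := EVT_min_rV (ex_intro _ x Kx) cK cu.
rewrite inE => Kc minc.
apply: (@le_trans _ _ (u c)); last by apply: minc; rewrite inE.
have c0 := Kn0 c Kc; have /andP[] := Kc; rewrite le_eqVlt => /orP[/eqP rc _|rc].
  have hc : k * G c < H c by apply: He => //; rewrite -rc.
  have : 0 <= d * (r ^+ 2 - sqn c).
    rewrite mulr_ge0 ?(ltW d0)// subr_ge0 -enorm_sqr -rc.
    rewrite ler_pXn2r ?nnegrE ?(ltW rho0) ?(ltW r0)//.
    exact: le_trans (ltW xr).
  have : 0 <= k * gr by rewrite mulr_ge0 ?ltW.
  rewrite /u mulrBr; lra.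
rewrite le_eqVlt => /orP[/eqP cr|cr].
  have -> : u c = H c.
    by rewrite /u -enorm_sqr /green -enorm_sqr cr -/gr !subrr !mulr0 subr0 addr0.
  by rewrite ltW// pH.
pose U := [set y : 'rV[R]_n | rho < enorm y] `&` eball r.
have oU : open U by apply: openI; [exact: open_enorm_gt|exact: open_eball].
have UV : U `<=` ~` [set 0].
  by move=> y [/= h1 _]; apply/eqP; rewrite -enorm_gt0 (lt_trans rho0).
have Vc : (~` [set 0]) c by exact/eqP.
have E : L u c = - d * L sqn c.
  rewrite uE (div_flux_lin 1 oV (smooth_cst cdirs _ oV) s2 Vc) div_flux_cst.
  rewrite (div_flux_lin (- d) oV s1 sN Vc) (div_flux_lin (- k) oV sH sG Vc).
  rewrite (div_flux_eq0 a0 a1 n4 sH (weak gH) c0).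
  rewrite (div_flux_eq0 a0 a1 n4 sG (weak (green_function_green a0 a1 n4)) c0).
  by rewrite mulr0 !add0r mul1r.
have umin y : U y -> u c <= u y.
  by move=> [h1 h2]; apply: minc; rewrite inE; apply/andP; split; exact: ltW.
have := div_flux_min oU (smooth_sub_set UV su) (conj rc cr) umin c0.
rewrite E mulNr oppr_ge0 (pmulr_rle0 _ d0) => F.
by have := lt_le_trans (div_flux_sqn_gt0 c) F; rewrite ltxx.
Qed.

(** The comparison function vanishes with d, and the boundary value of G tends
    to 0 on large spheres; then k tends to 1. *)
Lemma green_le x : x != 0 -> G x <= H x.
Proof.
move=> x0; have Gx := green_gt0 a0 a1 x0; have Hx := pH x0.
have step k : 0 < k -> k < 1 -> k * G x <= H x.
  move=> k0 k1; apply/ler_addgt0Pr => e e0; have e2 : 0 < e / 2 by rewrite divr_gt0.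
  near (+oo : set_system R) => r.
  have xr : enorm x < r by near: r; apply: nbhs_pinfty_gt; exact: num_real.
  have gr : green_profile a n (r ^+ 2) <= e / 2 by near: r; exact: green_profile_infty.
  have r0 : 0 < r by apply: le_lt_trans xr; exact: enorm_ge0.
  have gr0 : 0 < green_profile a n (r ^+ 2) by apply: green_profile_gt0 => //; rewrite exprn_gt0.
  have rx : 0 < r ^+ 2 - sqn x.
    by rewrite subr_gt0 -enorm_sqr ltr_pXn2r ?nnegrE ?enorm_ge0 ?(ltW r0).
  have d0 : 0 < e / 2 / (r ^+ 2 - sqn x) by rewrite divr_gt0.
  have := comparison k0 k1 d0 x0 xr; rewrite divfK ?gt_eqF// mulrBr.
  have : k * green_profile a n (r ^+ 2) <= green_profile a n (r ^+ 2) by rewrite ler_piMl ?ltW.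
  lra.
rewrite leNgt; apply/negP => HG.
(* For this k the number k G x is the midpoint of H x and G x. *)
have k0 : 0 < (H x + G x) / (2 * G x) by rewrite divr_gt0 ?addr_gt0 ?mulr_gt0.
have k1 : (H x + G x) / (2 * G x) < 1 by rewrite ltr_pdivrMr ?mulr_gt0// mul1r; lra.
have := step _ k0 k1.
have -> : (H x + G x) / (2 * G x) * G x = (H x + G x) / 2 by field; rewrite gt_eqF.
by lra.
Unshelve. all: by end_near. Qed.

End comparison.

Lemma minimal_positive_green_green : minimal_positive_green g 0 G.
Proof.
split; [exact: green_function_green|by move=> x; exact: green_gt0|].
by move=> H gH pH x; exact: green_le.
Qed.


End minimality.
Theorem theorem1p1 (R : realType) (n : nat) (a : R)
    (hn : (4 <= n)%N) (ha0 : 0 < a) (ha1 : a < 1) :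
  exists g : 'rV[R]_n -> 'M[R]_n,
    [/\ riemannian_metric g, complete_metric g & rotationally_symmetric g] /\
    [/\ nonneg_sectional g /\ ~ flat g,
        (volume g (geodesic_ball g 0 r) *
           ((unit_ball_volume n * r ^+ n)^-1)%:E)%E @[r --> +oo]
          --> (a ^+ (n - 2))%:E /\ 0 < a ^+ (n - 2),
        exists G : 'rV[R]_n -> R,
          minimal_positive_green g 0 G /\
          let b := fun x => G x `^ (1 / (2 - n%:R)) in
          (forall x, x != 0 ->
             let r := dist g 0 x in
             grad_sqnorm g b x = ((1 + a * r ^+ 2) / (1 + r ^+ 2)) ^+ 2) /\
          exists F : 'rV[R]_n -> R,
            smooth_on setT F /\ (forall x, x != 0 -> F x = grad_sqnorm g b x) &
        [/\ scalar_curvature g 0 = 2 * n%:R * (n%:R - 4) * (1 - a),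
            (5 <= n)%N -> 0 < scalar_curvature g 0 &
            n = 4%N -> scalar_curvature g 0 = 0 /\ ~ flat g]].
Proof.
pose m : R := warp_exp n.
have m0 : 0 < m := warp_exp_gt0 hn; have m3 : m <= 3^-1 := warp_exp_le hn.
have n1 : (1 < n)%N by exact: leq_trans hn.
have notflat : ~ flat (@gmx R n a m) := not_flat_gmx ha0 ha1 m0 m3 n1.
have scal : scalar_curvature (@gmx R n a m) 0 = 2 * n%:R * (n%:R - 4) * (1 - a).
  rewrite scalar_curvature_gmx// /m /warp_exp.
  have -> : n%:R = n.-1%:R + 1 :> R by rewrite natr1 prednK// ltnW.
  have p0 : n.-1%:R != 0 :> R by rewrite pnatr_eq0 -lt0n -subn1 subn_gt0.
  by field.
exists (gmx a m); split; first split.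
- exact (gmx_metric ha0 ha1 m0 m3).
- exact (complete_gmx ha0 ha1 m0 m3).
- exact (gmx_rotationally_symmetric a m).
have grad_b (x : 'rV[R]_n) : x != 0 ->
    grad_sqnorm (gmx a m) (fun x => green a x `^ (1 / (2 - n%:R))) x = slope a (sqn x) ^+ 2.
  by move=> x0; exact: (grad_sqnorm_green ha0 ha1 hn x0).
split.
- by split; [exact (nonneg_sectional_gmx ha0 ha1 m0 m3)|].
- by split; [exact (volume_ratio ha0 ha1 hn)|exact: exprn_gt0].
- exists (green a); split; first exact (minimal_positive_green_green ha0 ha1 hn).
  split => [x x0 /=|]; first by rewrite grad_b// dist0// enorm_sqr.
  exists (fun x => slope a (sqn x) ^+ 2); split => [|x x0]; last by rewrite grad_b.
  apply/smooth_onE.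
  have ss := smooth_exp 2 open_gtm1 (smooth_slope a).
  have dom x : [set: 'rV[R]_n] x -> [set t : R | -1 < t] (sqn x).
    by move=> _; rewrite /= (lt_le_trans (ltrN10 _))// sqn_ge0.
  exact: (smooth_radial_fun openT open_gtm1 ss dom).
- split => // [n5|n4].
    have n40 : 0 < n%:R - 4 :> R by rewrite subr_gt0 ltr_nat.
    have np : 0 < n%:R :> R by rewrite ltr0n ltnW.
    have ap : 0 < 1 - a by rewrite subr_gt0.
    by rewrite scal !mulr_gt0.
  by rewrite scal {2}n4 subrr mulr0 mul0r.
Qed.
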